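(* Let $X_1,X_2,\ldots$ be independent exponential random variables with mean $1$, and let $$J=\sum_{j=1}^{\infty}(2^j-1)^{-1}X_j .$$ Then, as $t\to+0$, $$\mathbb{P}(J\le t)\sim\frac{\sqrt{\log 2}\,\prod_{j=1}^{\infty}(1-2^{-j})^2}{2^{1/8}\,2\pi\,\tilde{\vartheta}_3(\mathrm{frac}\{\psi(t)\})}\exp\Big\{-\frac{\log 2}{2}[\psi(t)]^2\Big\}\,t^{-(1/2+1/\log 2)},$$ where $$\psi(t)=(\log 2)^{-1}\big[\log(1/t)+\log\log(1/t)-\log\log 2\big]$$ and $$\tilde{\vartheta}_3(\theta)=1+2\sum_{k=1}^{\infty}\exp\{-2k^2\pi^2/\log 2\}\cos\{2k\pi(1/2-\theta)\}.$$
   Context: $\log$ is the natural logarithm; $\mathrm{frac}(x)=x-\lfloor x\rfloor$ is the fractional part of $x$; $f(t)\sim g(t)$ as $t\to+0$ means $f(t)/g(t)\to1$ as $t$ decreases to $0$. *)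

(* Defs.v *)
From HB Require Import structures.
From mathcomp Require Import all_boot all_order all_algebra.
From mathcomp Require Import all_classical all_reals all_analysis.

Set Implicit Arguments.
Unset Strict Implicit.
Unset Printing Implicit Defensive.

Import Order.TTheory GRing.Theory Num.Theory.
Import numFieldNormedType.Exports.

Local Open Scope classical_set_scope.
Local Open Scope ring_scope.

(* Mutual independence: the product rule over every finite subfamily, given
   by a duplicate-free list of indices. *)
Definition independent_RVs (d : measure_display) (T : measurableType d)
    (R : realType) (P : probability T R) (X : nat -> {RV P >-> R}) : Prop :=
  forall (s : seq nat) (B : nat -> set R),
    uniq s -> (forall i, measurable (B i)) ->
    P (\bigcap_(i in [set` s]) (X i @^-1` B i)) =
    (\prod_(i <- s) P (X i @^-1` B i))%E.

(* [exponential_prob] is parametrised by the rate, the inverse of the mean. *)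
Definition exponential_RV (d : measure_display) (T : measurableType d)
    (R : realType) (P : probability T R) (mean : R) (Y : {RV P >-> R}) : Prop :=
  forall V : set R, measurable V ->
    distribution P Y V = exponential_prob mean^-1 V.

(* The sequence is indexed from 0, so [X j] plays the role of $X_{j+1}$. The
   sum is taken in the extended reals; where the partial sums have no limit
   there (a null event) it takes the default value of [lim]. *)
Definition J (d : measure_display) (T : measurableType d)
    (R : realType) (P : probability T R) (X : nat -> {RV P >-> R}) (w : T) :
    \bar R :=
  (\sum_(0 <= j <oo) ((2 ^+ j.+1 - 1)^-1 * X j w)%:E)%E.

Definition frac_part (R : realType) (x : R) : R := x - (Num.floor x)%:~R.

Definition psi (R : realType) (t : R) : R :=
  (ln 2)^-1 * (ln (1 / t) + ln (ln (1 / t)) - ln (ln 2)).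

Definition theta3 (R : realType) (theta : R) : R :=
  1 + 2 * limn (fun n => \sum_(1 <= k < n)
    expR (- (2 * k%:R ^+ 2 * pi ^+ 2 / ln 2))
      * cos (2 * k%:R * pi * (1 / 2 - theta))).

Definition euler_prod_sq (R : realType) : R :=
  limn (fun n => \prod_(1 <= j < n) ((1 - 2 ^- j) ^+ 2 : R)).

Definition J_asymp (R : realType) (t : R) : R :=
  Num.sqrt (ln 2) * euler_prod_sq R
    / (2 `^ (1 / 8) * (2 * pi) * theta3 (frac_part (psi t)))
  * expR (- (ln 2 / 2 * psi t ^+ 2)) * t `^ (- (1 / 2 + 1 / ln 2)).

(* Main.v *)
From HB Require Import structures.
Require Import Defs.
From mathcomp Require Import all_boot all_order all_algebra.
From mathcomp Require Import all_classical all_reals all_analysis.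
From mathcomp Require Import measurable_realfun ring lra zify.

Set Implicit Arguments.
Unset Strict Implicit.
Unset Printing Implicit Defensive.

Import Order.TTheory GRing.Theory Num.Theory.
Import numFieldNormedType.Exports.

Local Open Scope classical_set_scope.
Local Open Scope ring_scope.

(** Split J at n, the integer part of log_2 (1/t) + (1/2) log_2 log_2 (1/t).
    The head a_1 X_1 + ... + a_n X_n has a distribution function close to
    C_n x^n / n! near 0. With s = n/t this is C_n t^n e^(-s (t - x)) / n! at
    the relevant scale, and exponentials are eigenfunctions of the convolution
    with an exponential law, so that adding the tail divides by the product of
    the 1 + s a_j, j > n. Up to 1 + o(1) this product is Euler's
    prod_(i >= 1) (1 + r 2^-i) with r = s 2^-n, whose expansion into powers of r
    is asymptotic, as r tends to infinity, to a complete theta series. Poisson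
    summation turns the latter into theta3, and Stirling's formula deals with n!.

    The Poisson summation formula for Gaussians comes from the return
    probabilities of the simple random walk on a cycle of length 2H+1 at a time
    proportional to H^2, computed by counting paths and by diagonalization.
    The case where the two theta series coincide gives Stirling's constant. *)

(** The term (1/2) log_2 log_2 (1/t) in the choice of n balances two relative errors. Replacing the
    head's distribution function by a power costs about 2^n t / n; replacing that power by an
    exponential before the tail is added costs about 1 / (2^n t). With 2^n t of order sqrt (log
    (1/t)), both are of order log (1/t)^(-1/2). The rate s = n/t is the saddle point: x^n e^(-s x)
    is largest at x = t, so the exponential touches the power exactly where the bound is finally
    evaluated. No transform is inverted: every bound is a pointwise inequality between functions,
    and convolution with an exponential law preserves it. The oscillating factor appears because n
    is an integer while log_2 r is not. Up to a vanishing shift log_2 r equals psi(t) - n, and since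
    the theta series has period 1, n drops out and only the fractional part of psi(t) is left. *)

(** * Independence: from rectangles to all measurable sets of the plane *)

Section independence.
Context (d : measure_display) (T : measurableType d) (R : realType).
Variable P : probability T R.

Let rectangles := [set A `*` B | A in (measurable : set (set R))
                             & B in (measurable : set (set R))].

(** As functions of [C], both sides are finite measures that agree on the pi-system of measurable
    rectangles, which generates the product sigma-algebra. *)
Lemma pair_event_indep (U V : T -> R) (E : set T) :
  measurable_fun setT U -> measurable_fun setT V -> measurable E ->
  (forall A B, measurable A -> measurable B ->
     P (U @^-1` A `&` V @^-1` B `&` E) = (P (U @^-1` A `&` V @^-1` B) * P E)%E) ->
  forall C : set (R * R), measurable C ->
    P ((fun w => (U w, V w)) @^-1` C `&` E) =
    (P ((fun w => (U w, V w)) @^-1` C) * P E)%E.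
Proof.
move=> mU mV mE UVE C mC.
have mUV : measurable_fun setT (fun w => (U w, V w)) by exact: measurable_fun_pair.
have pE0 : 0 <= fine (P E) by exact: fine_ge0.
pose UV w := (U w, V w).
pose m1 : {measure set (R * R) -> \bar R} :=
  pushforward (mrestr P mE) UV.
pose m2  : {measure set (R * R) -> \bar R} :=
  mscale (NngNum pE0) (pushforward P UV).
have PE : P E = (fine (P E))%:E by rewrite fineK// fin_num_measure.
have m12 : m1 mUV C = m2 mUV C.
  apply: (@measure_unique _ R _ rectangles (fun=> setT)) => //.
  - exact: measurable_prod_measurableType.
  - move=> _ _ [A1 mA1 [A2 mA2 <-]] [B1 mB1 [B2 mB2 <-]].
    exists (A1 `&` B1); first exact: measurableI.
    by exists (A2 `&` B2); [exact: measurableI|rewrite setXI].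
  - by move=> _; exists setT => //; exists setT => //; rewrite setXTT.
  - by rewrite bigcup_const.
  - move=> _ [A mA [B mB <-]].
    rewrite /m1 /m2 /= /pushforward /mscale/= /mrestr -PE.
    have -> : UV @^-1` (A `*` B) = U @^-1` A `&` V @^-1` B by [].
    by rewrite UVE// muleC.
  - move=> _; rewrite /m1 /= /pushforward /mrestr preimage_setT setTI.
    by rewrite (le_lt_trans (probability_le1 P mE)) ?ltry.
by move: m12; rewrite /m1 /m2 /= /pushforward /mscale/= /mrestr -PE muleC.
Qed.

End independence.

(** Independence makes the joint law the product law. The product [\x^] is by definition an integral
    over the second coordinate, and uniqueness on rectangles identifies it with [\x]. *)
Lemma indep_pair_law (d d1 d2 : measure_display) (T : measurableType d)
    (T1 : measurableType d1) (T2 : measurableType d2) (R : realType)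
    (P : probability T R) (U : {mfun T >-> T1}) (V : {mfun T >-> T2}) :
  (forall A B, measurable A -> measurable B ->
     P (U @^-1` A `&` V @^-1` B) = (P (U @^-1` A) * P (V @^-1` B))%E) ->
  forall C : set (T1 * T2), measurable C ->
    P ((fun w => (U w, V w)) @^-1` C) =
    (\int[distribution P V]_y P (U @^-1` (ysection C y)))%E.
Proof.
move=> UV C mC.
have mUV : measurable_fun setT (fun w => (U w, V w)).
  by apply: measurable_fun_pair => //; exact: measurable_funP.
pose UV_mixin := isMeasurableFun.Build _ _ _ _ _ mUV.
pose W : {mfun T >-> (T1 * T2)%type} := HB.pack (fun w => (U w, V w)) UV_mixin.
have E1 : (distribution P U \x distribution P V)%E C = distribution P W C.
  by apply: product_measure_unique => // A B mA mB; exact: UV.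
have E2 : (distribution P U \x distribution P V)%E C =
          (distribution P U \x^ distribution P V)%E C.
  by apply: product_measure_unique => // A B mA mB; rewrite /= product_measure2E.
by transitivity (distribution P W C) => //; rewrite -E1 E2 /product_measure2.
Qed.



(** * Adding an independent exponential variable: the convolution formula *)

Section exponential.
Context {R : realType}.
Local Notation mu := (@lebesgue_measure R).

(** The Radon-Nikodym derivative of the law and [exponential_pdf] have the same integral over every
    measurable set, hence agree almost everywhere. The bounds on [f] give the integrability that the
    change of variables asks for. *)
Lemma ge0_integral_exponential_prob (f : measurableTypeR R -> \bar R) :
  measurable_fun setT f -> (forall x, 0 <= f x <= 1)%E ->
  (\int[exponential_prob (1 : R)]_x f x =
   \int[mu]_(x in `[0%R, +oo[) (f x * (expR (- x))%:E))%E.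
Proof.
move=> mf f01.
have r0 : (0 : R) < 1 by [].
have mpdf : measurable_fun [set: measurableTypeR R] (exponential_pdf (1 : R)).
  by have := measurable_exponential_pdf (1 : R); apply.
pose nu0 : probability (measurableTypeR R) R := exponential_prob (1:R); pose nu := nu0 r0.
have dom : nu `<< mu.
  apply/null_content_dominatesP => A mA muA0.
  rewrite /nu /= /exponential_prob; apply: null_set_integral => //.
  apply/measurable_funTS/measurable_EFinP; exact: measurable_funTS mpdf.
transitivity (\int[mu]_x (f x * (exponential_pdf 1 x)%:E))%E.
  rewrite -[LHS]/(\int[nu]_x f x)%E.
  rewrite -(Radon_Nikodym_change_of_variables dom)//=; last first.
    apply/integrableP; split => //.
    apply: (@le_lt_trans _ _ (\int[nu]_x cst 1 x)%E).
      apply: ge0_le_integral => //=; first exact: measurableT_comp.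
      by move=> x _; have /andP[? ?] := f01 x; rewrite gee0_abs.
    by rewrite integral_cst// mul1e (le_lt_trans (probability_le1 nu measurableT)) ?ltry.
  apply: ae_eq_integral => //.
  - by apply: emeasurable_funM.
  - have /measurable_EFinP mpdfE := mpdf.
    exact (emeasurable_funM mf mpdfE).
  - apply: ae_eqe_mul2l.
    rewrite Radon_NikodymE//=; case: cid => h [h1 h2 h3].
    apply: integral_ae_eq => //.
    + by apply/measurable_EFinP; apply: mpdf.
    + by move=> E E01 mE; rewrite -h3.
rewrite [RHS]integral_mkcond; apply: eq_integral => x _.
rewrite patchE mem_setE in_itv/= andbT; case: ifPn => x0.
  by rewrite exponential_pdfE// mul1r mulN1r.
by rewrite lt0_exponential_pdf ?mule0// ltNge.
Qed.

Lemma exponential_sum_cdf (d : measure_display) (T : measurableType d)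
    (P : probability T R) (U V : {RV P >-> R}) (a x : R) :
  (forall A B, measurable A -> measurable B ->
     P (U @^-1` A `&` V @^-1` B) = (P (U @^-1` A) * P (V @^-1` B))%E) ->
  exponential_RV 1 V ->
  P [set w | U w + a * V w <= x] =
  (\int[mu]_(y in `[0%R, +oo[) (P [set w | (U w <= x - a * y)%R] * (expR (- y))%:E))%E.
Proof.
move=> UV expV; pose RR := measurableTypeR R.
have mU : measurable_fun setT (U : T -> RR) by exact: (measurable_funP U).
have mV : measurable_fun setT (V : T -> RR) by exact: (measurable_funP V).
(* [exponential_prob] is a measure on [measurableTypeR R], so both variables are repackaged with
   that codomain. *)
pose U_mixin := isMeasurableFun.Build _ _ _ _ _ mU.
pose V_mixin := isMeasurableFun.Build _ _ _ _ _ mV.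
pose U' : {mfun T >-> RR} := HB.pack (U : T -> RR) U_mixin.
pose V' : {mfun T >-> RR} := HB.pack (V : T -> RR) V_mixin.
pose C : set (RR * RR) := [set p | p.1 + a * p.2 <= x].
have mC : measurable C.
  have mf : measurable_fun setT (fun p : RR * RR => p.1 + a * p.2).
    apply: measurable_funD; first exact: (@measurable_fst _ _ RR RR).
    by apply: measurable_funM => //; exact: (@measurable_snd _ _ RR RR).
  rewrite -[C]setTI (_ : C = (fun p : RR * RR => p.1 + a * p.2) @^-1` `]-oo, x]).
    exact: mf.
  by apply/seteqP; split => p; rewrite /C/= in_itv.
have Cy (y : RR) : ysection C y = [set u | u <= x - a * y].
  by apply/seteqP; split => u; rewrite /ysection/= ?inE/= /C/= lerBrDr.
have UV' (A B : set RR) : measurable A -> measurable B ->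
  P (U' @^-1` A `&` V' @^-1` B) = (P (U' @^-1` A) * P (V' @^-1` B))%E.
  by move=> mA mB; exact: UV.
transitivity (P ((fun w => (U' w, V' w)) @^-1` C)) => //.
rewrite (indep_pair_law UV')//.
have eqV (A : set RR) : measurable A -> distribution P V' A = exponential_prob (1:R) A.
  by move=> mA; rewrite -[1 in RHS]invr1; exact: expV.
have mF : measurable_fun [set: RR] (fun y => P (U' @^-1` ysection C y)).
  exact: (measurable_fun_ysection (distribution P U')).
rewrite (eq_measure_integral (exponential_prob (1:R))); last first.
  by move=> A mA _; exact: eqV.
rewrite ge0_integral_exponential_prob//.
- by apply: eq_integral => y _; rewrite Cy.
- move=> y; rewrite measure_ge0 probability_le1//.
  by apply: measurable_funPTI; exact: measurable_ysection.
Qed.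

End exponential.

(** * Measurability of events defined by a limit that may fail to exist *)

Section measurable_lim.
Context (d : measure_display) (T : measurableType d) (R : realType).

(** Where the lower and upper limits agree, the limit is the upper limit, a measurable function.
    Elsewhere [lim] returns the constant [point], so the condition holds everywhere or nowhere. *)
Lemma measurable_limn_le (f : nat -> T -> \bar R) (t : \bar R) :
  (forall n, measurable_fun setT (f n)) ->
  measurable [set w | (limn (f ^~ w) <= t)%E].
Proof.
move=> mf.
pose sup w := limn_esup (f ^~ w); pose inf w := limn_einf (f ^~ w).
have msup : measurable_fun setT sup by exact: measurable_fun_limn_esup.
have minf : measurable_fun setT inf.
  apply: measurableT_comp => //; apply: measurable_fun_limn_esup => n.
  exact: measurableT_comp.
pose C := [set w | inf w = sup w].
have mC : measurable C by rewrite -[C]setTI; exact: measurable_eqe.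
have CE w : C w <-> cvgn (f ^~ w).
  rewrite /C/= /inf /sup; split => [|h].
    rewrite limn_einf_lim limn_esup_lim => eq_lim; apply/cvg_ex.
    exists (limn (esups (f ^~ w))).
    apply: (@squeeze_cvge _ _ _ _ (einfs (f ^~ w)) _ (esups (f ^~ w))).
    - apply: nearW => n; apply/andP; split.
        by apply: ereal_inf_lbound; exists n => /=.
      by apply: ereal_sup_ubound; exists n => /=.
    - by rewrite -eq_lim; exact: is_cvg_einfs.
    - exact: is_cvg_esups.
  by rewrite is_cvg_limn_einfE// is_cvg_limn_esupE.
have -> : [set w | (limn (f ^~ w) <= t)%E] =
    (C `&` [set w | (sup w <= t)%E]) `|` (~` C `&` [set w | ((point : \bar R) <= t)%E]).
  apply/seteqP; split => w /=.
    have [Cw|Cw] := pselect (C w).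
      by move=> h; left; split => //; rewrite /sup is_cvg_limn_esupE//; apply/CE.
    move=> h; right; split => //.
    by rewrite -(_ : limn (f ^~ w) = point)//; apply: dvgP => /CE.
  case=> -[Cw h]; first by rewrite -is_cvg_limn_esupE//; apply/CE.
  by rewrite (_ : limn (f ^~ w) = point)//; apply: dvgP => /CE.
apply: measurableU; apply: measurableI => //.
- by rewrite -[X in measurable X]setTI; exact: emeasurable_fun_infty_c.
- exact: measurableC.
- have [h|h] := boolP ((point : \bar R) <= t)%E.
    by rewrite (_ : [set _ | _] = setT)//; apply/seteqP.
  by rewrite (_ : [set _ | _] = set0)//; apply/seteqP; split => //= x; apply/negP.
Qed.

End measurable_lim.

(** * Partial sums: independence of the next term, and convergence of their laws *)

Section partial_sums.
Context (d : measure_display) (T : measurableType d) (R : realType).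
Variables (P : probability T R) (X : nat -> {RV P >-> R}) (a : nat -> R).

Definition psum (N : nat) (w : T) : R := \sum_(0 <= j < N) a j * X j w.

Lemma psumS N w : psum N.+1 w = psum N w + a N * X N w.
Proof. by rewrite /psum big_nat_recr. Qed.

Lemma measurable_psum N : measurable_fun setT (psum N).
Proof.
by apply: measurable_sum => j; apply: measurable_funM => //; exact: measurable_funP.
Qed.

Lemma measurable_psum_le N t : measurable [set w | psum N w <= t].
Proof.
have -> : [set w | psum N w <= t] = psum N @^-1` `]-oo, t].
  by apply/seteqP; split => w; rewrite /= in_itv.
by rewrite -[X in measurable X]setTI; exact: (measurable_psum N).
Qed.

Lemma measurable_bigcap_preimage (s : seq nat) (B : nat -> set R) :
  (forall i, measurable (B i)) ->
  measurable (\bigcap_(i in [set` s]) (X i @^-1` B i)).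
Proof.
by move=> mB; apply: bigcap_measurableType => // i _; exact: measurable_funPTI.
Qed.

Hypothesis X_indep : independent_RVs X.

(** The list [s] is general for the sake of the induction: splitting the last term off the sum puts
    [X N] among the other variables, and the hypothesis is applied to [N :: s]. *)
Lemma psum_indep N (s : seq nat) (B : nat -> set R) (A : set R) :
  uniq s -> {in s, forall i, (N <= i)%N} -> measurable A ->
  (forall i, measurable (B i)) ->
  P (psum N @^-1` A `&` \bigcap_(i in [set` s]) (X i @^-1` B i)) =
  (P (psum N @^-1` A) * P (\bigcap_(i in [set` s]) (X i @^-1` B i)))%E.
Proof.
elim: N s B A => [|N IH] s B A us sN mA mB.
  have -> : psum 0 = cst 0 by apply/funext => w; rewrite /psum big_geq.
  rewrite preimage_cst; case: ifPn => _.
    by rewrite setTI probability_setT mul1e.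
  by rewrite set0I measure0 mul0e.
set E := \bigcap_(i in _) _.
have mE : measurable E by exact: measurable_bigcap_preimage.
pose C : set (R * R) := [set p | A (p.1 + a N * p.2)].
have mC : measurable C.
  have mf : measurable_fun setT (fun p : R * R => p.1 + a N * p.2).
    apply: measurable_funD; first exact: (@measurable_fst _ _ R R).
    by apply: measurable_funM => //; exact: (@measurable_snd _ _ R R).
  by rewrite -[C]setTI; exact: (mf measurableT).
have -> : psum N.+1 @^-1` A = (fun w => (psum N w, X N w)) @^-1` C.
  by apply/seteqP; split => w /=; rewrite psumS.
apply: pair_event_indep => //.
  exact: measurable_psum.
move=> A' B' mA' mB'.
have Ns : N \notin s by apply/negP => /sN; rewrite ltnn.
(* The family is overridden at [N] to carry the event on [X N]; as [N] is not in [s], the event [E]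
   does not change. *)
pose B'' i := if i == N then B' else B i.
have mB'' i : measurable (B'' i) by rewrite /B''; case: ifP.
have EE : \bigcap_(i in [set` s]) (X i @^-1` B'' i) = E.
  apply: eq_bigcapr => i /= si; rewrite /B'' ifF//.
  by apply/eqP => iN; move: Ns; rewrite -iN si.
have cons_E : \bigcap_(i in [set` N :: s]) (X i @^-1` B'' i) = X N @^-1` B' `&` E.
  by rewrite bigcap_seq big_cons -bigcap_seq EE {1}/B'' eqxx.
have sing_E : \bigcap_(i in [set` [:: N]]) (X i @^-1` B'' i) = X N @^-1` B'.
  by rewrite bigcap_seq big_seq1 /B'' eqxx.
rewrite -setIA -cons_E IH//=; last 2 first.
- by rewrite Ns.
- by move=> i; rewrite inE => /predU1P[->//|/sN/ltnW].
rewrite -[in X in (_ * _ = P (_ `&` X) * _)%E]sing_E IH//; last first.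
  by move=> i; rewrite inE => /eqP ->.
have -> : P (\bigcap_(i in [set` N :: s]) X i @^-1` B'' i) =
    (P (\bigcap_(i in [set` [:: N]]) X i @^-1` B'' i) * P E)%E.
  rewrite -EE !X_indep//=; last by rewrite Ns.
  by rewrite big_cons big_seq1.
by rewrite muleA.
Qed.

Lemma psum_pair_indep N (A B : set R) : measurable A -> measurable B ->
  P (psum N @^-1` A `&` X N @^-1` B) = (P (psum N @^-1` A) * P (X N @^-1` B))%E.
Proof.
move=> mA mB; have := @psum_indep N [:: N] (fun=> B) A isT.
rewrite bigcap_seq big_seq1; apply => //.
by move=> i; rewrite inE => /eqP ->.
Qed.

Hypothesis X_exp : forall j, exponential_RV 1 (X j).

Lemma psum_cdfS N (x : R) :
  P [set w | psum N.+1 w <= x] =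
  (\int[lebesgue_measure]_(y in `[0%R, +oo[)
     (P [set w | (psum N w <= x - a N * y)%R] * (expR (- y))%:E))%E.
Proof.
pose U_mixin := isMeasurableFun.Build _ _ _ _ _ (measurable_psum N).
pose U : {RV P >-> R} := HB.pack (psum N) U_mixin.
rewrite -(@exponential_sum_cdf _ _ _ P U (X N))//; last exact: psum_pair_indep.
by under eq_set do rewrite psumS.
Qed.

Let pos := \bigcap_j [set w | 0 <= X j w].

Let measurable_pos : measurable pos.
Proof.
apply: bigcap_measurable => // j _.
rewrite (_ : [set _ | _] = X j @^-1` `[0, +oo[); first exact: measurable_funPTI.
by apply/seteqP; split => w /=; rewrite in_itv/= andbT.
Qed.

Let negligible_neg : P (~` pos) = 0%E.
Proof.
rewrite setC_bigcap; apply/eqP; rewrite eq_le measure_ge0 andbT.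
have mneg j : measurable (~` [set w | 0 <= X j w]).
  apply: measurableC.
  rewrite (_ : [set _ | _] = X j @^-1` `[0, +oo[); first exact: measurable_funPTI.
  by apply/seteqP; split => w /=; rewrite in_itv/= andbT.
have neg0 j : P (~` [set w | 0 <= X j w]) = 0%E.
  rewrite (_ : ~` _ = X j @^-1` `]-oo, 0[); last first.
    by apply/seteqP; split => w /=; rewrite in_itv/= ltNge => /negP.
  rewrite -[LHS]/(distribution P (X j) `]-oo, 0[) X_exp//.
  rewrite /exponential_prob integral0_eq// => x; rewrite /= in_itv/= => x0.
  by rewrite lt0_exponential_pdf.
apply: le_trans (measure_sigma_subadditive P mneg _ _) _.
- exact: bigcup_measurable.
- exact: subset_refl.
by rewrite eseries0 => [|n _ _]; [exact: lexx|exact: neg0].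
Qed.

Hypothesis a_ge0 : forall j, 0 <= a j.

(** Almost surely all the [X j] are nonnegative. On that event the partial sums increase to the
    series, so the events for the partial sums decrease to the event for the series, and P is
    continuous from above. *)
Lemma cvg_psum_cdf (t : R) :
  (fun N => fine (P [set w | psum N w <= t])) @ \oo -->
  fine (P [set w | (\sum_(0 <= j <oo) (a j * X j w)%:E <= t%:E)%E]).
Proof.
pose L := [set w | (\sum_(0 <= j <oo) (a j * X j w)%:E <= t%:E)%E].
have mL : measurable L.
  apply: measurable_limn_le => n.
  under eq_fun do rewrite sumEFin.
  by apply/measurable_EFinP; exact: measurable_psum.
have restr_pos A : measurable A -> P A = P (A `&` pos).
  move=> mA; rewrite [LHS](_ : _ = P (A `&` pos `|` A `&` ~` pos)); last first.
    by rewrite -setIUr setUv setIT.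
  rewrite measureU//; [|exact: measurableI| |]; last 2 first.
  - by apply: measurableI => //; exact: measurableC.
  - by rewrite setIACA setICr setI0.
  rewrite [X in (_ + X)%E](_ : _ = 0%E) ?adde0//.
  apply/eqP; rewrite eq_le measure_ge0 andbT -negligible_neg le_measure ?inE//.
  - by apply: measurableI => //; exact: measurableC.
  - exact: measurableC.
pose D N := [set w | psum N w <= t] `&` pos.
have mD N : measurable (D N) by apply: measurableI => //; exact: measurable_psum_le.
have ndS w : pos w -> nondecreasing_seq (psum ^~ w).
  move=> pw; apply/nondecreasing_seqP => n; rewrite psumS lerDl mulr_ge0//.
  exact: pw.
have capD : \bigcap_N D N = L `&` pos.
  apply/seteqP; split => w.
    move=> Dw; have pw : pos w by have [] := Dw 0%N I.
    split => //; rewrite /L/=; apply: lime_le.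
      by apply: is_cvg_nneseries => n _ _; rewrite lee_fin mulr_ge0//; exact: pw.
    apply: nearW => N; rewrite sumEFin lee_fin.
    by have [] := Dw N I.
  move=> [Lw pw] N _; split => //=.
  rewrite -lee_fin; apply: le_trans Lw; rewrite /psum -sumEFin.
  apply: nneseries_lim_ge => n _ _.
  by rewrite lee_fin mulr_ge0//; exact: pw.
have : P \o D @ \oo --> P (\bigcap_N D N).
  apply: nonincreasing_cvg_mu => //.
  - by rewrite (le_lt_trans (probability_le1 _ _)) ?ltry.
  - exact: bigcap_measurable.
  - move=> m n mn; apply/subsetPset => w [Dw pw]; split => //=.
    by apply: le_trans Dw; exact: ndS.
rewrite capD -restr_pos// => h.
apply: fine_cvg.
rewrite fineK ?fin_num_measure//.
apply: cvg_trans h; apply: near_eq_cvg; apply: nearW => N /=.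
by rewrite /D -restr_pos//; exact: measurable_psum_le.
Qed.

End partial_sums.

(** * Monotonicity of the convolution step and its action on exponentials *)

Section convolution_step.
Context {R : realType}.
Local Notation mu := (@lebesgue_measure R).

Lemma measurable_funTypeR (D : set R) (f : R -> R) : measurable_fun [set: R] f ->
  measurable_fun (D : set (measurableTypeR R)) f.
Proof.
move=> mf.
have h : measurable_fun (setT : set (measurableTypeR R)) f := mf.
exact: measurable_funTS h.
Qed.

(** If [F] is the distribution function of U, then [G] is that of U + a V, with V exponential of
    mean 1 and independent of U. *)
Definition exp_convolution (a : R) (F G : R -> R) :=
  forall x, (G x)%:E =
    (\int[mu]_(y in `[0%R, +oo[) (F (x - a * y) * expR (- y))%:E)%E.

Lemma integral_expR_scale (c r : R) : 0 < r ->
  (\int[mu]_(y in `[0%R, +oo[) (c * expR (- (r * y)))%:E = (c / r)%:E)%E.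
Proof.
move=> r0.
have pdfE : (\int[mu]_(y in `[0%R, +oo[) (exponential_pdf r y)%:E = 1)%E.
  rewrite -(integral_exponential_pdf r0) [LHS]integral_mkcond.
  apply: eq_integral => y _; rewrite patchE mem_setE in_itv/= andbT.
  by case: ifPn => // y0; rewrite lt0_exponential_pdf// ltNge.
transitivity (\int[mu]_(y in `[0%R, +oo[) ((c / r)%:E * (exponential_pdf r y)%:E))%E.
  apply: eq_integral => y; rewrite inE/= in_itv/= andbT => y0.
  by rewrite exponential_pdfE// -EFinM mulrA mulfVK ?gt_eqF// mulNr.
rewrite integralZl//=; first by rewrite pdfE mule1.
by apply: integrableS (integrable_exponential_pdf r0).
Qed.

Lemma integrable_expR_scale (c r : R) : 0 < r ->
  mu.-integrable `[0%R, +oo[ (fun y => (c * expR (- (r * y)))%:E).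
Proof.
move=> r0.
apply: (@eq_integrable _ _ _ mu _ _ (fun y => ((c / r)%:E * (exponential_pdf r y)%:E)%E)) => //.
  move=> y; rewrite inE/= in_itv/= andbT => y0.
  by rewrite exponential_pdfE// -EFinM mulrA mulfVK ?gt_eqF// mulNr.
apply: integrableZl => //.
by apply: integrableS (integrable_exponential_pdf r0).
Qed.

Variables (a : R) (F G : R -> R).
Hypothesis a_gt0 : 0 < a.
Hypothesis F01 : forall x, 0 <= F x <= 1.
Hypothesis mF : measurable_fun [set: R] F.
Hypothesis FG : exp_convolution a F G.

Let measurable_integrand x (D : set R) :
  measurable_fun (D : set (measurableTypeR R)) (fun y => F (x - a * y) * expR (- y)).
Proof.
apply: measurable_funTypeR; apply: measurable_funM.
  by apply: (measurableT_comp mF); apply: measurable_funB.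
by apply: measurableT_comp => //; exact: oppr_measurable.
Qed.

Let integrand_ge0 x y : 0 <= F (x - a * y) * expR (- y).
Proof. by have /andP[F0 _] := F01 (x - a * y); rewrite mulr_ge0 ?expR_ge0. Qed.

Lemma convolution_le (h : R -> R) (H x : R) :
  measurable_fun (`[0%R, +oo[ : set (measurableTypeR R)) h ->
  (forall y, 0 <= y -> F (x - a * y) * expR (- y) <= h y) ->
  (\int[mu]_(y in `[0%R, +oo[) (h y)%:E <= H%:E)%E -> G x <= H.
Proof.
move=> mh Fh hH; rewrite -lee_fin FG; apply: le_trans hH.
apply: ge0_le_integral => //=.
- by move=> y _; rewrite lee_fin.
- apply/measurable_EFinP. exact: measurable_integrand.
- exact/measurable_EFinP.
- by move=> y; rewrite in_itv/= andbT => y0; rewrite lee_fin Fh.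
Qed.

(** A lower bound [h] may be negative, hence the integrability hypothesis. The domain [D] is free
    because a bound by powers is only valid where x - a y is nonnegative. *)
Lemma convolution_ge (D : set (measurableTypeR R)) (h : R -> R) (H x : R) :
  measurable D -> D `<=` `[0%R, +oo[ ->
  mu.-integrable D (EFin \o h) ->
  (forall y, D y -> h y <= F (x - a * y) * expR (- y)) ->
  (H%:E <= \int[mu]_(y in D) (h y)%:E)%E -> H <= G x.
Proof.
move=> mD D0 ih hF Hh; rewrite -lee_fin FG; apply: (le_trans Hh).
have i01 : mu.-integrable `[0%R, +oo[ (EFin \o (fun y => F (x - a * y) * expR (- y))).
  apply: (@le_integrable _ _ _ mu _ _ _ (fun y => (1 * expR (- (1 * y)))%:E)) => //.
  - by apply/measurable_EFinP; exact: measurable_integrand.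
  - move=> y _; rewrite /= lee_fin !mul1r !ger0_norm ?expR_ge0//.
    by rewrite ler_piMl ?expR_ge0//; have /andP[] := F01 (x - a * y).
  - exact: integrable_expR_scale.
apply: (@le_trans _ _ (\int[mu]_(y in D) (F (x - a * y) * expR (- y))%:E)%E).
  apply: le_integral => //.
  - by apply: integrableS i01.
  - by move=> y; rewrite inE => Dy; rewrite lee_fin hF.
apply: ge0_subset_integral => //.
- by apply/measurable_EFinP; exact: measurable_integrand.
- by move=> y _; rewrite lee_fin.
Qed.

Lemma convolution_expR_le (C s : R) : 0 <= s ->
  (forall x, F x <= C * expR (s * x)) ->
  forall x, G x <= C / (1 + s * a) * expR (s * x).
Proof.
move=> s0 FC x.
have r0 : 0 < 1 + s * a by rewrite ltr_wpDr// mulr_ge0// ltW.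
apply: (@convolution_le (fun y => C * expR (s * x) * expR (- ((1 + s * a) * y)))).
- apply: measurable_funTypeR; apply: measurable_funM => //.
  by do 2 apply: measurableT_comp => //.
- move=> y y0; apply: le_trans (ler_wpM2r (expR_ge0 _) (FC _)) _.
  rewrite -!mulrA -!expRD le_eqVlt; apply/predU1P; left.
  by congr (_ * expR _); ring.
- by rewrite integral_expR_scale// lee_fin mulrAC.
Qed.

(** Two rates are carried because the lower bound for the head has an error term decaying at half
    the main rate. Bounds up to [t] suffice, since convolution only looks at x - a y <= x. *)
Lemma convolution_expR_ge (C C' s s' t : R) : 0 <= s -> 0 <= s' ->
  (forall x, x <= t -> C * expR (s * x) - C' * expR (s' * x) <= F x) ->
  forall x, x <= t ->
    C / (1 + s * a) * expR (s * x) - C' / (1 + s' * a) * expR (s' * x) <= G x.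
Proof.
move=> s0 s'0 FC x xt.
have r0 : 0 < 1 + s * a by rewrite ltr_wpDr// mulr_ge0// ltW.
have r'0 : 0 < 1 + s' * a by rewrite ltr_wpDr// mulr_ge0// ltW.
pose h y := C * expR (s * x) * expR (- ((1 + s * a) * y)).
pose h' y := C' * expR (s' * x) * expR (- ((1 + s' * a) * y)).
have ih : mu.-integrable `[0%R, +oo[ (EFin \o h) by exact: integrable_expR_scale.
have ih' : mu.-integrable `[0%R, +oo[ (EFin \o h') by exact: integrable_expR_scale.
apply: (@convolution_ge `[0%R, +oo[ (fun y => h y - h' y)) => //.
- rewrite (_ : _ \o _ = (EFin \o h) \- (EFin \o h'))%E; first exact: integrableB.
  by apply/funext => y /=; rewrite EFinB.
- move=> y; rewrite /= in_itv/= andbT => y0.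
  have xy : x - a * y <= t by rewrite (le_trans _ xt)// lerBlDr lerDl mulr_ge0// ltW.
  apply: le_trans (ler_wpM2r (expR_ge0 _) (FC _ xy)).
  rewrite mulrBl /h /h' -!mulrA -!expRD le_eqVlt; apply/predU1P; left.
  by congr (_ * expR _ - _ * expR _); ring.
- under eq_integral do rewrite EFinB.
  rewrite integralB_EFin// !integral_expR_scale// -EFinB lee_fin.
  by rewrite [X in _ <= X - _]mulrAC [X in _ <= _ - X]mulrAC.
Qed.

End convolution_step.

(** * The head near 0: convolution acting on powers *)

Section head.
Context {R : realType}.
Local Notation mu := (@lebesgue_measure R).

Lemma integral_is_derive (f F : R -> R) (a b : R) : a <= b ->
  continuous f -> (forall x : R, is_derive x 1 F (f x)) ->
  (\int[mu]_(x in `[a, b]) (f x)%:E = (F b - F a)%:E)%E.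
Proof.
rewrite le_eqVlt => /predU1P[<-|ab] cf dF.
  by rewrite set_itv1 integral_set1 subrr.
rewrite (continuous_FTC2 (F := F))//.
- exact: continuous_subspaceT.
- have cF : continuous F.
    by move=> x; apply/differentiable_continuous/derivable1_diffP; exact: ex_derive.
  split.
  + by move=> x _; exact: ex_derive.
  + exact/cvg_at_right_filter/cF.
  + exact/cvg_at_left_filter/cF.
- by move=> x _; rewrite derive1E; exact: derive_val.
Qed.


(** Divided powers: each is the derivative of the next, so that convolution merely raises the
    index. *)
Definition fpow (k : nat) (x : R) : R := x ^+ k / k`!%:R.

Lemma fpow_ge0 k x : 0 <= x -> 0 <= fpow k x.
Proof. by move=> x0; rewrite divr_ge0 ?exprn_ge0. Qed.

Lemma fpowS0 k : fpow k.+1 0 = 0.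
Proof. by rewrite /fpow expr0n mul0r. Qed.

Lemma mulr_fpow k x : x * fpow k x = k.+1%:R * fpow k.+1 x.
Proof.
rewrite /fpow factS natrM exprS; field.
by rewrite nat1r !pnatr_eq0 -lt0n fact_gt0.
Qed.

Lemma continuous_fpow k : continuous (fpow k).
Proof. by move=> x; apply: cvgMl; exact: exprn_continuous. Qed.

Lemma continuous_fpow_comp k (a x A B : R) :
  continuous (fun y => A * fpow k (x - a * y) + B * fpow k.+1 (x - a * y)).
Proof.
have c1 : continuous (fun y : R => x - a * y).
  by move=> y; apply: cvgB; [exact: cvg_cst|apply: cvgMr; exact: cvg_id].
move=> y; apply: cvgD; apply: cvgMr.
  exact: (continuous_comp (c1 y) (@continuous_fpow k _)).
exact: (continuous_comp (c1 y) (@continuous_fpow k.+1 _)).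
Qed.

Lemma is_derive_fpow k (x : R) : is_derive x 1 (fpow k.+1) (fpow k x).
Proof.
have -> : fpow k.+1 = k.+1`!%:R^-1 \*: (@id R ^+ k.+1).
  by apply/funext => y; rewrite /fpow mulrC !fctE.
apply: is_derive_eq; rewrite /GRing.scale/= mulr1 /fpow factS natrM; field.
by rewrite nat1r !pnatr_eq0 -lt0n fact_gt0.
Qed.

Lemma is_derive_fpow_comp k (a x y : R) : a != 0 ->
  is_derive y 1 (fun y => - a^-1 * fpow k.+1 (x - a * y)) (fpow k (x - a * y)).
Proof.
move=> a0.
have dg : is_derive y 1 (fun y => x - a * y) (- a).
  rewrite (_ : (fun y => _) = cst x - a \*: @id R)//.
  by apply: is_derive_eq; rewrite sub0r /GRing.scale/= mulr1.
have df := is_derive_fpow k (x - a * y).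
rewrite (_ : (fun y => _) = (- a^-1) \*: (fpow k.+1 \o (fun y => x - a * y)))//.
apply: is_derive_eq; rewrite /GRing.scale/=; field.
exact: a0.
Qed.

(** The antiderivative vanishes at y = x / a, where x - a y = 0. Two consecutive powers are needed
    for the integrand of the lower bound. *)
Lemma integral_fpow k (a x A B : R) : 0 < a -> 0 <= x ->
  (\int[mu]_(y in `[0%R, (x / a)%R])
     (A * fpow k (x - a * y) + B * fpow k.+1 (x - a * y))%:E)%E =
  (a^-1 * (A * fpow k.+1 x + B * fpow k.+2 x))%:E.
Proof.
move=> a0 x0; have aN0 : a != 0 by rewrite gt_eqF.
pose g y := A * fpow k (x - a * y) + B * fpow k.+1 (x - a * y).
pose Fg y := A * (- a^-1 * fpow k.+1 (x - a * y)) + B * (- a^-1 * fpow k.+2 (x - a * y)).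
have dFg (y : R) : is_derive y 1 Fg (g y).
  have h1 := @is_derive_fpow_comp k a x y aN0.
  have h2 := @is_derive_fpow_comp k.+1 a x y aN0.
  rewrite (_ : Fg = A \*: (fun y => - a^-1 * fpow k.+1 (x - a * y)) +
                    B \*: (fun y => - a^-1 * fpow k.+2 (x - a * y)))//.
  exact: is_derive_eq.
rewrite (integral_is_derive (divr_ge0 x0 (ltW a0)) (@continuous_fpow_comp k a x A B) dFg).
have axa : a * (x / a) = x by rewrite mulrCA mulfV// mulr1.
by rewrite /Fg mulr0 subr0 axa subrr !fpowS0; congr EFin; ring.
Qed.

Variables (a : R) (F G : R -> R).
Hypothesis a_gt0 : 0 < a.
Hypothesis F01 : forall x, 0 <= F x <= 1.
Hypothesis mF : measurable_fun [set: R] F.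
Hypothesis FG : exp_convolution a F G.

(** Bound e^(-y) by 1; only y <= x / a contributes, because [F] vanishes on the negative axis. *)
Lemma convolution_fpow_le (L : R) k :
  (forall x, x < 0 -> F x = 0) -> (forall x, 0 <= x -> F x <= L * fpow k x) ->
  (forall x, x < 0 -> G x = 0) /\
  (forall x, 0 <= x -> G x <= L / a * fpow k.+1 x).
Proof.
move=> F0 FL; split => x x0.
  apply/EFin_inj; rewrite FG integral0_eq// => y.
  rewrite /= in_itv/= andbT => y0; rewrite F0 ?mul0r//.
  by rewrite (le_lt_trans _ x0)// lerBlDr lerDl mulr_ge0// ltW.
pose g y := L * fpow k (x - a * y) + 0 * fpow k.+1 (x - a * y).
have cg : continuous g by exact: continuous_fpow_comp.
have mg : measurable_fun [set: R] g by exact: continuous_measurable_fun.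
apply: (convolution_le F01 mF FG (h := g \_ `[0, x / a])).
- apply: measurable_funTypeR; apply/(measurable_restrictT g) => //.
  exact: measurable_funTS.
- move=> y y0; rewrite patchE mem_setE in_itv/= y0/= ler_pdivlMr// (mulrC y a).
  case: ifPn => [yx|]; last first.
    by rewrite -ltNge => xy; rewrite F0 ?mul0r// subr_lt0.
  rewrite /g mul0r addr0.
  have xy : 0 <= x - a * y by rewrite subr_ge0.
  rewrite (le_trans _ (FL _ xy))// ler_piMr//.
    by have /andP[] := F01 (x - a * y).
  by rewrite -expR0 ler_expR oppr_le0.
- rewrite (_ : (\int[mu]_(y in `[0%R, +oo[) _)%E =
      (\int[mu]_(y in `[0%R, (x / a)%R]) (g y)%:E)%E).
    by rewrite integral_fpow// mul0r addr0 lee_fin mulrCA mulrA.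
  rewrite [LHS]integral_mkcond [RHS]integral_mkcond; apply: eq_integral => y _.
  rewrite !patchE !mem_setE !in_itv/= andbT.
  by case: (0 <= y) => //=; case: ifP.
Qed.

(** On the main term use e^(-y) >= 1 - y, on the subtracted one e^(-y) <= 1. The term in y is what
    adds 1/a to the coefficient [d] of the first-order correction. *)
Lemma convolution_fpow_ge (L d : R) k : 0 <= L ->
  (forall x, 0 <= x -> L * (fpow k x - d * fpow k.+1 x) <= F x) ->
  0 <= d ->
  forall x, 0 <= x ->
    L / a * (fpow k.+1 x - (d + a^-1) * fpow k.+2 x) <= G x.
Proof.
move=> L0 LF d0 x x0.
(* With u = x - a y this is L (fpow k u (1 - y) - d fpow (k+1) u), where y = (x - u) / a has been
   substituted so that only powers of u remain. *)
pose g y := (L * (1 - x / a)) * fpow k (x - a * y)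
          + (L * (k.+1%:R / a - d)) * fpow k.+1 (x - a * y).
have cg : continuous g by exact: continuous_fpow_comp.
apply: (convolution_ge F01 mF FG (D := `[0, x / a]) (h := g)).
- exact: measurable_itv.
- by move=> y /=; rewrite !in_itv/= andbT => /andP[].
- apply: continuous_compact_integrable; first exact: segment_compact.
  exact: continuous_subspaceT.
- move=> y /=; rewrite in_itv/= ler_pdivlMr// => /andP[y0 yx].
  have u0 : 0 <= x - a * y by rewrite subr_ge0 mulrC.
  have gE : g y = L * (fpow k (x - a * y) * (1 - y) - d * fpow k.+1 (x - a * y)).
    have := mulr_fpow k (x - a * y); rewrite /g => E.
    have -> : fpow k (x - a * y) * (1 - y) = (1 - x / a) * fpow k (x - a * y)
       + a^-1 * ((x - a * y) * fpow k (x - a * y)).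
      by field; rewrite gt_eqF.
    by rewrite E; ring.
  rewrite gE; apply: le_trans (ler_wpM2r (expR_ge0 _) (LF _ u0)).
  rewrite -(mulrA L) ler_wpM2l//.
  have e1 := expR_ge1Dx (- y).
  have e2 : expR (- y) <= 1 by rewrite -expR0 ler_expR oppr_le0.
  have f0 := fpow_ge0 k u0.
  have f1 : 0 <= d * fpow k.+1 (x - a * y) by rewrite mulr_ge0 ?fpow_ge0.
  rewrite mulrBl lerB//; first by rewrite ler_wpM2l.
  by rewrite ler_piMr.
- rewrite integral_fpow// lee_fin le_eqVlt; apply/predU1P; left.
  have := mulr_fpow k.+1 x => E.
  have -> : L * (1 - x / a) * fpow k.+1 x + L * (k.+1%:R / a - d) * fpow k.+2 x =
    L * (fpow k.+1 x - a^-1 * (x * fpow k.+1 x) + (k.+1%:R / a - d) * fpow k.+2 x).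
    by ring.
  by rewrite E -[in k.+2%:R]natr1; ring.
Qed.
End head.

(** * From powers to exponentials, and two-sided bounds after adding the tail *)

Section sandwich.
Context {R : realType}.

(** Square y/4 <= e^(y/4). This is the origin of the constant 16 in the error of the exponential
    approximation. *)
Lemma sqr_expRN_le (y : R) : 0 <= y ->
  y ^+ 2 * expR (- y) <= 16 * expR (- (y / 2)).
Proof.
move=> y0; have h : y / 4 <= expR (y / 4) by have := expR_ge1Dx (y / 4); lra.
have -> : 16 * expR (- (y / 2)) = (4 * expR (y / 4)) ^+ 2 * expR (- y).
  have -> : expR (- (y / 2)) = expR (y / 4) ^+ 2 * expR (- y).
    by rewrite -expRM_natr -expRD; congr expR; field.
  ring.
rewrite ler_wpM2r ?expR_ge0// lerXn2r ?nnegrE ?mulr_ge0 ?expR_ge0//; lra.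
Qed.

(** Since 1 - v >= e^(-v) (1 - v^2), Bernoulli's inequality gives (1 - v)^n >= e^(-nv) (1 - n v^2).
    The loss n v^2 e^(-nv) is traded for a slower pure exponential of size 1/n, as the tail
    convolution only handles exponentials. *)
Lemma onem_expn_ge (n : nat) (v : R) : (0 < n)%N -> 0 <= v <= 1 ->
  expR (- (n%:R * v)) - 16 / n%:R * expR (- (n%:R * v / 2)) <= (1 - v) ^+ n.
Proof.
move=> n0 /andP[v0 v1]; have n0' : 0 < n%:R :> R by rewrite ltr0n.
have y0 : 0 <= n%:R * v by rewrite mulr_ge0// ltW.
have v2 : 0 <= 1 - v ^+ 2 by rewrite subr_ge0 expr_le1.
have e1 : expR (- v) * (1 - v ^+ 2) <= 1 - v.
  have -> : 1 - v ^+ 2 = (1 + v) * (1 - v) by ring.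
  rewrite mulrA ler_piMl ?subr_ge0// expRN mulrC ler_pdivrMr ?expR_gt0// mul1r.
  exact: expR_ge1Dx.
have bern : 1 - n%:R * v ^+ 2 <= (1 - v ^+ 2) ^+ n.
  elim: (n) => [|k IH]; first by rewrite mul0r subr0 expr0.
  have w0 : 0 <= v ^+ 2 by rewrite exprn_ge0.
  rewrite (exprS _ k); apply: le_trans (ler_wpM2l v2 IH).
  have : 0 <= k%:R * v ^+ 2 * v ^+ 2 by rewrite !mulr_ge0.
  rewrite -natr1; nra.
have : expR (- (n%:R * v)) * (1 - n%:R * v ^+ 2) <= (1 - v) ^+ n.
  apply: le_trans (ler_wpM2l (expR_ge0 _) bern) _.
  have -> : expR (- (n%:R * v)) = expR (- v) ^+ n.
    by rewrite -expRM_natr; congr expR; ring.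
  by rewrite -exprMn lerXn2r ?nnegrE ?mulr_ge0 ?expR_ge0 ?v2// subr_ge0.
apply: le_trans; rewrite mulrBr mulr1 lerD2l lerN2.
rewrite -(ler_pM2l n0') [leRHS](_ : _ = 16 * expR (- (n%:R * v / 2))); last first.
  by field; rewrite gt_eqF.
rewrite [leLHS](_ : _ = (n%:R * v) ^+ 2 * expR (- (n%:R * v))); last by ring.
exact: sqr_expRN_le.
Qed.

(** This covers x < 0: there v = 1 - x/t exceeds 1, and a lower bound for a distribution function
    that vanishes must not be positive. *)
Lemma expR_half_ge (n : nat) (v : R) : (0 < n)%N -> 1 <= v ->
  expR (- (n%:R * v)) - 16 / n%:R * expR (- (n%:R * v / 2)) <= 0.
Proof.
move=> n0 v1; have n1 : 1 <= n%:R :> R by rewrite ler1n.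
have ny : n%:R <= n%:R * v by rewrite ler_peMr.
rewrite subr_le0 -(ler_pM2l (lt_le_trans ltr01 n1)).
rewrite [leRHS](_ : _ = 16 * expR (- (n%:R * v / 2))); last first.
  by field; rewrite gt_eqF// (lt_le_trans ltr01).
apply: le_trans (@sqr_expRN_le (n%:R * v) _); last by lra.
rewrite ler_wpM2r ?expR_ge0//; nra.
Qed.

Lemma prod_half_ratio (b : nat -> R) (s : R) (m : nat) : 0 <= s ->
  (forall j, 0 <= b j) -> (forall j, b j.+1 <= b j / 2) ->
  \prod_(0 <= j < m) (1 + s * b j) <=
  (1 + s * b 0%N) * \prod_(0 <= j < m) (1 + s / 2 * b j).
Proof.
move=> s0 b0 bS.
(* Strengthened by the next numerator, the one that denominator m - 1 dominates, so that the
   induction closes. *)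
suff : \prod_(0 <= j < m) (1 + s * b j) * (1 + s * b m) <=
       (1 + s * b 0%N) * \prod_(0 <= j < m) (1 + s / 2 * b j).
  apply: le_trans; rewrite ler_peMr ?lerDl ?mulr_ge0// prodr_ge0// => j _.
  by rewrite addr_ge0// mulr_ge0.
elim: m => [|m IH]; first by rewrite !big_geq// mul1r mulr1.
rewrite !big_nat_recr//= mulrA; apply: ler_pM => //.
- rewrite mulr_ge0 ?addr_ge0 ?mulr_ge0// prodr_ge0// => j _.
  by rewrite addr_ge0// mulr_ge0.
- by rewrite addr_ge0// mulr_ge0.
- by rewrite lerD2l -mulrA ler_wpM2l// mulrC.
Qed.

Context (d : measure_display) (T : measurableType d).
Variables (P : probability T R) (X : nat -> {RV P >-> R}) (a : nat -> R).
Hypothesis X_indep : independent_RVs X.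
Hypothesis X_exp : forall j, exponential_RV 1 (X j).
Hypothesis a_gt0 : forall j, 0 < a j.

Let F N x := fine (P [set w | psum X a N w <= x]).

Let F01 N x : 0 <= F N x <= 1.
Proof.
rewrite fine_ge0//= -lee_fin fineK ?fin_num_measure ?probability_le1//;
exact: measurable_psum_le.
Qed.

Let F_nd N : {homo F N : x y / x <= y}.
Proof.
move=> x y xy; apply: fine_le; rewrite ?fin_num_measure//.
- exact: measurable_psum_le.
- exact: measurable_psum_le.
- apply: le_measure; rewrite ?inE; try exact: measurable_psum_le.
  by move=> w /= h; exact: le_trans xy.
Qed.

Let mF N : measurable_fun [set: R] (F N).
Proof. by apply: nondecreasing_measurable => //; exact: F_nd. Qed.

Let F_conv N : exp_convolution (a N) (F N) (F N.+1).
Proof.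
move=> x; rewrite fineK ?fin_num_measure//; last exact: measurable_psum_le.
rewrite psum_cdfS//; apply: eq_integral => y _.
by rewrite EFinM fineK ?fin_num_measure//; exact: measurable_psum_le.
Qed.

Let F0 x : F 0%N x = (0 <= x)%R%:R.
Proof.
rewrite /F; have -> : [set w | psum X a 0%N w <= x] = if 0 <= x then setT else set0.
  by apply/seteqP; split => w /=; rewrite /psum big_geq//; case: ifP.
by case: ifP => _; rewrite ?probability_setT ?measure0.
Qed.

(** The variable a_j X_j has rate 1/a_j. The product of the rates is the constant C_n of the head;
    their sum governs its first-order correction. *)
Definition rate_prod (n : nat) : R := \prod_(0 <= j < n) (a j)^-1.
Definition rate_sum (n : nat) : R := \sum_(0 <= j < n) (a j)^-1.

Let rate_prod_gt0 n : 0 < rate_prod n.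
Proof. by apply: prodr_gt0 => j _; rewrite invr_gt0. Qed.

Let rate_sum_ge0 n : 0 <= rate_sum n.
Proof. by apply: sumr_ge0 => j _; rewrite invr_ge0 ltW. Qed.

Lemma head_cdf_le n : (forall x, x < 0 -> F n x = 0) /\
  (forall x, 0 <= x -> F n x <= rate_prod n * fpow n x).
Proof.
elim: n => [|n [IH1 IH2]].
  split=> x x0; first by rewrite F0 leNgt x0.
  by rewrite F0 x0 /rate_prod big_geq// /fpow fact0 expr0 divr1 mulr1.
rewrite /rate_prod big_nat_recr//=.
by apply: (convolution_fpow_le (a_gt0 n) (F01 n) (@mF n) (F_conv n) IH1 IH2).
Qed.

Lemma head_cdf_ge n x : 0 <= x ->
  rate_prod n * (fpow n x - rate_sum n * fpow n.+1 x) <= F n x.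
Proof.
elim: n x => [|n IH] x x0.
  rewrite F0 x0 /rate_prod /rate_sum !big_geq// mul0r subr0 mul1r.
  by rewrite /fpow fact0 expr0 divr1.
rewrite /rate_prod /rate_sum !big_nat_recr//=.
exact: (convolution_fpow_ge (a_gt0 n) (F01 n) (@mF n) (F_conv n) (ltW (rate_prod_gt0 n)) IH).
Qed.

Lemma tail_cdf_le n m (C s : R) : 0 <= s ->
  (forall x, F n x <= C * expR (s * x)) ->
  forall x, F (n + m)%N x <=
    C / \prod_(0 <= j < m) (1 + s * a (n + j)%N) * expR (s * x).
Proof.
move=> s0 FC; elim: m => [|m IH] x; first by rewrite addn0 big_geq// divr1.
have := convolution_expR_le (a_gt0 (n + m)%N) (F01 (n + m)%N) (@mF _) (F_conv _) s0 IH x.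
by rewrite addnS big_nat_recr//= invfM mulrA.
Qed.

Lemma tail_cdf_ge n m (C C' s s' t : R) : 0 <= s -> 0 <= s' ->
  (forall x, x <= t -> C * expR (s * x) - C' * expR (s' * x) <= F n x) ->
  forall x, x <= t ->
    C / \prod_(0 <= j < m) (1 + s * a (n + j)%N) * expR (s * x)
    - C' / \prod_(0 <= j < m) (1 + s' * a (n + j)%N) * expR (s' * x) <= F (n + m)%N x.
Proof.
move=> s0 s'0 FC; elim: m => [|m IH] x xt; first by rewrite addn0 !big_geq// !divr1 FC.
have := convolution_expR_ge (a_gt0 (n + m)%N) (F01 (n + m)%N) (@mF _) (F_conv _) s0 s'0 IH xt.
by rewrite addnS !big_nat_recr//= !invfM !mulrA.
Qed.

Hypothesis a_half : forall j, a j.+1 <= a j / 2.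

(* The error term of the head, a multiple of exp (s x / 2), is amplified by the
   tail by prod (1 + s a_j) / (1 + s a_j / 2), which is at most 1 + s a_n: each
   denominator dominates the next numerator by [a_half]. *)
Lemma cdf_sandwich n m t (s := n%:R / t)
    (U := rate_prod n * fpow n t / \prod_(0 <= j < m) (1 + s * a (n + j)%N)) :
  (0 < n)%N -> 0 < t -> rate_sum n * t <= n.+1%:R ->
  (1 - rate_sum n * t / n.+1%:R) * (1 - 16 / n%:R * (1 + s * a n)) * U
    <= F (n + m)%N t <= U.
Proof.
move=> n0 t0 Dt.
have nN0 : n%:R != 0 :> R by rewrite pnatr_eq0 -lt0n.
have tN0 : t != 0 by rewrite gt_eqF.
have s0 : 0 <= s by rewrite divr_ge0// ltW.
have st : s * t = n%:R by rewrite /s mulfVK.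
have ft0 : 0 <= fpow n t by rewrite fpow_ge0// ltW.
have fE x : fpow n x = fpow n t * (x / t) ^+ n.
  rewrite /fpow expr_div_n; field; by rewrite expf_neq0 ?pnatr_eq0 -?lt0n ?fact_gt0.
apply/andP; split; last first.
  (* From u <= e^(u - 1) at u = x/t, (x/t)^n <= e^(s x - n), with equality at x = t: the upper bound
     loses nothing there. *)
  have := @tail_cdf_le n m (rate_prod n * fpow n t * expR (- n%:R)) s s0.
  have [F1 F2] := head_cdf_le n => H.
  have {}H := H _ t; rewrite st in H.
  rewrite /U; apply: le_trans (H _) _; last first.
    rewrite mulrAC -[X in X / _]mulrA -expRD addNr expR0 mulr1.
    exact: lexx.
  move=> x; have [x0|x0] := ltP x 0.
    by rewrite F1// 2?mulr_ge0 ?expR_ge0// mulr_ge0// (ltW (rate_prod_gt0 n)).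
  apply: (le_trans (F2 x x0)).
  rewrite [leRHS](_ : _ = rate_prod n * (fpow n t *
    (expR (- n%:R) * expR (s * x)))); last by ring.
  rewrite ler_wpM2l ?(ltW (rate_prod_gt0 n))// (fE x) ler_wpM2l// -expRD.
  have -> : - n%:R + s * x = (x / t - 1) * n%:R by rewrite /s; ring.
  have xt0 : 0 <= x / t by rewrite divr_ge0// ltW.
  rewrite expRM_natr lerXn2r ?nnegrE ?expR_ge0//.
  by have := expR_ge1Dx (x / t - 1); lra.
set A := 1 - _ / _.
have A0 : 0 <= A by rewrite subr_ge0 ler_pdivrMr// mul1r.
(* With v = 1 - x/t, C e^(s x) - C' e^(s x / 2) is the lower bound of [onem_expn_ge] for (x/t)^n,
   scaled; [A] is the head's correction at its worst point x = t. *)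
pose C := A * rate_prod n * fpow n t * expR (- n%:R).
pose C' := A * rate_prod n * fpow n t * (16 / n%:R * expR (- (n%:R / 2))).
have Arf0 : 0 <= A * rate_prod n * fpow n t.
  by rewrite mulr_ge0// mulr_ge0// ltW.
have s'0 : 0 <= s / 2 by rewrite divr_ge0.
have H : forall x, x <= t -> C * expR (s * x) - C' * expR (s / 2 * x) <= F n x.
  move=> x xt; pose v := 1 - x / t.
  have vn1 : - n%:R + s * x = - (n%:R * v) by rewrite /s /v; ring.
  have vn2 : - (n%:R / 2) + s / 2 * x = - (n%:R * v / 2) by rewrite /s /v; ring.
  have -> : C * expR (s * x) - C' * expR (s / 2 * x) = A * rate_prod n * fpow n t *
     (expR (- (n%:R * v)) - 16 / n%:R * expR (- (n%:R * v / 2))).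
    by rewrite -vn1 -vn2 !expRD /C /C'; ring.
  have [x0|x0] := ltP x 0.
    have /andP[+ _] := F01 n x; apply: le_trans.
    rewrite mulr_ge0_le0// expR_half_ge//.
    by rewrite /v lerDl oppr_ge0 pmulr_lle0 ?invr_gt0// ltW.
  have v01 : 0 <= v <= 1.
    by rewrite subr_ge0 ler_pdivrMr// mul1r xt gerBl divr_ge0// ltW.
  apply: le_trans (ler_wpM2l Arf0 (onem_expn_ge n0 v01)) _.
  apply: le_trans (head_cdf_ge n x0).
  have -> : 1 - v = x / t by rewrite /v; ring.
  rewrite -(mulrA _ (fpow n t)) -fE (mulrC A) -mulrA ler_wpM2l ?(ltW (rate_prod_gt0 n))//.
  have -> : fpow n x - rate_sum n * fpow n.+1 x =
            (1 - rate_sum n * x / n.+1%:R) * fpow n x.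
    rewrite mulrBl mul1r mulrAC -[rate_sum n * x * _]mulrA mulr_fpow.
    by field; rewrite nat1r pnatr_eq0.
  rewrite ler_wpM2r ?fpow_ge0// lerD2l lerN2 ler_pM2r ?invr_gt0//.
  by rewrite ler_wpM2l.
have := @tail_cdf_ge n m C C' s (s / 2) t s0 s'0 H t (lexx t).
apply: le_trans.
have P0 : 0 < \prod_(0 <= j < m) (1 + s * a (n + j)%N).
  by apply: prodr_gt0 => j _; rewrite ltr_wpDr// mulr_ge0// ltW.
have P'0 : 0 < \prod_(0 <= j < m) (1 + s / 2 * a (n + j)%N).
  by apply: prodr_gt0 => j _; rewrite ltr_wpDr// mulr_ge0// ltW.
have rat := @prod_half_ratio (fun j => a (n + j)%N) s m s0 (fun j => ltW (a_gt0 _)).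
have {}rat : (\prod_(0 <= j < m) (1 + s / 2 * a (n + j)%N))^-1 <=
   (1 + s * a n) / \prod_(0 <= j < m) (1 + s * a (n + j)%N).
  rewrite ler_pdivlMr// mulrC ler_pdivrMr//.
  by have := rat; rewrite addn0; apply => j; rewrite addnS.
have -> : C / \prod_(0 <= j < m) (1 + s * a (n + j)%N) * expR (s * t) =
    A * U.
  rewrite st /C /U; set Q := \prod_(_ <= _ < _) _.
  rewrite [LHS](_ : _ = A * (rate_prod n * fpow n t / Q) *
    (expR (- n%:R) * expR n%:R)); last by ring.
  by rewrite -expRD addNr expR0 mulr1.
set Q' := \prod_(0 <= j < m) (1 + s / 2 * _).
have -> : C' / Q' * expR (s / 2 * t) =
    A * (rate_prod n * fpow n t) * (16 / n%:R) * Q'^-1.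
  have -> : s / 2 * t = n%:R / 2 by rewrite mulrAC st.
  rewrite /C'.
  rewrite [LHS](_ : _ = A * (rate_prod n * fpow n t) * (16 / n%:R) * Q'^-1 *
    (expR (- (n%:R / 2)) * expR (n%:R / 2))); last by ring.
  by rewrite -expRD addNr expR0 mulr1.
rewrite mulrBr mulr1 mulrBl lerB//.
have E1 : A * (rate_prod n * fpow n t) * (16 / n%:R) * Q'^-1 <=
  A * (rate_prod n * fpow n t) * (16 / n%:R) *
    ((1 + s * a n) / \prod_(0 <= j < m) (1 + s * a (n + j)%N)).
  by rewrite ler_wpM2l// mulr_ge0// mulrA.
apply: (le_trans E1); rewrite /U le_eqVlt; apply/predU1P; left; ring.
Qed.

End sandwich.

(** * Series: dominated convergence and comparison *)

Section series_tools.
Context {R : realType}.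
Implicit Types (u v l : nat -> R).

Lemma series_tail_le v : (forall k, 0 <= v k) -> cvgn (series v) ->
  forall e, 0 < e -> exists K, forall n, \sum_(K <= k < n) v k <= e.
Proof.
move=> v0 cv e e0.
have nd : nondecreasing_seq (series v).
  by apply/nondecreasing_seqP => n; rewrite seriesSr lerDl.
have := cvgr_dist_le _ _ cv _ e0 => -[K _ HK]; exists K => n.
have [nK|/ltnW Kn] := leqP n K; first by rewrite big_geq// ltW.
have -> : \sum_(K <= k < n) v k = series v n - series v K.
  by rewrite sub_series_geq.
have := HK K (leqnn K); rewrite ler_norml => /andP[_].
apply: le_trans; rewrite lerD2r; exact: nondecreasing_cvgn_le.
Qed.

Lemma cvg_sum_nat (u : nat -> nat -> R) l n :
  (forall k, u ^~ k @ \oo --> l k) ->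
  (fun m => \sum_(0 <= k < n) u m k) @ \oo --> \sum_(0 <= k < n) l k.
Proof.
move=> ul; elim: n => [|n IH].
  rewrite big_geq//; under eq_fun do rewrite big_geq//; exact: cvg_cst.
rewrite big_nat_recr//=; under eq_fun do rewrite big_nat_recr//=.
exact: cvgD.
Qed.

(** Cut at an index beyond which the dominating series is small: finitely many terms converge one by
    one, and both tails are negligible. The number of terms [N m] may grow with m. *)
Lemma tannery (u : nat -> nat -> R) l v (N : nat -> nat) :
  (forall k, u ^~ k @ \oo --> l k) ->
  (\forall m \near \oo, forall k, `|u m k| <= v k) ->
  cvgn (series v) ->
  (forall K, \forall m \near \oo, (K <= N m)%N) ->
  cvgn (series l) /\ (fun m => \sum_(0 <= k < N m) u m k) @ \oo --> limn (series l).
Proof.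
move=> ul uv cv NK.
have lv k : `|l k| <= v k.
  have /cvg_norm h := ul k.
  rewrite -(cvg_lim (@norm_hausdorff _ _) h).
  apply: limr_le; first by apply/cvg_ex; exists `|l k|.
  by apply: filterS uv => m; exact.
have v0 k : 0 <= v k by exact: le_trans (lv k).
have cl : cvgn (series l).
  apply: normed_cvg; apply: series_le_cvg cv => //.
  by move=> n; exact: normr_ge0.
split => //; apply/cvgrPdist_le => e e0.
have e3 : 0 < e / 4 by rewrite divr_gt0.
have [K HK] := series_tail_le v0 cv e3.
have [K' _ HK'] := cvgr_dist_le _ _ cl _ e3.
pose L := maxn K K'.
have HL n : \sum_(L <= k < n) v k <= e / 4.
  apply: le_trans (HK n).
  have [nL|/ltnW Ln] := leqP n L; first by rewrite big_geq// sumr_ge0.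
  rewrite (@big_cat_nat _ _ _ L K n)//= ?leq_maxl// lerDr sumr_ge0//.
have cs : (fun m => \sum_(0 <= k < L) u m k) @ \oo --> \sum_(0 <= k < L) l k.
  exact: cvg_sum_nat.
near=> m.
have NL : (L <= N m)%N by near: m; exact: NK.
have uvm : forall k, `|u m k| <= v k by near: m.
rewrite (@big_cat_nat _ _ _ L 0 (N m))//=.
have h1 : `|limn (series l) - series l L| <= e / 4 by apply: HK'; exact: leq_maxr.
have h2 : `|\sum_(0 <= k < L) l k - \sum_(0 <= k < L) u m k| <= e / 4.
  by near: m; exact: (cvgr_dist_le _ _ cs _ e3).
have h3 : `|\sum_(L <= k < N m) u m k| <= e / 4.
  apply: le_trans (HL (N m)); apply: (le_trans (ler_norm_sum _ _ _)).
  by apply: ler_sum => k _; exact: uvm.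
move: h1 h2 h3; rewrite /series /=; move: (\sum_(0 <= k < L) l k) => x.
move: (\sum_(0 <= k < L) u m k) (\sum_(L <= k < N m) u m k) (limn _) => y z w.
rewrite !ler_norml; lra.
Unshelve. all: by end_near. Qed.

Lemma is_cvg_geometric_le v C z : 0 <= z < 1 ->
  (forall k, 0 <= v k <= C * z ^+ k) -> cvgn (series v).
Proof.
move=> /andP[z0 z1] vC.
apply: (@series_le_cvg _ _ (fun k => C * z ^+ k)).
- by move=> n; have /andP[] := vC n.
- by move=> n; have /andP[] := vC n; exact: le_trans.
- by move=> n; have /andP[] := vC n.
- by apply: is_cvg_geometric_series; rewrite ger0_norm.
Qed.

Lemma lim_series_recl u : cvgn (series u) ->
  cvgn (series (fun k => u k.+1)) /\
  limn (series u) = u 0%N + limn (series (fun k => u k.+1)).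
Proof.
move=> cu.
have E n : series (fun k => u k.+1) n = series u n.+1 - u 0%N.
  by rewrite /series /= big_nat_recl//= addrC addKr.
have h : series (fun k => u k.+1) @ \oo --> limn (series u) - u 0%N.
  rewrite (_ : series _ = (fun n => series u n.+1 - u 0%N)); last exact/funext.
  apply: cvgB; last exact: cvg_cst.
  by have := cu; rewrite -(cvg_shiftS (series u)).
split; first by apply/cvg_ex; eexists; exact: h.
by rewrite (cvg_lim _ h)// addrC subrK.
Qed.

Lemma is_cvg_series_le u v : (forall k, `|u k| <= v k) -> cvgn (series v) ->
  cvgn (series u).
Proof.
move=> uv cv; apply: normed_cvg; apply: series_le_cvg cv => // n.
- exact: normr_ge0.
- exact: le_trans (uv n).
Qed.

Lemma lim_series_le_norm u v : (forall k, `|u k| <= v k) -> cvgn (series v) ->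
  `|limn (series u)| <= limn (series v).
Proof.
move=> uv cv; have cu := is_cvg_series_le uv cv.
rewrite ler_norml; apply/andP; split.
  rewrite -lim_seriesN//; apply: lim_series_le => //.
    by rewrite is_cvg_seriesN.
  by move=> k; have := uv k; rewrite ler_norml => /andP[].
apply: lim_series_le => // k.
by have := uv k; rewrite ler_norml => /andP[].
Qed.

Lemma lim_series_ge0 u : (forall k, 0 <= u k) -> cvgn (series u) ->
  0 <= limn (series u).
Proof. by move=> u0 cu; apply: limr_ge => //; apply: nearW => n; rewrite sumr_ge0. Qed.

Lemma lim_series_ge_term u K : (forall k, 0 <= u k) -> cvgn (series u) ->
  u K <= limn (series u).
Proof.
move=> u0 cu; apply: limr_ge => //; exists K.+1 => // n /= Kn.
rewrite /series/= (bigD1_seq K) ?mem_index_iota ?iota_uniq//=.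
by rewrite lerDl sumr_ge0.
Qed.

End series_tools.

(** * Sums of a Gaussian over a shifted integer lattice *)

Section gaussian_sums.
Context {R : realType}.

Definition gs (c x : R) : R := expR (- (c * x ^+ 2 / 2)).

Lemma gs_ge0 c x : 0 <= gs c x. Proof. exact: expR_ge0. Qed.
Lemma gs_gt0 c x : 0 < gs c x. Proof. exact: expR_gt0. Qed.

Lemma gsN c x : gs c (- x) = gs c x.
Proof. by rewrite /gs sqrrN. Qed.

(** From (k - x)^2 + x^2 = (k^2 + (k - 2x)^2) / 2 >= k / 2. *)
Lemma gs_nat_le c x (k : nat) : 0 <= c ->
  gs c (k%:R - x) <= expR (c * x ^+ 2 / 2) * expR (- (c / 4)) ^+ k.
Proof.
move=> c0; rewrite -expRM_natr -expRD ler_expR.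
have h0 : 0 <= (k%:R - 2 * x) ^+ 2 by exact: sqr_ge0.
have h1 : (k%:R : R) <= k%:R ^+ 2 by rewrite -natrX ler_nat; case: k {h0} => // k; nia.
have h2 : 0 <= c * (k%:R ^+ 2 - k%:R) by rewrite mulr_ge0// subr_ge0.
have h3 : 0 <= c * (k%:R - 2 * x) ^+ 2 by rewrite mulr_ge0.
nra.
Qed.

Lemma is_cvg_gs c x : 0 < c -> cvgn (series (fun k => gs c (k%:R - x))).
Proof.
move=> c0; apply: (@is_cvg_geometric_le _ _ (expR (c * x ^+ 2 / 2)) (expR (- (c / 4)))).
  by rewrite expR_ge0/= -[ltRHS]expR0 ltr_expR oppr_lt0 divr_gt0.
by move=> k; rewrite gs_ge0 gs_nat_le// ltW.
Qed.

Lemma is_cvg_gs1 c x : 0 < c -> cvgn (series (fun k => gs c (k.+1%:R + x))).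
Proof.
move=> c0; rewrite (_ : (fun k => _) = (fun k => gs c (k%:R - - (1 + x)))).
  exact: is_cvg_gs.
by apply/funext => k; rewrite opprK addrA natr1.
Qed.

(* The sum of [gs c (k - x)] over all integers k. *)
Definition gsum (c x : R) : R :=
  limn (series (fun k => gs c (k%:R - x))) +
  limn (series (fun k => gs c (k.+1%:R + x))).

Lemma gsumD1 c x : 0 < c -> gsum c (x + 1) = gsum c x.
Proof.
move=> c0; rewrite /gsum.
have [_ ->] := lim_series_recl (is_cvg_gs (x := x + 1) c0).
have -> : (fun k => gs c (k.+1%:R - (x + 1))) = (fun k => gs c (k%:R - x)).
  by apply/funext => k; congr gs; rewrite -natr1; ring.
have h : cvgn (series (fun k => gs c (k%:R + x))).
  have := is_cvg_gs (x := - x) c0; under eq_fun do rewrite opprK.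
  exact.
have [_] := lim_series_recl h.
rewrite sub0r gsN add0r => h1.
have h2 : cvgn (series (fun k => gs c (k.+1%:R + (x + 1)))) by exact: is_cvg_gs1.
have [_ ->] := lim_series_recl (is_cvg_gs1 (x := x) c0).
have -> : (fun k => gs c (k.+2%:R + x)) = (fun k => gs c (k.+1%:R + (x + 1))).
  by apply/funext => k; congr gs; rewrite -natr1; ring.
by rewrite [1%:R + x]addrC [gs c (x + 1) + _]addrC addrA.
Qed.

Lemma gsumN c x : 0 < c -> gsum c (- x) = gsum c x.
Proof.
move=> c0; rewrite /gsum.
have h : cvgn (series (fun k => gs c (k%:R + x))).
  have := is_cvg_gs (x := - x) c0; under eq_fun do rewrite opprK.
  exact.
under eq_fun do rewrite opprK.
have [_ ->] := lim_series_recl h.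
have [_ ->] := lim_series_recl (is_cvg_gs (x := x) c0).
rewrite add0r sub0r gsN -!addrA; congr (_ + _).
by rewrite addrC.
Qed.

Lemma gsum_gt0 c x : 0 < c -> 0 < gsum c x.
Proof.
move=> c0; rewrite /gsum ltr_wpDr//.
  by apply: lim_series_ge0; [move=> k; exact: gs_ge0|exact: is_cvg_gs1].
apply: (lt_le_trans (gs_gt0 c (0%:R - x))).
exact: (@lim_series_ge_term _ (fun k => gs c (k%:R - x)) 0%N
  (fun k => gs_ge0 _ _) (is_cvg_gs (x := x) c0)).
Qed.

End gaussian_sums.

(** * Euler's product, its power series, and the comparison with a Gaussian sum *)

Section euler_function.
Context {R : realType}.
Let c : R := ln 2.

Let c0 : 0 < c. Proof. by rewrite ln_gt0// ltr1n. Qed.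
Let expRc : expR c = 2. Proof. by rewrite lnK// posrE. Qed.

Lemma expRN_ln2 n : expR (- (c * n%:R)) = 2 ^- n :> R.
Proof. by rewrite expRN expRM_natr expRc. Qed.

(** The q-Pochhammer symbol (q; q)_n at q = 1/2. *)
Definition qpoch (n : nat) : R := \prod_(0 <= i < n) (1 - 2 ^- i.+1).

Lemma qpochS n : qpoch n.+1 = qpoch n * (1 - 2 ^- n.+1).
Proof. by rewrite /qpoch big_nat_recr. Qed.

Let half_le1 n : 0 < (2 ^- n : R) <= 1.
Proof. by rewrite invr_gt0 exprn_gt0//= invf_le1 ?exprn_gt0// exprn_ege1// ler1n. Qed.


Lemma qpoch_gt_quarter n : 1 / 4 < qpoch n.
Proof.
case: n => [|n]; first by rewrite /qpoch big_geq//; lra.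
(* The plain bound 1/4 is not inductive. The extra term starts with equality at the first factor,
   and halving it at each step pays for the next one. *)
suff : 1 / 4 * (1 + 2 * 2 ^- n.+1) <= qpoch n.+1.
  by have /andP[h _] := half_le1 n.+1; lra.
elim: n => [|n IH]; first by rewrite qpochS /qpoch big_geq// expr1; lra.
rewrite qpochS; have /andP[h h1] := half_le1 n.+1.
have h2 : (2 ^- n.+1 : R) <= 1 / 2.
  have /andP[g g1] := half_le1 n.
  by rewrite exprS invfM; lra.
have h3 : 2 ^- n.+2 = 2 ^- n.+1 / 2 :> R by rewrite (exprS _ n.+1) invfM mulrC.
rewrite h3; move: (2 ^- n.+1) (qpoch n.+1) h h1 h2 IH {h3} => z w *; nra.
Qed.

Lemma qpoch_gt0 n : 0 < qpoch n.
Proof. by have := qpoch_gt_quarter n; lra. Qed.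

Lemma qpoch_nonincreasing : nonincreasing_seq qpoch.
Proof.
apply/nonincreasing_seqP => n; rewrite qpochS.
have /andP[h _] := half_le1 n.+1; have := qpoch_gt0 n.
by move: (2 ^- n.+1) (qpoch n) h => y z *; nra.
Qed.

(** The product of the 1 - x_i is at least 1 minus the sum of the x_i; here the sum is geometric,
    2^-n - 2^-(n+m). *)
Lemma qpoch_addn n m : qpoch n * (1 - 2 ^- n + 2 ^- (n + m)) <= qpoch (n + m).
Proof.
elim: m => [|m IH]; first by rewrite addn0 subrK mulr1.
rewrite addnS qpochS; have /andP[h h1] := half_le1 (n + m).+1.
have /andP[h' h1'] := half_le1 (n + m).
have /andP[g _] := half_le1 n.
have h3 : 2 ^- (n + m).+1 = 2 ^- (n + m) / 2 :> R by rewrite exprS invfM mulrC.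
have h4 : (2 ^- (n + m) : R) <= 2 ^- n.
  by rewrite lef_pV2 ?posrE ?exprn_gt0// ler_weXn2l ?ler1n// leq_addr.
apply: (@le_trans _ _ (qpoch n * (1 - 2 ^- n + 2 ^- (n + m)) * (1 - 2 ^- (n + m).+1))).
  rewrite -mulrA ler_pM2l ?qpoch_gt0// h3.
  by move: (2 ^- (n + m)) (2 ^- n) h' h1' g h4 {IH h3} => y z *; nra.
by rewrite ler_wpM2r// subr_ge0.
Qed.

Definition qpoch_oo : R := limn qpoch.

Lemma cvg_qpoch : qpoch @ \oo --> qpoch_oo.
Proof.
apply: nonincreasing_is_cvgn; first exact: qpoch_nonincreasing.
by exists (1 / 4) => _ [n _ <-]; rewrite ltW// qpoch_gt_quarter.
Qed.

Lemma qpoch_oo_le n : qpoch_oo <= qpoch n.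
Proof. apply: nonincreasing_cvgn_ge; [exact: qpoch_nonincreasing|exact: cvg_qpoch]. Qed.

Lemma qpoch_oo_ge n : qpoch n * (1 - 2 ^- n) <= qpoch_oo.
Proof.
apply: limr_ge; first exact: cvg_qpoch.
exists n => // m /= nm; rewrite -(subnKC nm).
apply: le_trans (qpoch_addn n (m - n)); rewrite ler_pM2l ?qpoch_gt0// lerDl.
by have /andP[/ltW] := half_le1 (n + (m - n)).
Qed.

Lemma qpoch_oo_ge_quarter : 1 / 4 <= qpoch_oo.
Proof.
by apply: limr_ge; [exact: cvg_qpoch|apply: nearW => n; rewrite ltW// qpoch_gt_quarter].
Qed.

Lemma qpoch_oo_gt0 : 0 < qpoch_oo.
Proof. by have := qpoch_oo_ge_quarter; lra. Qed.

(* [ebase k x] is r^k 2^(-k(k+1)/2) with r = 2^x *)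
Definition ebase (k : nat) (x : R) : R :=
  expR (c * (k%:R * x - k%:R * k.+1%:R / 2)).

Lemma ebase_ge0 k x : 0 <= ebase k x. Proof. exact: expR_ge0. Qed.

Lemma ebase0 x : ebase 0 x = 1.
Proof. by rewrite /ebase !mul0r subrr mulr0 expR0. Qed.

Lemma ebaseS k x : ebase k.+1 x = expR (c * (x - 1)) * ebase k (x - 1).
Proof.
rewrite /ebase -expRD; congr expR.
by rewrite -!(natr1 k.+1) -!(natr1 k); field.
Qed.

Lemma ebase_sub1 k x : ebase k (x - 1) = ebase k x * 2 ^- k.
Proof. by rewrite /ebase -expRN_ln2 -expRD; congr expR; ring. Qed.

(** Completing the square in k; the shift by 1/2 in the argument of the theta function comes from
    here. *)
Lemma ebase_gs k x : ebase k x =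
  expR (c * (x - 1 / 2) ^+ 2 / 2) * gs c (k%:R - (x - 1 / 2)).
Proof. by rewrite /ebase /gs -expRD; congr expR; rewrite -natr1; field. Qed.

Lemma ebase_mono k x y : x <= y -> ebase k x <= ebase k y.
Proof. by move=> xy; rewrite ler_expR ler_pM2l// lerD2r ler_wpM2l. Qed.

Lemma is_cvg_ebase x : cvgn (series (fun k => ebase k x)).
Proof.
rewrite (_ : (fun k => _) = expR (c * (x - 1 / 2) ^+ 2 / 2) *:
    (fun k => gs c (k%:R - (x - 1 / 2)))).
  by apply: is_cvg_seriesZ; exact: is_cvg_gs.
by apply/funext => k; rewrite ebase_gs.
Qed.

Lemma lim_ebase x : limn (series (fun k => ebase k x)) =
  expR (c * (x - 1 / 2) ^+ 2 / 2) *
  limn (series (fun k => gs c (k%:R - (x - 1 / 2)))).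
Proof.
rewrite (_ : (fun k => _) = expR (c * (x - 1 / 2) ^+ 2 / 2) *:
    (fun k => gs c (k%:R - (x - 1 / 2)))).
  by rewrite lim_seriesZ//; exact: is_cvg_gs.
by apply/funext => k; rewrite ebase_gs.
Qed.

(** The term q^(k(k+1)/2) r^k / (q; q)_k of Euler's expansion, with q = 1/2 and r = 2^x. *)
Definition eterm (x : R) (k : nat) : R := ebase k x / qpoch k.

Lemma eterm_ge0 x k : 0 <= eterm x k.
Proof. by rewrite divr_ge0 ?ebase_ge0// ltW// qpoch_gt0. Qed.

Lemma eterm_le x k : eterm x k <= 4 * ebase k x.
Proof.
rewrite ler_pdivrMr ?qpoch_gt0// mulrC mulrA ler_peMl ?ebase_ge0//.
by have := qpoch_gt_quarter k; lra.
Qed.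

Lemma is_cvg_eterm x : cvgn (series (eterm x)).
Proof.
apply: (@is_cvg_series_le _ _ (4 *: (fun k => ebase k x))).
  by move=> k; rewrite ger0_norm ?eterm_ge0// eterm_le.
by apply: is_cvg_seriesZ; exact: is_cvg_ebase.
Qed.

Definition euler (x : R) : R := limn (series (eterm x)).

Lemma euler_ge1 x : 1 <= euler x.
Proof.
have := @lim_series_ge_term _ (eterm x) 0%N (eterm_ge0 x) (is_cvg_eterm (x := x)).
by rewrite /eterm ebase0 /qpoch big_geq// divr1.
Qed.

(** Halving r multiplies term k+1 by 2^-(k+1). In the difference, the factor 1 - 2^-(k+1) cancels
    the last factor of the denominator and leaves 2^(x-1) times term k at x - 1. *)
Lemma euler_step x : euler x = (1 + expR (c * (x - 1))) * euler (x - 1).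
Proof.
rewrite mulrDl mul1r; apply/eqP; rewrite addrC -subr_eq; apply/eqP.
have cD : cvgn (series (eterm x - eterm (x - 1))).
  by apply: is_cvg_seriesB; exact: is_cvg_eterm.
rewrite /euler -lim_seriesB; try exact: is_cvg_eterm.
have [_ ->] := lim_series_recl cD.
rewrite -[RHS]/(expR (c * (x - 1)) *: limn (series (eterm (x - 1)))).
rewrite -lim_seriesZ; last exact: is_cvg_eterm.
rewrite [X in X + _ = _](_ : _ = 0) ?add0r; last first.
  by rewrite !fctE /eterm !ebase0 subrr.
congr (limn (series _)); apply/funext => k.
rewrite !fctE /eterm ebase_sub1 ebaseS qpochS.
have := qpoch_gt0 k; have /andP[_] := half_le1 k.
have : (2 ^- k.+1 : R) = 2 ^- k / 2 by rewrite exprS invfM mulrC.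
move: (2 ^- k.+1) (2 ^- k) (qpoch k) => z y w -> y1 w0.
rewrite /GRing.scale/=; field.
by apply/andP; split; rewrite gt_eqF//; lra.
Qed.

Lemma euler_prod m x :
  euler x = \prod_(0 <= i < m) (1 + expR (c * (x - i.+1%:R))) * euler (x - m%:R).
Proof.
elim: m => [|m IH]; first by rewrite big_geq// mul1r subr0.
have xm : x - m.+1%:R = x - m%:R - 1 by rewrite -natr1; ring.
by rewrite IH big_nat_recr//= euler_step -mulrA xm.
Qed.

Lemma euler_le_expR : exists2 K, 0 <= K &
  forall x, x <= 0 -> euler x <= 1 + K * expR (c * x).
Proof.
exists (4 * limn (series (fun k => ebase k 0))).
  by rewrite mulr_ge0// lim_series_ge0//; [move=> k; exact: ebase_ge0|exact: is_cvg_ebase].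
move=> x x0; rewrite /euler.
have [cS ->] := lim_series_recl (is_cvg_eterm (x := x)).
rewrite {1}/eterm ebase0 /qpoch big_geq// divr1 lerD2l mulrAC.
rewrite -[leRHS]/((4 * expR (c * x)) *: limn (series (fun k => ebase k 0))).
rewrite -lim_seriesZ; last exact: is_cvg_ebase.
apply: lim_series_le => //; first by apply: is_cvg_seriesZ; exact: is_cvg_ebase.
move=> k; rewrite fctE /GRing.scale/= (le_trans (eterm_le _ _))// -mulrA ler_pM2l// ebaseS.
rewrite ler_pM ?expR_ge0 ?ebase_ge0//; last by apply: ebase_mono; lra.
by rewrite ler_expR ler_pM2l//; lra.
Qed.

(** After m uses of [euler_step] the remaining factor is euler (x - m), which tends to 1 by
    [euler_le_expR]. *)
Lemma cvg_euler_prod x :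
  (fun m => \prod_(0 <= i < m) (1 + expR (c * (x - i.+1%:R)))) @ \oo --> euler x.
Proof.
have [K K0 HK] := euler_le_expR.
have h : (fun m : nat => euler (x - m%:R)) @ \oo --> (1 : R).
  apply: (@squeeze_cvgr _ _ _ _ (cst 1) (fun m : nat => 1 + K * expR (c * x) * (2^-1) ^+ m)).
  - near=> m; rewrite euler_ge1/=.
    have xm : x - m%:R <= 0.
      by rewrite subr_le0; near: m; exact: nbhs_infty_ger.
    apply: le_trans (HK _ xm) _.
    by rewrite lerD2l -mulrA ler_wpM2l// mulrBr expRD expRN_ln2 exprVn.
  - exact: cvg_cst.
  - rewrite -[X in _ --> X]addr0; apply: cvgD; first exact: cvg_cst.
    rewrite -[X in _ --> X](mulr0 (K * expR (c * x))); apply: cvgMr.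
    by apply: cvg_expr; rewrite ger0_norm; lra.
have e0 : euler x != 0 by rewrite gt_eqF// (lt_le_trans ltr01)// euler_ge1.
have E m : \prod_(0 <= i < m) (1 + expR (c * (x - i.+1%:R))) = euler x / euler (x - m%:R).
  rewrite (euler_prod m x) mulfK// gt_eqF// (lt_le_trans ltr01)// euler_ge1//.
rewrite (_ : (fun m => _) = (fun m : nat => euler x * (euler (x - m%:R))^-1)).
  have hV : (fun m : nat => (euler (x - m%:R))^-1) @ \oo --> (1 : R).
    by rewrite -[X in _ --> X]invr1; apply: cvgV => //; exact: oner_neq0.
  by rewrite -[X in _ --> X]mulr1; exact: cvgMr hV.
exact/funext.
Unshelve. all: by end_near. Qed.

(* Replacing the denominators of [eterm] by their limit costs a factor
   1 + O(2^-x), and so does adding the terms of negative index. *)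
Lemma euler_gsum : exists2 K, 0 <= K & forall x, 1 <= x ->
  qpoch_oo * euler x <= expR (c * (x - 1 / 2) ^+ 2 / 2) * gsum c (x - 1 / 2) <=
  qpoch_oo * euler x * (1 + K * expR (- (c * x))).
Proof.
pose S := limn (series (fun k => gs c (k.+1%:R + 0))).
have S0 : 0 <= S.
  by apply: lim_series_ge0 => [k|]; [exact: gs_ge0|exact: is_cvg_gs1].
exists (8 + 8 * S); first by rewrite addr_ge0// mulr_ge0.
move=> x x1; pose y := x - 1 / 2.
pose B := limn (series (fun k => ebase k x)).
have cb := is_cvg_ebase (x := x); have ct := is_cvg_eterm (x := x).
have Q0 := qpoch_oo_gt0.
have QB : qpoch_oo * euler x <= B.
  rewrite -[leLHS]/(qpoch_oo *: limn (series (eterm x))) -lim_seriesZ//.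
  apply: lim_series_le => //; first exact: is_cvg_seriesZ.
  move=> k; rewrite fctE /GRing.scale/= /eterm mulrCA ler_piMr ?ebase_ge0//.
  by rewrite ler_pdivrMr ?qpoch_gt0// mul1r qpoch_oo_le.
(* Term by term: qpoch k exceeds its limit by at most 2^-k, and 2^-k times [ebase k x] is
   [ebase k (x - 1)]. The result is smaller than euler x by the factor 1 + 2^(x-1). *)
have BQ : B - qpoch_oo * euler x <= euler (x - 1).
  rewrite -[X in _ - X]/(qpoch_oo *: limn (series (eterm x))) -lim_seriesZ//.
  rewrite -lim_seriesB//; last exact: is_cvg_seriesZ.
  apply: lim_series_le.
  - by apply: is_cvg_seriesB => //; exact: is_cvg_seriesZ.
  - exact: is_cvg_eterm.
  - move=> k; rewrite !fctE /GRing.scale/= /eterm ebase_sub1.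
    have q0 := qpoch_gt0 k.
    rewrite -(ler_pM2r q0) mulrBl mulfVK ?gt_eqF// -[qpoch_oo * _ * _]mulrA mulfVK ?gt_eqF//.
    rewrite [qpoch_oo * _]mulrC -mulrBr ler_wpM2l ?ebase_ge0//.
    have q1 : qpoch k <= 1.
      by have := qpoch_nonincreasing (leq0n k); rewrite {2}/qpoch big_geq.
    have := qpoch_oo_ge k; have /andP[] := half_le1 k.
    by move: (2 ^- k) (qpoch k) q0 q1 => z w *; nra.
have e0 := expR_gt0 (c * (x - 1)).
have Estep := euler_step x.
have E1 := euler_ge1 (x - 1).
pose N := limn (series (fun k => gs c (k.+1%:R + y))).
have y0 : 0 <= y by rewrite /y; lra.
have N0 : 0 <= N.
  by apply: lim_series_ge0 => [k|]; [exact: gs_ge0|exact: is_cvg_gs1].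
(* Terms of negative index: once the Gaussian prefactor is multiplied in, the cross term c (k+1) y
   has a favourable sign, which leaves a bound free of x. *)
have NS : expR (c * y ^+ 2 / 2) * N <= S.
  rewrite -[leLHS]/(expR (c * y ^+ 2 / 2) *: N) -lim_seriesZ; last exact: is_cvg_gs1.
  apply: lim_series_le.
  - by apply: is_cvg_seriesZ; exact: is_cvg_gs1.
  - exact: is_cvg_gs1.
  - move=> k; rewrite fctE /GRing.scale/= /gs -expRD ler_expR addr0.
    have k0 : 0 <= (k.+1%:R : R) by [].
    have : 0 <= c * (k.+1%:R * y) by rewrite !mulr_ge0// ltW.
    by move: (k.+1%:R) k0 => z *; nra.
have -> : expR (c * (x - 1 / 2) ^+ 2 / 2) * gsum c (x - 1 / 2) =
    B + expR (c * y ^+ 2 / 2) * N.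
  by rewrite /B lim_ebase mulrDr.
have P0 : 0 <= expR (c * y ^+ 2 / 2) * N by rewrite mulr_ge0 ?expR_ge0.
apply/andP; split; first lra.
have ex : expR (c * (x - 1)) * expR (- (c * x)) = 1 / 2.
  rewrite -expRD (_ : c * (x - 1) + - (c * x) = - c); last by ring.
  by rewrite expRN expRc mul1r.
rewrite mulrDr mulr1.
have q4 := qpoch_oo_ge_quarter.
(* The 8 is the inverse of 1/4 times 1/2: the lower bound for [qpoch_oo], and 2^(x-1) 2^-x. *)
have K1 : euler (x - 1) + S <= qpoch_oo * euler x * ((8 + 8 * S) * expR (- (c * x))).
  rewrite Estep.
  have -> : qpoch_oo * ((1 + expR (c * (x - 1))) * euler (x - 1)) *
     ((8 + 8 * S) * expR (- (c * x))) = qpoch_oo * euler (x - 1) * (8 + 8 * S) *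
     (expR (- (c * x)) + expR (c * (x - 1)) * expR (- (c * x))) by ring.
  rewrite ex; have := expR_gt0 (- (c * x)).
  move: (expR (- (c * x))) (euler (x - 1)) E1 => z e E1 z0.
  have : 1 / 4 * e <= qpoch_oo * e by rewrite ler_wpM2r//; lra.
  move: (qpoch_oo * e) => w hw.
  have w4 : 1 / 4 <= w by lra.
  have h1 : (e + S) <= w * (8 + 8 * S) * (1 / 2).
    have : 0 <= (w - 1 / 4) * S by rewrite mulr_ge0//; lra.
    nra.
  apply: (le_trans h1); rewrite ler_wpM2l//; last by lra.
  by rewrite mulr_ge0; lra.
lra.
Qed.

End euler_function.

(** * Stirling's formula with an unspecified constant *)

Section stirling.
Context {R : realType}.

Lemma is_derive_ge0 (f f' : R -> R) (a x : R) : a <= x ->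
  (forall y, a <= y <= x -> is_derive y 1 f (f' y)) ->
  (forall y, a <= y <= x -> 0 <= f' y) ->
  f a <= f x.
Proof.
rewrite le_eqVlt => /predU1P[->//|ax] df f'0.
have [| |z] := @MVT R f f' a x ax.
- by move=> y; rewrite in_itv/= => /andP[/ltW ay /ltW yx]; apply: df; rewrite ay.
- apply: derivable_within_continuous => y; rewrite in_itv/= => ayx.
  by have := df y ayx => -[].
- rewrite in_itv/= => /andP[az zx] E; rewrite -subr_ge0 E mulr_ge0//.
    by apply: f'0; rewrite !ltW.
  by rewrite subr_ge0 ltW.
Qed.

(** With x = e^u this is u <= sinh u. At x = (n+1)/n it bounds (n + 1/2) ln x - 1 by a telescoping
    quantity, while [ln_ge_ratio] shows that it is nonnegative. *)
Lemma ln_le_sinh (x : R) : 1 <= x -> ln x <= (x - x^-1) / 2.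
Proof.
move=> x1.
pose f y : R := (y - y^-1) / 2 - ln y.
have df (y : R) : 1 <= y <= x -> is_derive y 1 f ((1 + y ^- 2) / 2 - y^-1).
  move=> /andP[y1 _]; have y0 : 0 < y by lra.
  have h1 := is_derive1_ln y0.
  have h2 : is_derive y 1 (fun z : R => z^-1) (- y ^- 2 *: 1).
    by apply: is_deriveV; rewrite gt_eqF.
  rewrite (_ : f = (2^-1 \*: (@id R - (fun z : R => z^-1))) - @ln R).
    apply: is_derive_eq; rewrite /GRing.scale/= mulr1; ring.
  by apply/funext => z; rewrite /f !fctE mulrC.
have := @is_derive_ge0 f (fun y => (1 + y ^- 2) / 2 - y^-1) 1 x x1 df.
rewrite /f ln1 invr1 !subrr mul0r subrr subr_ge0; apply => y /andP[y1 _].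
rewrite -exprVn; have : 0 <= (1 - y^-1) ^+ 2 by exact: sqr_ge0.
by move: (y^-1) => z; nra.
Qed.

Lemma ln_ge_ratio (x : R) : 1 <= x -> 2 * (x - 1) / (x + 1) <= ln x.
Proof.
move=> x1.
pose f (y : R) : R := ln y - (2 - 4 * (y + 1)^-1).
have df (y : R) : 1 <= y <= x -> is_derive y 1 f (y^-1 - 4 * (y + 1) ^- 2).
  move=> /andP[y1 _]; have y0 : 0 < y by lra.
  have h1 := is_derive1_ln y0.
  have h2 : is_derive y 1 (fun z : R => (z + 1)^-1) (- (y + 1) ^- 2 *: 1).
    apply: is_deriveV; first by rewrite gt_eqF//; lra.
    rewrite (_ : (fun z => _) = @id R + cst 1)//.
    by apply: is_derive_eq; rewrite addr0.
  rewrite (_ : f = @ln R - (cst 2 - 4 \*: (fun z : R => (z + 1)^-1))).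
    apply: is_derive_eq; rewrite /GRing.scale/= mulr1; ring.
  by apply/funext => z; rewrite /f !fctE.
have := @is_derive_ge0 f (fun y => y^-1 - 4 * (y + 1) ^- 2) 1 x x1 df.
have -> : 2 * (x - 1) / (x + 1) = 2 - 4 * (x + 1)^-1.
  by field; rewrite gt_eqF//; lra.
rewrite /f ln1 (_ : 2 - 4 * (1 + 1)^-1 = 0 :> R); last by field.
rewrite subrr subr_ge0; apply => y /andP[y1 _].
have y0 : 0 < y by lra.
have -> : y^-1 - 4 * (y + 1) ^- 2 = (y - 1) ^+ 2 / (y * (y + 1) ^+ 2).
  field; apply/andP; split; rewrite gt_eqF//; lra.
by rewrite divr_ge0 ?sqr_ge0// mulr_ge0 ?sqr_ge0// ltW.
Qed.

Definition stirling (n : nat) : R := n`!%:R * expR n%:R / (n%:R ^+ n * Num.sqrt n%:R).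

Lemma stirling_gt0 n : (0 < n)%N -> 0 < stirling n.
Proof.
move=> n0; have n0' : 0 < n%:R :> R by rewrite ltr0n.
by rewrite divr_gt0// mulr_gt0 ?expR_gt0 ?ltr0n ?fact_gt0 ?exprn_gt0 ?sqrtr_gt0.
Qed.

Lemma stirling_ratio n : (0 < n)%N ->
  stirling n / stirling n.+1 = expR ((n%:R + 1 / 2) * ln (n.+1%:R / n%:R) - 1).
Proof.
move=> n0; have n0' : 0 < n%:R :> R by rewrite ltr0n.
have n1' : 0 < n.+1%:R :> R by rewrite ltr0n.
pose u : R := n.+1%:R / n%:R.
have u0 : 0 < u by rewrite divr_gt0.
have nu : n.+1%:R = n%:R * u by rewrite /u mulrCA mulfV ?gt_eqF// mulr1.
rewrite -/u mulrDl expRB expRD -[n%:R * _]mulrC expRM_natr lnK ?posrE//.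
have -> : expR (1 / 2 * ln u) = Num.sqrt u.
  by rewrite -powR12_sqrt ?ltW// /powR gt_eqF// mul1r.
have e1 : expR n.+1%:R = expR n%:R * expR 1 :> R by rewrite -expRD natr1.
rewrite /stirling e1 factS natrM nu exprMn sqrtrM ?(ltW n0')// !exprS.
have := expR_gt0 (n%:R : R); have := expR_gt0 (1 : R).
have : 0 < Num.sqrt (n%:R : R) by rewrite sqrtr_gt0.
have : 0 < Num.sqrt u by rewrite sqrtr_gt0.
have : 0 < n`!%:R :> R by rewrite ltr0n fact_gt0.
have : 0 < (n%:R : R) ^+ n by rewrite exprn_gt0.
have : 0 < u ^+ n by rewrite exprn_gt0.
move: (n`!%:R) (n%:R ^+ n) (u ^+ n) (Num.sqrt n%:R) (Num.sqrt u) (expR n%:R) (expR 1).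
move=> p1 p2 p3 p4 p5 p6 p7 *; field.
rewrite !gt_eqF//.
Qed.

(** The logarithm decreases, by at most (1/n - 1/(n+1)) / 4 at each step, so it stays bounded below.
    The value of the limit is only found later, from Poisson summation. *)
Lemma cvg_stirling_pos : exists2 C : R, 0 < C & stirling @ \oo --> C.
Proof.
pose L n : R := ln (stirling n.+1).
have dL n : 0 <= L n - L n.+1 <= (n.+1%:R^-1 - n.+2%:R^-1) / 4.
  have n0 : 0 < n.+1%:R :> R by rewrite ltr0n.
  have n1 : 0 < n.+2%:R :> R by rewrite ltr0n.
  pose u : R := n.+2%:R / n.+1%:R.
  have u1 : 1 <= u by rewrite ler_pdivlMr// mul1r ler_nat.
  have -> : L n - L n.+1 = (n.+1%:R + 1 / 2) * ln u - 1.
    rewrite /L -ln_div ?posrE ?stirling_gt0// stirling_ratio// expRK//.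
  have h1 := ln_le_sinh u1; have h2 := ln_ge_ratio u1.
  have e : n.+2%:R = n.+1%:R + 1 :> R by rewrite natr1.
  have N0 : 0 <= (n.+1%:R + 1 / 2 : R) by rewrite addr_ge0.
  have {}h1 := ler_wpM2l N0 h1; have {}h2 := ler_wpM2l N0 h2.
  have e1 : (n.+1%:R + 1 / 2) * (2 * (u - 1) / (u + 1)) = 1.
    rewrite /u e; move: (n.+1%:R) n0 => N N1; field.
    by rewrite !gt_eqF//; lra.
  have e2 : (n.+1%:R + 1 / 2) * ((u - u^-1) / 2) = 1 + (n.+1%:R^-1 - n.+2%:R^-1) / 4.
    rewrite /u e; move: (n.+1%:R) n0 => N N1; field.
    by rewrite !gt_eqF//; lra.
  by move: h1 h2; rewrite e1 e2 => h1 h2; rewrite subr_ge0 h2 lerBlDl.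
have ndL : nonincreasing_seq L.
  by apply/nonincreasing_seqP => n; have := dL n; lra.
have lbL n : L 0%N - 1 / 4 + n.+1%:R^-1 / 4 <= L n.
  elim: n => [|n IH]; first by rewrite invr1; lra.
  have := dL n; move: (n.+1%:R^-1) (n.+2%:R^-1) (L n) (L n.+1) IH => a b x y; lra.
have cL : cvgn L.
  apply: nonincreasing_is_cvgn => //.
  exists (L 0%N - 1 / 4) => _ [n _ <-]; apply: le_trans (lbL n).
  by rewrite lerDl divr_ge0.
exists (expR (limn L)); first exact: expR_gt0.
rewrite -(cvg_shiftS stirling).
have : expR (L n) @[n --> \oo] --> expR (limn L).
  by apply: continuous_cvg => //; exact: continuous_expR.
apply: cvg_trans; apply: near_eq_cvg; apply: nearW => n.
by rewrite /L lnK// posrE stirling_gt0.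
Qed.

Definition stirling_cst : R := limn stirling.

Lemma cvg_stirling : stirling @ \oo --> stirling_cst.
Proof. by have [C _ h] := cvg_stirling_pos; apply/cvg_ex; exists C. Qed.

Lemma stirling_cst_gt0 : 0 < stirling_cst.
Proof.
have [C C0 h] := cvg_stirling_pos.
by rewrite /stirling_cst (cvg_lim (@norm_hausdorff _ _) h).
Qed.

(** An exact identity, since powers and exponentials cancel; the asymptotics then need nothing
    beyond the limit of [stirling]. *)
Lemma central_bin_stirling (m : nat) : (0 < m)%N ->
  4 ^+ m / 'C(m.*2, m)%:R =
  Num.sqrt m%:R * (stirling m ^+ 2 / (Num.sqrt 2 * stirling m.*2)) :> R.
Proof.
move=> m0; have m0' : 0 < m%:R :> R by rewrite ltr0n.
have m2 : m.*2%:R = 2 * m%:R :> R by rewrite -muln2 natrM mulrC.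
have E : 'C(m.*2, m)%:R * m`!%:R ^+ 2 = (m.*2)`!%:R :> R.
  have mm : (m <= m.*2)%N by rewrite -addnn leq_addr.
  have <- := bin_fact mm; have -> : (m.*2 - m = m)%N by rewrite -addnn addnK.
  by rewrite !natrM expr2.
have e1 : expR m.*2%:R = expR m%:R ^+ 2 :> R.
  by rewrite m2 mulrC -[2 in LHS]/(2%:R) expRM_natr.
have e2 : m.*2%:R ^+ m.*2 = 4 ^+ m * (m%:R ^+ m) ^+ 2 :> R.
  rewrite m2 exprMn -mul2n !exprM (_ : 2 ^+ 2 = 4 :> R); last by ring.
  by congr (_ * _); rewrite exprAC.
rewrite /stirling e1 e2 m2 sqrtrM// -E.
have : Num.sqrt m%:R ^+ 2 = m%:R :> R by rewrite sqr_sqrtr// ltW.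
have : 0 < Num.sqrt (m%:R : R) by rewrite sqrtr_gt0.
have : 0 < Num.sqrt (2 : R) by rewrite sqrtr_gt0.
have : 0 < m`!%:R :> R by rewrite ltr0n fact_gt0.
have : 0 < 'C(m.*2, m)%:R :> R by rewrite ltr0n bin_gt0 -addnn leq_addr.
have : 0 < (m%:R : R) ^+ m by rewrite exprn_gt0.
have : 0 < (4 : R) ^+ m by rewrite exprn_gt0.
have := expR_gt0 (m%:R : R).
move: (m`!%:R) (m%:R ^+ m) ('C(m.*2, m)%:R) (Num.sqrt m%:R) (Num.sqrt 2) (expR m%:R) (4 ^+ m).
move=> p1 p2 p3 p4 p5 p6 p7 *; field.
by rewrite !gt_eqF.
Qed.

End stirling.

(** * Random walk on a cycle: diagonalization against path counting *)

Section cycle_walk.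
Context {R : realType}.

Lemma cosDnat2pi (x : R) (k : nat) : cos (x + 2 * pi * k%:R) = cos x.
Proof.
have -> : x + 2 * pi * k%:R = x + pi *+ 2 *+ k.
  by rewrite -[X in _ = _ + X]mulr_natr -(mulr_natr pi 2); ring.
exact (periodicn (@cosD2pi R) k x).
Qed.

Variable M : nat.
Hypothesis M_gt0 : (0 < M)%N.
Let theta (k : nat) : R := pi * k%:R / M%:R.

Let MN0 : M%:R != 0 :> R. Proof. by rewrite pnatr_eq0 -lt0n. Qed.

(** On integers this is M times the indicator of the multiples of M. *)
Definition dirichlet (y : R) : R := \sum_(0 <= k < M) cos (2 * theta k * y).

Lemma dirichletN y : dirichlet (- y) = dirichlet y.
Proof. by apply: eq_bigr => k _; rewrite mulrN cosN. Qed.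

Lemma dirichletDM y (n : nat) : dirichlet (y + (n * M)%:R) = dirichlet y.
Proof.
apply: eq_bigr => k _; rewrite natrM /theta.
rewrite (_ : 2 * (pi * k%:R / M%:R) * (y + n%:R * M%:R) =
   2 * (pi * k%:R / M%:R) * y + 2 * pi * (k * n)%:R); first exact: cosDnat2pi.
by rewrite natrM; field.
Qed.

Lemma dirichlet0 : dirichlet 0 = M%:R.
Proof.
rewrite /dirichlet (eq_bigr (fun=> 1)) => [|k _]; last by rewrite mulr0 cos0.
by rewrite big_const_nat subn0 iter_addr addr0 -[RHS]mul1r mulr_natr.
Qed.

Lemma dirichlet_eq0 (d : nat) : (0 < d < M)%N -> dirichlet d%:R = 0.
Proof.
move=> /andP[d0 dM]; pose phi : R := pi * d%:R / M%:R.
have sphi : 0 < sin phi.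
  apply: sin_gt0_pi; rewrite divr_gt0 ?mulr_gt0 ?pi_gt0 ?ltr0n//=.
  by rewrite ltr_pdivrMr ?ltr0n// ltr_pM2l ?pi_gt0// ltr_nat.
(* 2 sin phi cos (2 k phi) = sin ((2k+1) phi) - sin ((2k-1) phi) telescopes. *)
have tel n : 2 * sin phi * \sum_(0 <= k < n) cos (2 * theta k * d%:R) =
    sin (2 * n%:R * phi - phi) + sin phi.
  elim: n => [|n IH]; first by rewrite big_geq// !mulr0 mul0r add0r sinN addNr.
  rewrite big_nat_recr//= mulrDr IH.
  have -> : 2 * theta n * d%:R = 2 * n%:R * phi by rewrite /theta /phi; ring.
  have -> : 2 * n.+1%:R * phi - phi = 2 * n%:R * phi + phi by rewrite -natr1; ring.
  by rewrite sinB sinD; ring.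
have := tel M.
have -> : 2 * M%:R * phi - phi = - phi + 2 * pi * d%:R by rewrite /phi; field.
have -> : sin (- phi + 2 * pi * d%:R) = sin (- phi).
  have -> : - phi + 2 * pi * d%:R = - phi + pi *+ 2 *+ d by rewrite -[X in _ = _ + X]mulr_natr -(mulr_natr pi 2); ring.
  exact (periodicn (@sinD2pi R) d _).
rewrite sinN addNr => /eqP; rewrite mulf_eq0 => /orP[|/eqP//].
by rewrite mulf_eq0 pnatr_eq0/= gt_eqF.
Qed.

(* [walk N y / M] is the probability that the walk on Z/M whose steps are 0 or 1
   with equal odds goes from 0 to y in N steps, written in the eigenbasis. *)
Definition walk (N : nat) (y : R) : R :=
  \sum_(0 <= k < M) cos (theta k) ^+ N * cos (theta k * (N%:R - 2 * y)).

Lemma walkS N y : walk N.+1 y = (walk N y + walk N (y - 1)) / 2.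
Proof.
rewrite /walk -big_split/= mulr_suml; apply: eq_bigr => k _.
have -> : theta k * (N%:R - 2 * (y - 1)) = theta k * (N.+1%:R - 2 * y) + theta k.
  by rewrite -natr1; ring.
have -> : theta k * (N%:R - 2 * y) = theta k * (N.+1%:R - 2 * y) - theta k.
  by rewrite -natr1; ring.
by rewrite cosB cosD exprS; field.
Qed.

Lemma bin_sum_recl (N : nat) (g : nat -> R) :
  \sum_(0 <= i < N.+2) 'C(N.+1, i)%:R * g i =
  \sum_(0 <= i < N.+1) 'C(N, i)%:R * (g i + g i.+1).
Proof.
rewrite big_nat_recl//= bin0 mul1r.
under eq_bigr => i _ do rewrite binS natrD mulrDl.
rewrite big_split/= addrA.
under [RHS]eq_bigr => i _ do rewrite mulrDr.
rewrite [RHS]big_split/=; congr (_ + _).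
rewrite [RHS]big_nat_recl//= bin0 mul1r; congr (_ + _).
by rewrite big_nat_recr//= bin_small// mul0r addr0.
Qed.

(** The path-counting side, where [dirichlet] selects the endpoints congruent to y; the one-step
    recursion [walkS] matches Pascal's rule. *)
Lemma walkE N y :
  walk N y = (\sum_(0 <= i < N.+1) 'C(N, i)%:R * dirichlet (y - i%:R)) / 2 ^+ N.
Proof.
elim: N y => [|N IH] y.
  rewrite big_nat1 bin0 mul1r expr0 divr1 subr0 -dirichletN /walk /dirichlet.
  by apply: eq_bigr => k _; rewrite expr0 mul1r sub0r; congr cos; ring.
rewrite walkS !IH bin_sum_recl.
have -> : \sum_(0 <= i < N.+1) 'C(N, i)%:R * (dirichlet (y - i%:R) + dirichlet (y - i.+1%:R)) =
  \sum_(0 <= i < N.+1) 'C(N, i)%:R * dirichlet (y - i%:R) +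
  \sum_(0 <= i < N.+1) 'C(N, i)%:R * dirichlet (y - 1 - i%:R).
  rewrite -big_split/=; apply: eq_bigr => i _; rewrite mulrDr; congr (_ + _ * dirichlet _).
  by rewrite -natr1; ring.
by rewrite exprS; field; rewrite expf_neq0.
Qed.

Lemma sum_nat_block (K : nat) (f : nat -> R) :
  \sum_(0 <= j < K * M) f j = \sum_(0 <= n < K) \sum_(0 <= r < M) f (n * M + r)%N.
Proof.
elim: K => [|K IH]; first by rewrite mul0n !big_geq.
rewrite big_nat_recr//= -IH mulSn addnC.
rewrite (@big_cat_nat _ _ _ (K * M))//= ?leq_addr//; congr (_ + _).
rewrite -{1}[(K * M)%N]add0n big_addn addKn.
by apply: eq_bigr => r _; rewrite addnC.
Qed.

Lemma block_filter (K b : nat) (f : nat -> R) (h : nat -> R) : (b < M)%N ->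
  (forall n r, (r < M)%N -> h (n * M + r)%N = if r == b then M%:R else 0) ->
  \sum_(0 <= j < K * M) f j * h j = M%:R * \sum_(0 <= n < K) f (n * M + b)%N.
Proof.
move=> bM hE; rewrite sum_nat_block mulr_sumr; apply: eq_bigr => n _.
rewrite (bigD1_seq b) ?mem_index_iota ?iota_uniq//=.
rewrite hE// eqxx mulrC big1_seq ?addr0// => r /andP[rb].
by rewrite mem_index_iota/= => rM; rewrite hE// (negbTE rb) mulr0.
Qed.

Definition cbin (m j : nat) : R := 'C(m.*2, m + j)%:R.

Lemma cbin_small m j : (m < j)%N -> cbin m j = 0.
Proof. by move=> mj; rewrite /cbin bin_small// -addnn ltn_add2l. Qed.

(** Both sides describe the walk at m + b after 2m steps. Endpoints at or above m that are congruent
    to m + b give the first sum; those below m, reflected by the symmetry of binomials, give the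
    second. K > m is enough to reach every nonzero coefficient. *)
Lemma walk_cbin (m b K : nat) : (b < M)%N -> (m < K)%N ->
  \sum_(0 <= k < M) cos (theta k) ^+ m.*2 * cos (2 * theta k * b%:R) =
  M%:R / 4 ^+ m * (\sum_(0 <= n < K) cbin m (n * M + b)
                 + \sum_(0 <= n < K) cbin m (n * M + (M - b))).
Proof.
move=> bM mK.
have mKM : (m < K * M)%N by rewrite (leq_trans mK)// leq_pmulr.
transitivity (walk m.*2 (m + b)%:R).
  apply: eq_bigr => k _; congr (_ * _).
  rewrite -[LHS]cosN; congr cos.
  by rewrite natrD -muln2 natrM; ring.
have e4 : 2 ^+ m.*2 = 4 ^+ m :> R.
  by rewrite -mul2n exprM (_ : 2 ^+ 2 = 4 :> R)//; ring.
rewrite walkE e4 [RHS]mulrAC; congr (_ / _); rewrite -addnn -addSn.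
rewrite (@big_cat_nat _ _ _ m)//= ?(leq_trans (leqnSn m))// ?leq_addr//.
have E1 : \sum_(m <= i < m.+1 + m) 'C(m + m, i)%:R * dirichlet ((m + b)%:R - i%:R) =
    M%:R * \sum_(0 <= n < K) cbin m (n * M + b).
  rewrite -(@block_filter K b (cbin m) (fun j => dirichlet (b%:R - j%:R)))//; last first.
    move=> n r rM.
    have -> : b%:R - (n * M + r)%:R = - ((r%:R - b%:R) + (n * M)%:R) :> R.
      by rewrite natrD; ring.
    rewrite dirichletN dirichletDM.
    have [->|rb] := eqVneq r b; first by rewrite subrr dirichlet0.
    have [lt_rb|le_br] := ltnP r b.
      rewrite -dirichletN opprB -natrB ?(ltnW lt_rb)// dirichlet_eq0//.
      by rewrite subn_gt0 lt_rb (leq_ltn_trans (leq_subr _ _)).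
    rewrite -natrB// dirichlet_eq0// subn_gt0 ltn_neqAle eq_sym rb le_br/=.
    exact: leq_ltn_trans (leq_subr _ _) rM.
  rewrite (@big_cat_nat _ _ _ m.+1 0 (K * M))//= [X in _ = _ + X]big1_seq ?addr0; last first.
    by move=> j /andP[_]; rewrite mem_index_iota => /andP[mj _]; rewrite cbin_small ?mul0r.
  rewrite -{1}[m]add0n big_addn addnK.
  apply: eq_bigr => j _; rewrite /cbin addnn [(j + m)%N]addnC; congr (_ * dirichlet _).
  by rewrite !natrD; ring.
have E2 : \sum_(0 <= i < m) 'C(m + m, i)%:R * dirichlet ((m + b)%:R - i%:R) =
    M%:R * \sum_(0 <= n < K) cbin m (n * M + (M - b)).
  have -> : \sum_(0 <= n < K) cbin m (n * M + (M - b)) =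
            \sum_(0 <= n < K) cbin m (n * M + (M.-1 - b)).+1.
    apply: eq_bigr => n _; congr cbin; rewrite -addnS; congr addn.
    by rewrite -subSn ?prednK//; rewrite -ltnS prednK.
  (* For b = 0 the offset M - b is M, which is not a residue; counting from j + 1 replaces it by the
     residue M - 1 - b. *)
  have b'M : (M.-1 - b < M)%N by rewrite (leq_ltn_trans (leq_subr _ _))// prednK.
  rewrite -(@block_filter K (M.-1 - b) (fun j => cbin m j.+1)
     (fun j => dirichlet (b%:R + j.+1%:R)))//; last first.
    move=> n r rM.
    have -> : b%:R + (n * M + r).+1%:R = (b + r.+1)%:R + (n * M)%:R :> R.
      by rewrite -addnS !natrD; ring.
    rewrite dirichletDM.
    have [rb|rb] := eqVneq r (M.-1 - b)%N.
      have -> : (b + r.+1)%N = M by lia.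
      by have := dirichletDM 0 1; rewrite mul1n add0r dirichlet0.
    have [lt_M|le_M] := ltnP (b + r.+1) M; first by rewrite dirichlet_eq0//; lia.
    have -> : (b + r.+1)%N = ((b + r.+1 - M) + 1 * M)%N by lia.
    by rewrite natrD dirichletDM dirichlet_eq0//; lia.
  rewrite (@big_cat_nat _ _ _ m 0 (K * M))//= ?(ltnW mKM)//.
  rewrite [X in _ = _ + X]big1_seq ?addr0; last first.
    by move=> j /andP[_]; rewrite mem_index_iota => /andP[mj _]; rewrite cbin_small ?mul0r.
  rewrite big_nat_rev/= add0n; apply: eq_big_nat => j /andP[_ jm].
  rewrite /cbin -addnn; congr (_%:R * dirichlet _).
    have -> : (m - j.+1 = (m + m) - (m + j.+1))%N by lia.
    by rewrite bin_sub//; lia.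
  by rewrite natrB// !natrD; ring.
by rewrite E1 E2 mulrDr addrC.
Qed.

(** Frequencies k and M - k contribute equally, as the exponent 2m is even. With M odd only k = 0 is
    unpaired, and the angles kept stay below pi/2, where the cosine powers decay. *)
Lemma walk_sum_odd (H m b : nat) : M = H.*2.+1 ->
  \sum_(0 <= k < M) cos (theta k) ^+ m.*2 * cos (2 * theta k * b%:R) =
  1 + 2 * \sum_(0 <= k < H)
    cos (theta k.+1) ^+ m.*2 * cos (2 * theta k.+1 * b%:R).
Proof.
move=> MH; pose g k := cos (theta k) ^+ m.*2 * cos (2 * theta k * b%:R).
have gM k : (k <= M)%N -> g (M - k)%N = g k.
  move=> kM; rewrite /g.
  have -> : theta (M - k) = - theta k + pi by rewrite /theta natrB//; field.
  rewrite cosDpi cosN -mul2n !exprM sqrrN; congr (_ * _).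
  have -> : 2 * (- theta k + pi) * b%:R = - (2 * theta k * b%:R) + 2 * pi * b%:R by ring.
  by rewrite cosDnat2pi cosN.
rewrite -/(\sum_(0 <= k < M) g k) MH big_nat_recl//=.
rewrite {1}/g /theta mulr0 mul0r cos0 expr1n mul1r mulr0 mul0r cos0; congr (_ + _).
rewrite -addnn (@big_cat_nat _ _ _ H)//= ?leq_addr// mulrDl mul1r; congr (_ + _).
rewrite -{1}[H]add0n big_addn addnK big_nat_rev/= add0n.
apply: eq_big_nat => k /andP[_ kH]; rewrite -gM; last by lia.
by congr g; lia.
Qed.

End cycle_walk.

(** * Elementary bounds on sines, powers and central binomial ratios *)

Section elementary_limits.
Context {R : realType}.

Lemma sin_le_id (x : R) : 0 <= x -> sin x <= x.
Proof.
move=> x0.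
have := @is_derive_ge0 R (@id R - @sin R) (fun y => 1 - cos y) 0 x x0.
rewrite !fctE sin0 subr0 subr_ge0; apply => y _.
by rewrite subr_ge0 cos_le1.
Qed.

Lemma sin_ge_cos (x : R) : 0 <= x <= pi -> x * cos x <= sin x.
Proof.
move=> /andP[x0 xpi].
have := @is_derive_ge0 R (@sin R - @id R * @cos R) (fun y => y * sin y) 0 x x0.
rewrite !fctE sin0 mul0r subrr subr_ge0; apply => y /andP[y0 yx].
  by apply: is_derive_eq; rewrite /GRing.scale/=; ring.
by rewrite mulr_ge0// sin_ge0_pi// y0 (le_trans yx).
Qed.

(** With y = x/2, sin x = 2 sin y cos y >= 2 y cos^2 y, and 2 cos^2 y >= 1 because cos x >= 0. *)
Lemma sin_ge_half (x : R) : 0 <= x <= pi / 2 -> x / 2 <= sin x.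
Proof.
move=> /andP[x0 xp]; have pi0 := @pi_gt0 R.
have h : x / 2 * cos (x / 2) <= sin (x / 2).
  by apply: sin_ge_cos; apply/andP; split; lra.
have c0 : 0 <= cos (x / 2).
  by apply: cos_ge0_pihalf; apply/andP; split; lra.
have : 0 <= cos x by apply: cos_ge0_pihalf; apply/andP; split; lra.
have x2 : x = (x / 2) *+ 2 by rewrite -mulr_natr mulfVK.
rewrite [X in cos X]x2 [X in sin X]x2 cos_mulr2n sin_mulr2n !mulr2n.
have : 0 <= x / 2 by lra.
move: (x / 2) (cos (x / 2)) (sin (x / 2)) c0 h => y u v u0 h y0 w.
have h1 : 0 <= u * (v - y * u) by rewrite mulr_ge0// subr_ge0.
have h2 : 0 <= y * (u ^+ 2 + u ^+ 2 - 1) by rewrite mulr_ge0.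
nra.
Qed.

Lemma expRN_le_onem (u : R) (m : nat) : 0 <= u < 1 ->
  expR (- (m%:R * u / (1 - u))) <= (1 - u) ^+ m <= expR (- (m%:R * u)).
Proof.
move=> /andP[u0 u1]; have v0 : 0 < 1 - u by rewrite subr_gt0.
have v0' := ltW v0; apply/andP; split.
  rewrite -mulrA mulrC -mulNr expRM_natr lerXn2r ?nnegrE ?expR_ge0//.
  have h := expR_ge1Dx (u / (1 - u)).
  rewrite expRN -[leRHS]invrK lef_pV2 ?posrE ?expR_gt0 ?invr_gt0//.
  by apply: le_trans h; rewrite le_eqVlt; apply/predU1P; left; field; rewrite gt_eqF.
rewrite mulrC -mulNr expRM_natr lerXn2r ?nnegrE ?expR_ge0//.
by have := expR_ge1Dx (- u); lra.
Qed.

Lemma central_ratio_recr (m j : nat) : (j < m)%N ->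
  cbin m j.+1 * (m + j.+1)%:R = cbin m j * (m - j)%:R :> R.
Proof.
move=> jm; rewrite /cbin -!natrM addnS mulnC mul_bin_left mulnC.
by congr (_ * _)%:R; lia.
Qed.

Lemma cbin_gt0 m j : (j <= m)%N -> 0 < cbin m j :> R.
Proof. by move=> jm; rewrite ltr0n bin_gt0 -addnn leq_add2l. Qed.

(** The step factor (m-j)/(m+j+1) is both 1 - (2j+1)/(m+j+1) and the inverse of 1 + (2j+1)/(m-j). By
    1 + u <= e^u each form matches (j+1)^2 - j^2 = 2j+1, and the denominators of the exponents move
    the right way with j. *)
Lemma central_ratio_bound (m j : nat) : (j <= m)%N -> (0 < m)%N ->
  expR (- (j%:R ^+ 2 / (m%:R - j%:R + 1))) <= (cbin m j / cbin m 0 : R)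
    <= expR (- (j%:R ^+ 2 / (m%:R + j%:R))).
Proof.
move=> + m0; have m0' : 0 < m%:R :> R by rewrite ltr0n.
elim: j => [|j IH] jm.
  by rewrite expr0n !mul0r oppr0 expR0 mulfV ?lexx// gt_eqF// cbin_gt0.
have /andP[lo hi] := IH (ltnW jm).
have E : cbin m j.+1 / cbin m 0 = cbin m j / cbin m 0 * ((m%:R - j%:R) / (m%:R + j.+1%:R)) :> R.
  have := central_ratio_recr jm.
  rewrite natrB 1?ltnW// natrD => rec.
  have mj0 : m%:R + j.+1%:R != 0 :> R by rewrite -natrD pnatr_eq0 addnS.
  have -> : cbin m j.+1 = cbin m j * (m%:R - j%:R) / (m%:R + j.+1%:R) :> R.
    by rewrite -rec mulfK.
  by ring.
have mj : 1 <= m%:R - j%:R :> R by rewrite lerBrDr addrC natr1 ler_nat.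
have j0 : 0 <= j%:R :> R by [].
have q0 : 0 <= (m%:R - j%:R) / (m%:R + j.+1%:R) :> R.
  by rewrite divr_ge0//; lra.
rewrite -!natr1 in q0 E *; rewrite E.
move: (j%:R) (m%:R) mj j0 m0' lo hi q0 {E} => y z mj j0 z0 lo hi q0.
have w0 : 0 < z + (y + 1) by lra.
apply/andP; split.
  apply: le_trans (ler_wpM2r q0 lo).
  have -> : (z - y) / (z + (y + 1)) = (1 + (2 * y + 1) / (z - y))^-1.
    by field; rewrite !gt_eqF//; lra.
  have p0 : 0 < 1 + (2 * y + 1) / (z - y) by rewrite ltr_wpDr// divr_ge0//; lra.
  have h := expR_ge1Dx ((2 * y + 1) / (z - y)).
  apply: (@le_trans _ _ (expR (- (y ^+ 2 / (z - y + 1))) * expR (- ((2 * y + 1) / (z - y))))).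
    rewrite -expRD ler_expR -opprD lerN2.
    have -> : z - (y + 1) + 1 = z - y by ring.
    have -> : (y + 1) ^+ 2 / (z - y) = y ^+ 2 / (z - y) + (2 * y + 1) / (z - y) by ring.
    rewrite lerD2r ler_wpM2l ?sqr_ge0// lef_pV2 ?posrE; lra.
  by rewrite ler_wpM2l ?expR_ge0// expRN lef_pV2 ?posrE ?expR_gt0.
apply: le_trans (ler_wpM2r q0 hi) _.
have -> : (z - y) / (z + (y + 1)) = 1 + - ((2 * y + 1) / (z + (y + 1))).
  by field; rewrite !gt_eqF//; lra.
have h := expR_ge1Dx (- ((2 * y + 1) / (z + (y + 1)))).
apply: le_trans (ler_wpM2l (expR_ge0 _) h) _.
rewrite -expRD ler_expR -opprD lerN2.
have -> : (y + 1) ^+ 2 / (z + (y + 1)) = y ^+ 2 / (z + (y + 1)) + (2 * y + 1) / (z + (y + 1)) by ring.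
rewrite lerD2r ler_wpM2l ?sqr_ge0// lef_pV2 ?posrE; lra.
Qed.

End elementary_limits.

(** * Poisson summation for Gaussians, as the limit of large cycles *)

Section poisson.
Context {R : realType}.
Variables (c a : R).
Hypothesis c0 : 0 < c.
Hypothesis a01 : 0 <= a < 1.

(* Walk of length [2 m] on a cycle of odd length [M], observed at the fraction
   [a] of the cycle; [m] is chosen so that the limit profile is [gs c]. *)
Let M (H : nat) : nat := H.*2.+1.
Let m (H : nat) : nat := Num.truncn (2 * (M H)%:R ^+ 2 / c : R).
Let b (H : nat) : nat := Num.truncn ((M H)%:R * a : R).

Let M_gt0 H : 0 < (M H)%:R :> R. Proof. by rewrite ltr0n. Qed.

Let cvg_invM : (fun H => (M H)%:R^-1 : R) @ \oo --> (0 : R).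
Proof.
apply/cvgrPdist_le => e e0; near=> H.
have M0 : 0 < (M H)%:R :> R by rewrite ltr0n.
rewrite sub0r normrN ger0_norm ?invr_ge0// invf_ple ?posrE//.
apply: (@le_trans _ _ H%:R); first by near: H; exact: nbhs_infty_ger.
by rewrite ler_nat /M; lia.
Unshelve. all: by end_near. Qed.

Let cvg_truncn (y z : nat -> R) (l : R) :
  (forall H, 0 <= y H) -> (fun H => y H * z H) @ \oo --> l -> z @ \oo --> (0 : R) ->
  (fun H => (Num.truncn (y H))%:R * z H : R) @ \oo --> l.
Proof.
move=> y0 yl z0; apply/cvgrPdist_le => e e0.
have e2 : 0 < e / 2 by rewrite divr_gt0.
near=> H.
have h1 : `|l - y H * z H| <= e / 2 by near: H; exact: (cvgr_dist_le _ _ yl _ e2).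
have h2 : `|0 - z H| <= e / 2 by near: H; exact: (cvgr_dist_le _ _ z0 _ e2).
have /andP[t1 t2] := truncn_itv (y0 H).
have h3 : `|y H - (Num.truncn (y H))%:R| <= 1.
  by rewrite ger0_norm ?subr_ge0//; move: t2; rewrite -natr1; lra.
have h4 : `|y H * z H - (Num.truncn (y H))%:R * z H| <= e / 2.
  rewrite -mulrBl normrM; rewrite sub0r normrN in h2.
  by rewrite (le_trans _ h2)// ler_piMl.
have := ler_normD (l - y H * z H) (y H * z H - (Num.truncn (y H))%:R * z H).
rewrite addrA subrK; lra.
Unshelve. all: by end_near. Qed.

Let cvg_m : (fun H => (m H)%:R / (M H)%:R ^+ 2 : R) @ \oo --> 2 / c.
Proof.
apply: cvg_truncn => [H||].
- by rewrite divr_ge0 ?mulr_ge0 ?exprn_ge0// ltW.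
- rewrite (_ : (fun H => _) = cst (2 / c)); first exact: cvg_cst.
  apply/funext => H /=; move: (M_gt0 H); move: ((M H)%:R) => z z0; field.
  by rewrite !gt_eqF.
- rewrite -[X in _ --> X](mulr0 0); rewrite (_ : (fun H => _) = (fun H => (M H)%:R^-1 * (M H)%:R^-1)).
    exact: cvgM.
  by apply/funext => H; rewrite expr2 invfM.
Qed.

Let cvg_b : (fun H => (b H)%:R / (M H)%:R : R) @ \oo --> a.
Proof.
have /andP[a0 _] := a01.
apply: cvg_truncn => // [H|]; first by rewrite mulr_ge0.
rewrite (_ : (fun H => _) = cst a); first exact: cvg_cst.
by apply/funext => H /=; rewrite mulrAC mulfV ?mul1r// gt_eqF.
Qed.

Let b_lt H : (b H < M H)%N.
Proof.
have /andP[a0 a1] := a01.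
by rewrite truncn_lt_nat ?mulr_ge0// gtr_pMr// ltr0n.
Qed.

Let cvg_m0 : \forall H \near \oo, (0 < m H)%N.
Proof.
have h : 0 < 2 / c by rewrite divr_gt0.
near=> H.
have : 0 < (m H)%:R / (M H)%:R ^+ 2 :> R by near: H; exact: cvgr_gt cvg_m _ h.
by rewrite pmulr_lgt0 ?invr_gt0 ?exprn_gt0// ltr0n.
Unshelve. all: by end_near. Qed.

Let cvg_ratio (j : nat -> nat) (x : R) :
  (fun H => (j H)%:R / (M H)%:R : R) @ \oo --> x ->
  (fun H => cbin (m H) (j H) / cbin (m H) 0 : R) @ \oo --> expR (- (c * x ^+ 2 / 2)).
Proof.
move=> jx; have h2c : 0 < 2 / c by rewrite divr_gt0.
have cM0 := cvg_invM.
have near_lt : \forall H \near \oo, (j H <= m H)%N.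
  have h : (fun H => (m H)%:R / (M H)%:R ^+ 2 - (j H)%:R / (M H)%:R * (M H)%:R^-1 : R)
    @ \oo --> 2 / c - x * 0 by apply: cvgB => //; exact: cvgM.
  rewrite mulr0 subr0 in h; near=> H.
  have : 0 < (m H)%:R / (M H)%:R ^+ 2 - (j H)%:R / (M H)%:R * (M H)%:R^-1 :> R.
    by near: H; exact: cvgr_gt h _ h2c.
  rewrite -mulrA -invfM -expr2 -mulrBl pmulr_lgt0 ?invr_gt0 ?exprn_gt0//.
  by rewrite subr_gt0 ltr_nat => /ltnW.
have lim (d : nat -> R) : (fun H => d H / (M H)%:R ^+ 2) @ \oo --> 2 / c ->
    (fun H => expR (- ((j H)%:R ^+ 2 / d H))) @ \oo --> expR (- (c * x ^+ 2 / 2)).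
  move=> dH.
  have h : (fun H => ((j H)%:R / (M H)%:R) ^+ 2 * (d H / (M H)%:R ^+ 2)^-1) @ \oo -->
      x ^+ 2 * (2 / c)^-1.
    apply: cvgM; first exact: cvgM.
    by apply: cvgV => //; rewrite gt_eqF.
  apply: continuous_cvg; first exact: continuous_expR.
  apply: cvgN; rewrite (_ : c * x ^+ 2 / 2 = x ^+ 2 * (2 / c)^-1); last first.
    by field; rewrite gt_eqF.
  apply: cvg_trans h; apply: near_eq_cvg; apply: nearW => H.
  by rewrite expr_div_n invf_div mulrA mulfVK// expf_neq0// gt_eqF.
apply: (@squeeze_cvgr _ _ _ _
  (fun H => expR (- ((j H)%:R ^+ 2 / ((m H)%:R - (j H)%:R + 1))))
  (fun H => expR (- ((j H)%:R ^+ 2 / ((m H)%:R + (j H)%:R))))).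
- near=> H; apply: central_ratio_bound; first by near: H.
  by near: H; exact: cvg_m0.
- apply: lim; rewrite (_ : (fun H => _) = (fun H => (m H)%:R / (M H)%:R ^+ 2
     - (j H)%:R / (M H)%:R * (M H)%:R^-1 + (M H)%:R^-1 * (M H)%:R^-1)).
    rewrite -[X in _ --> X]addr0 -[X in _ --> X + _]subr0.
    rewrite -[X in _ --> _ - X + _](mulr0 x) -[X in _ --> _ + X](mulr0 0).
    by apply: cvgD; [apply: cvgB => //; exact: cvgM|exact: cvgM].
  apply/funext => H; field; rewrite gt_eqF//.
- apply: lim; rewrite (_ : (fun H => _) = (fun H => (m H)%:R / (M H)%:R ^+ 2
     + (j H)%:R / (M H)%:R * (M H)%:R^-1)).
    rewrite -[X in _ --> X]addr0 -[X in _ --> _ + X](mulr0 x).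
    by apply: cvgD => //; exact: cvgM.
  apply/funext => H; field; rewrite gt_eqF//.
Unshelve. all: by end_near. Qed.

(** Domination for the path counts: the exponent j^2/(m+j) is at least j^2/(2m) >= n^2 M^2/(2m) >= c
    n^2/4, as m <= 2 M^2/c. *)
Let ratio_le n j H : (n * M H <= j)%N ->
  cbin (m H) j / cbin (m H) 0 <= expR (- (c / 4)) ^+ n :> R.
Proof.
move=> nMj; have [jm|mj] := leqP j (m H); last first.
  by rewrite cbin_small// mul0r exprn_ge0// expR_ge0.
case: (posnP n) => [->|n0].
  rewrite expr0; case: (posnP (m H)) jm => [->|m0 jm].
    by rewrite leqn0 => /eqP ->; rewrite mulfV ?gt_eqF// cbin_gt0.
  have /andP[_] := @central_ratio_bound R _ _ jm m0.
  move=> /le_trans; apply; rewrite -[leRHS]expR0 ler_expR oppr_le0.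
  by rewrite divr_ge0 ?exprn_ge0.
have m0 : (0 < m H)%N by rewrite (leq_trans _ jm)// (leq_trans _ nMj)// muln_gt0 n0.
have /andP[_] := @central_ratio_bound R _ _ jm m0.
move=> /le_trans; apply; rewrite -expRM_natr ler_expR mulNr lerN2.
have m0' : 0 < (m H)%:R :> R by rewrite ltr0n.
have mM : (m H)%:R <= 2 * (M H)%:R ^+ 2 / c :> R.
  by rewrite /m truncn_le divr_ge0 ?mulr_ge0 ?exprn_ge0// ltW.
rewrite ler_pdivlMr ?ltr_wpDr//.
have h1 : n%:R * (M H)%:R <= j%:R :> R by rewrite -natrM ler_nat.
have h2 : j%:R <= (m H)%:R :> R by rewrite ler_nat.
have n1 : 1 <= n%:R :> R by rewrite ler1n.
have h3 : c * (m H)%:R <= 2 * (M H)%:R ^+ 2 by move: mM; rewrite ler_pdivlMr// mulrC.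
apply: (@le_trans _ _ ((n%:R * (M H)%:R) ^+ 2)); last first.
  by rewrite lerXn2r ?nnegrE ?mulr_ge0.
apply: (@le_trans _ _ (n%:R * (c * (m H)%:R) / 2)).
  have : 0 <= c * n%:R * ((m H)%:R - j%:R) by rewrite mulr_ge0 ?subr_ge0// mulr_ge0// ltW.
  by move: (n%:R) (j%:R) ((m H)%:R) => x y z; nra.
have M0 := sqr_ge0 ((M H)%:R : R).
apply: (@le_trans _ _ (n%:R * (2 * (M H)%:R ^+ 2) / 2)).
  by rewrite ler_pM2r ?invr_gt0// ler_wpM2l.
rewrite exprMn; move: (n%:R) ((M H)%:R ^+ 2) n1 M0 => x y x1 y0.
have : 0 <= x * y * (x - 1) by rewrite !mulr_ge0//; lra.
lra.
Qed.

(** cos^(2m) th = (1 - sin^2 th)^m behaves like e^(-m th^2), and m / M^2 tends to 2/c. *)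
Let cvg_cos_term (k : nat) :
  (fun H => cos (pi * k.+1%:R / (M H)%:R) ^+ (m H).*2 *
            cos (2 * (pi * k.+1%:R / (M H)%:R) * (b H)%:R) : R) @ \oo -->
  expR (- (2 * k.+1%:R ^+ 2 * pi ^+ 2 / c)) * cos (2 * k.+1%:R * pi * a).
Proof.
pose th H : R := pi * k.+1%:R / (M H)%:R.
have cth : th @ \oo --> (0 : R).
  by rewrite -[X in _ --> X](mulr0 (pi * k.+1%:R)); exact: cvgMr.
have th0 H : 0 <= th H by rewrite divr_ge0 ?mulr_ge0 ?pi_ge0.
have ccos : (fun H => cos (th H)) @ \oo --> (1 : R).
  by rewrite -[X in _ --> X](@cos0 R); apply: continuous_cvg => //; exact: continuous_cos.
have csin : (fun H => sin (th H)) @ \oo --> (0 : R).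
  by rewrite -[X in _ --> X](@sin0 R); apply: continuous_cvg => //; exact: continuous_sin.
pose L : R := 2 * k.+1%:R ^+ 2 * pi ^+ 2 / c.
have cmth : (fun H => (m H)%:R * th H ^+ 2) @ \oo --> L.
  have h : (fun H => pi ^+ 2 * k.+1%:R ^+ 2 * ((m H)%:R / (M H)%:R ^+ 2) : R) @ \oo -->
     pi ^+ 2 * k.+1%:R ^+ 2 * (2 / c) by exact: cvgMr.
  rewrite (_ : L = pi ^+ 2 * k.+1%:R ^+ 2 * (2 / c)); last by rewrite /L; ring.
  apply: cvg_trans h; apply: near_eq_cvg; apply: nearW => H.
  by rewrite /th !exprMn exprVn; ring.
pose u H : R := sin (th H) ^+ 2.
have near_pi : \forall H \near \oo, th H <= pi.
  by apply: cvgr_le cth _ _; exact: pi_gt0.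
have cmu : (fun H => (m H)%:R * u H) @ \oo --> L.
  apply: (@squeeze_cvgr _ _ _ _
    (fun H => (m H)%:R * th H ^+ 2 * cos (th H) ^+ 2) (fun H => (m H)%:R * th H ^+ 2)) => //.
  - near=> H; have tp : th H <= pi by near: H.
    have c0' : 0 <= cos (th H).
      by near: H; apply: (cvgr_ge _ ccos); exact: ltr01.
    have s1 : th H * cos (th H) <= sin (th H) by apply: sin_ge_cos; rewrite th0.
    have s2 := sin_le_id (th0 H).
    have s0 : 0 <= sin (th H) by apply: sin_ge0_pi; rewrite th0.
    rewrite -mulrA -exprMn; apply/andP; split; rewrite ler_wpM2l// lerXn2r ?nnegrE//.
    by rewrite mulr_ge0.
  - have c2 : (fun H => cos (th H) ^+ 2) @ \oo --> (1 : R).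
      rewrite -[X in _ --> X](mulr1 1).
      rewrite (_ : (fun H => _) = (fun H => cos (th H) * cos (th H))); first exact: cvgM.
      by apply/funext => H; rewrite expr2.
    by rewrite -[X in _ --> X]mulr1; exact: cvgM.
have cu : u @ \oo --> (0 : R).
  rewrite -[X in _ --> X](mulr0 0) (_ : u = (fun H => sin (th H) * sin (th H))).
    exact: cvgM.
  by apply/funext => H; rewrite /u expr2.
have c1u : (fun H => (1 - u H)^-1) @ \oo --> (1 : R).
  rewrite -[X in _ --> X]invr1; apply: cvgV; first exact: oner_neq0.
  by rewrite -[X in _ --> X]subr0; apply: cvgB => //; exact: cvg_cst.
have cpow : (fun H => (1 - u H) ^+ m H) @ \oo --> expR (- L).
  apply: (@squeeze_cvgr _ _ _ _ (fun H => expR (- ((m H)%:R * u H / (1 - u H))))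
     (fun H => expR (- ((m H)%:R * u H)))).
  - near=> H; apply: expRN_le_onem; rewrite sqr_ge0/=.
    by near: H; exact: cvgr_lt cu _ ltr01.
  - apply: continuous_cvg; first exact: continuous_expR.
    by apply: cvgN; rewrite -[X in _ --> X]mulr1; exact: cvgM.
  - by apply: continuous_cvg; [exact: continuous_expR|exact: cvgN].
apply: cvgM.
  apply: cvg_trans cpow; apply: near_eq_cvg; apply: nearW => H.
  by rewrite -mul2n exprM cos2sin2.
apply: continuous_cvg; first exact: continuous_cos.
have h : (fun H => 2 * k.+1%:R * pi * ((b H)%:R / (M H)%:R) : R) @ \oo --> 2 * k.+1%:R * pi * a.
  exact: cvgMr.
apply: cvg_trans h; apply: near_eq_cvg; apply: nearW => H.
by ring.
Unshelve. all: by end_near. Qed.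

(** Domination for the frequencies: sin th >= th/2, and eventually m / M^2 >= 1/c, so that m sin^2
    th >= (k+1)^2/c >= k/c. *)
Let cos_term_le : \forall H \near \oo, forall k, (k < H)%N ->
  `|cos (pi * k.+1%:R / (M H)%:R) ^+ (m H).*2 *
            cos (2 * (pi * k.+1%:R / (M H)%:R) * (b H)%:R)| <= expR (- c^-1) ^+ k :> R.
Proof.
have aux (p x y z : R) : z != 0 ->
    (p * x / z / 2) ^+ 2 * y = p ^+ 2 / 4 * x ^+ 2 * (y / z ^+ 2).
  by move=> z0; field.
have h1 : 1 / c < 2 / c by rewrite ltr_pM2r ?invr_gt0// ltr1n.
near=> H => k kH.
have mM : 1 / c <= (m H)%:R / (M H)%:R ^+ 2 :> R.
  by near: H; exact: (cvgr_ge _ cvg_m).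
rewrite normrM; apply: (@le_trans _ _ (`|cos (pi * k.+1%:R / (M H)%:R) ^+ (m H).*2| * 1)).
  by rewrite ler_wpM2l// cos_max.
set th := pi * k.+1%:R / (M H)%:R.
have th0 : 0 <= th by rewrite divr_ge0 ?mulr_ge0 ?pi_ge0.
have thp : th <= pi / 2.
  rewrite /th -mulrA ler_wpM2l ?pi_ge0// ler_pdivrMr// mulrC ler_pdivlMr//.
  by rewrite -natrM ler_nat /M; lia.
have s1 := @sin_ge_half R th; rewrite th0 thp in s1; have {}s1 := s1 isT.
rewrite mulr1 -mul2n exprM cos2sin2 ger0_norm; last first.
  by rewrite exprn_ge0// -cos2sin2 sqr_ge0.
apply: (@le_trans _ _ (expR (- (sin th ^+ 2)) ^+ m H)).
  have cc : 0 <= 1 - sin th ^+ 2 by rewrite -cos2sin2 sqr_ge0.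
  by rewrite lerXn2r ?nnegrE ?expR_ge0//; exact: expR_ge1Dx.
rewrite -!expRM_natr ler_expR !mulNr lerN2.
apply: (@le_trans _ _ ((th / 2) ^+ 2 * (m H)%:R)); last first.
  have t20 : 0 <= th / 2 by rewrite divr_ge0.
  have s0 := le_trans t20 s1.
  by rewrite ler_wpM2r// lerXn2r.
have -> : (th / 2) ^+ 2 * (m H)%:R =
   pi ^+ 2 / 4 * k.+1%:R ^+ 2 * ((m H)%:R / (M H)%:R ^+ 2).
  by rewrite /th aux// gt_eqF.
have p1 : 1 <= pi ^+ 2 / 4 :> R.
  by have := @pi_ge2 R; rewrite ler_pdivlMr// mul1r => p2; nra.
have k1 : k%:R <= k.+1%:R ^+ 2 :> R by rewrite -natrX ler_nat; nia.
have c'0 : 0 <= 1 / c by rewrite divr_ge0// ltW.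
apply: (@le_trans _ _ (k.+1%:R ^+ 2 * (1 / c))).
  by rewrite mulrC mul1r ler_wpM2r// invr_ge0 ltW.
apply: (@le_trans _ _ (pi ^+ 2 / 4 * k.+1%:R ^+ 2 * (1 / c))).
  by rewrite ler_wpM2r// ler_peMl// exprn_ge0.
by rewrite ler_wpM2l// mulr_ge0 ?exprn_ge0// (le_trans ler01).
Unshelve. all: by end_near. Qed.

Definition theta_term (x : R) (k : nat) : R :=
  expR (- (2 * k.+1%:R ^+ 2 * pi ^+ 2 / c)) * cos (2 * k.+1%:R * pi * x).

(** Divide [walk_cbin] by the central coefficient and let H grow, with [tannery] on both sides. The
    path counts become the two halves of [gsum], the frequencies become [theta_term], and [kap]
    collects the normalization, whose limit comes from [central_bin_stirling]. *)
Lemma poisson01 : cvgn (series (theta_term a)) /\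
  gsum c a = stirling_cst / Num.sqrt c * (1 + 2 * limn (series (theta_term a))).
Proof.
pose kap H : R := 4 ^+ m H / cbin (m H) 0 / (M H)%:R.
have m_oo (K : nat) : \forall H \near \oo, (K <= m H)%N.
  have h : 1 / c < 2 / c by rewrite ltr_pM2r ?invr_gt0// ltr1n.
  near=> H.
  have mM : 1 / c <= (m H)%:R / (M H)%:R ^+ 2 :> R.
    by near: H; exact: (cvgr_ge _ cvg_m).
  rewrite -(ler_nat R).
  have H0 : c * K%:R <= (M H)%:R.
    apply: (@le_trans _ _ H%:R); first by near: H; exact: nbhs_infty_ger.
    by rewrite ler_nat /M; lia.
  have M1 : 1 <= (M H)%:R :> R by rewrite ler1n.
  move: mM; rewrite ler_pdivlMr ?exprn_gt0//; apply: le_trans.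
  rewrite mul1r ler_pdivlMl//; apply: (le_trans H0).
  by rewrite expr2 ler_peMr.
have E H : kap H * (1 + 2 * \sum_(0 <= k < H)
    cos (pi * k.+1%:R / (M H)%:R) ^+ (m H).*2 *
            cos (2 * (pi * k.+1%:R / (M H)%:R) * (b H)%:R)) =
   \sum_(0 <= n < (m H).+1) cbin (m H) (n * M H + b H) / cbin (m H) 0 +
   \sum_(0 <= n < (m H).+1) cbin (m H) (n * M H + (M H - b H)) / cbin (m H) 0.
  have M0 : (0 < M H)%N by [].
  have e1 := @walk_cbin R (M H) M0 (m H) (b H) (m H).+1 (b_lt H) (ltnSn _).
  have e2 := @walk_sum_odd R (M H) M0 H (m H) (b H) erefl.
  rewrite -e2 e1 -!mulr_suml -mulrDl /kap.
  have c0' : cbin (m H) 0 != 0 :> R by rewrite gt_eqF// cbin_gt0.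
  have p4 : 4 ^+ m H != 0 :> R by rewrite expf_neq0.
  have Mn0 : (M H)%:R != 0 :> R by rewrite gt_eqF.
  move: (_ + _) (cbin _ 0) (4 ^+ m H) ((M H)%:R) c0' p4 Mn0 => x y z w *.
  by field; do ![apply/andP; split => //].
have ckap : kap @ \oo --> stirling_cst / Num.sqrt c.
  have sm : (fun H => stirling (m H) : R) @ \oo --> stirling_cst.
    apply: (@cvg_comp _ _ _ m stirling _ _ _ _ cvg_stirling).
    move=> A [K _ KA]; rewrite /nbhs/=; apply: filterS (m_oo K) => H Km.
    exact: KA.
  have sm2 : (fun H => stirling (m H).*2 : R) @ \oo --> stirling_cst.
    apply: (@cvg_comp _ _ _ (fun H => (m H).*2) stirling _ _ _ _ cvg_stirling).
    move=> A [K _ KA]; rewrite /nbhs/=; apply: filterS (m_oo K) => H Km.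
    by apply: KA; apply: (leq_trans Km); rewrite -addnn leq_addr.
  have s0 : stirling_cst != 0 :> R by rewrite gt_eqF// stirling_cst_gt0.
  have s20 : Num.sqrt 2 != 0 :> R by rewrite gt_eqF// sqrtr_gt0.
  have sq : (fun H => Num.sqrt ((m H)%:R / (M H)%:R ^+ 2) : R) @ \oo --> Num.sqrt (2 / c).
    by apply: continuous_cvg => //; exact: sqrt_continuous.
  have h : (fun H => Num.sqrt ((m H)%:R / (M H)%:R ^+ 2) *
     (stirling (m H) * stirling (m H) * (Num.sqrt 2 * stirling (m H).*2)^-1)) @ \oo -->
     Num.sqrt (2 / c) * (stirling_cst * stirling_cst * (Num.sqrt 2 * stirling_cst)^-1).
    apply: cvgM => //; apply: cvgM; first exact: cvgM.
    by apply: cvgV; [rewrite mulf_neq0|exact: cvgMr].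
  have -> : stirling_cst / Num.sqrt c = Num.sqrt (2 / c) *
      (stirling_cst * stirling_cst * (Num.sqrt 2 * stirling_cst)^-1) :> R.
    rewrite sqrtrM// sqrtrV ?ltW//; field.
    by rewrite s20 s0 gt_eqF// sqrtr_gt0.
  apply: cvg_trans h; apply: near_eq_cvg; near=> H.
  have m0 : (0 < m H)%N by near: H; exact: cvg_m0.
  rewrite /kap /cbin addn0 central_bin_stirling// sqrtrM// sqrtrV ?exprn_ge0//.
  rewrite sqrtr_sqr ger0_norm ?ltW//; ring.
have [cT hT] : cvgn (series (theta_term a)) /\ (fun H => \sum_(0 <= k < H)
    cos (pi * k.+1%:R / (M H)%:R) ^+ (m H).*2 *
            cos (2 * (pi * k.+1%:R / (M H)%:R) * (b H)%:R)) @ \oo -->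
    limn (series (theta_term a)).
  have /andP[z0 z1] : 0 <= (expR (- c^-1) : R) < 1.
    by rewrite expR_ge0/= -[ltRHS]expR0 ltr_expR oppr_lt0 invr_gt0.
  (* The domination only holds for k < H, so later terms are set to 0. *)
  have T := @tannery R (fun H k => if (k < H)%N then
      cos (pi * k.+1%:R / (M H)%:R) ^+ (m H).*2 *
            cos (2 * (pi * k.+1%:R / (M H)%:R) * (b H)%:R) else 0)
    (theta_term a) (fun k => expR (- c^-1) ^+ k) id.
  have [||||cT hT] := T.
  - move=> k; have h := @cvg_cos_term k; rewrite /theta_term.
    apply: cvg_trans h; apply: near_eq_cvg.
    by exists k.+1 => // H /= kH; rewrite kH.
  - apply: filterS cos_term_le => H hH k; case: ifPn => kH; first exact: hH.
    by rewrite normr0 exprn_ge0.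
  - apply: (@is_cvg_geometric_le _ _ 1 (expR (- c^-1))); first by rewrite z0.
    by move=> k; rewrite mul1r exprn_ge0/=.
  - by move=> K; exists K.
  split => //; apply: cvg_trans hT; apply: near_eq_cvg; apply: nearW => H.
  by apply: eq_big_nat => k /andP[_ ->].
split => //.
have z01 : 0 <= (expR (- (c / 4)) : R) < 1.
  by rewrite expR_ge0/= -[ltRHS]expR0 ltr_expR oppr_lt0 divr_gt0.
have cz : cvgn (series (fun k => expR (- (c / 4)) ^+ k : R)).
  apply: (@is_cvg_geometric_le _ _ 1 _ z01) => k.
  by have /andP[? _] := z01; rewrite mul1r exprn_ge0/=.
have r_ge0 p j : 0 <= cbin p j / cbin p 0 :> R by rewrite divr_ge0.
have N_oo (K : nat) : \forall H \near \oo, (K <= (m H).+1)%N.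
  by apply: filterS (m_oo K) => H; exact: leqW.
have cnM (n : nat) : (fun H => (n * M H)%:R / (M H)%:R : R) @ \oo --> (n%:R : R).
  rewrite (_ : (fun H => _) = cst n%:R); first exact: cvg_cst.
  by apply/funext => H; rewrite natrM mulfK// gt_eqF.
have [||||_ h1] := @tannery R (fun H n => cbin (m H) (n * M H + b H) / cbin (m H) 0)
  (fun n => gs c (n%:R - - a)) (fun k => expR (- (c / 4)) ^+ k) (fun H => (m H).+1).
- move=> n; rewrite /gs; apply: cvg_ratio; rewrite opprK.
  rewrite (_ : (fun H => _) = (fun H => (n * M H)%:R / (M H)%:R
      + (b H)%:R / (M H)%:R : R)); first exact: cvgD.
  by apply/funext => H; rewrite natrD mulrDl.
- apply: nearW => H n; rewrite ger0_norm//.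
  by apply: ratio_le; rewrite leq_addr.
- exact: cz.
- exact: N_oo.
have [||||_ h2] := @tannery R (fun H n => cbin (m H) (n * M H + (M H - b H)) / cbin (m H) 0)
  (fun n => gs c (n.+1%:R + - a)) (fun k => expR (- (c / 4)) ^+ k) (fun H => (m H).+1).
- move=> n; rewrite /gs; apply: cvg_ratio.
  rewrite (_ : (fun H => _) = (fun H => (n * M H)%:R / (M H)%:R
      + (1 - (b H)%:R / (M H)%:R) : R)).
    rewrite (_ : n.+1%:R + - a = n%:R + (1 - a)); last by rewrite -natr1; ring.
    by apply: cvgD => //; apply: cvgB => //; exact: cvg_cst.
  apply/funext => H; rewrite natrD (natrB _ (ltnW (b_lt H))) mulrDl mulrBl.
  by rewrite mulfV// gt_eqF.
- apply: nearW => H n; rewrite ger0_norm//.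
  by apply: ratio_le; rewrite leq_addr.
- exact: cz.
- exact: N_oo.
have hR := cvgD h1 h2.
have hL : (fun H => kap H * (1 + 2 * \sum_(0 <= k < H)
    cos (pi * k.+1%:R / (M H)%:R) ^+ (m H).*2 *
            cos (2 * (pi * k.+1%:R / (M H)%:R) * (b H)%:R))) @ \oo -->
   stirling_cst / Num.sqrt c * (1 + 2 * limn (series (theta_term a))).
  by apply: cvgM => //; apply: cvgD; [exact: cvg_cst|exact: cvgMr].
(* The walk counts displacements n + a and n + 1 - a, which are the two halves of the Gaussian sum
   at -a. *)
rewrite -(gsumN a c0) /gsum.
rewrite -(cvg_lim (@norm_hausdorff _ _) hL); apply/esym.
apply: (cvg_lim (@norm_hausdorff _ _)).
rewrite (_ : (fun H => _) = (fun H =>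
   \sum_(0 <= n < (m H).+1) cbin (m H) (n * M H + b H) / cbin (m H) 0 +
   \sum_(0 <= n < (m H).+1) cbin (m H) (n * M H + (M H - b H)) / cbin (m H) 0)).
  exact: hR.
exact/funext.
Unshelve. all: by end_near. Qed.

End poisson.

(** * The theta series: periodicity, Stirling's constant, lower bound, continuity *)

Section theta_series.
Context {R : realType}.

Lemma theta_termDn (c x : R) (n k : nat) : theta_term c (x + n%:R) k = theta_term c x k.
Proof.
rewrite /theta_term; congr (_ * _).
have -> : 2 * k.+1%:R * pi * (x + n%:R) = 2 * k.+1%:R * pi * x + 2 * pi * (k.+1 * n)%:R :> R.
  by rewrite natrM; ring.
exact: cosDnat2pi.
Qed.

Definition theta_sum (c x : R) : R := 1 + 2 * limn (series (theta_term c x)).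

Lemma theta_sumDn c x n : theta_sum c (x + n%:R) = theta_sum c x.
Proof.
rewrite /theta_sum.
have -> // : theta_term c (x + n%:R) = theta_term c x.
by apply/funext => k; rewrite theta_termDn.
Qed.

Lemma poisson c x : 0 < c -> 0 <= x ->
  gsum c x = stirling_cst / Num.sqrt c * theta_sum c x.
Proof.
move=> c0 x0; have /andP[n1 n2] := truncn_itv x0.
move: (Num.truncn x) n1 n2 => n n1 n2.
have [a xa] : exists a, x = a + n%:R by exists (x - n%:R); rewrite subrK.
have a01 : 0 <= a < 1 by move: n1 n2; rewrite xa -natr1; lra.
have [_ pa] := poisson01 c0 a01.
have -> : gsum c x = gsum c a.
  rewrite {1}xa; elim: n {n1 n2 a01 xa pa} a => [|n IH] a; first by rewrite addr0.
  by rewrite -natr1 addrA gsumD1.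
by rewrite pa xa theta_sumDn.
Qed.

(** At c = 2 pi the exponents c k^2/2 and 2 pi^2 k^2/c agree. *)
Lemma stirling_cstE : stirling_cst = Num.sqrt (2 * pi) :> R.
Proof.
have p2 : 0 < 2 * pi :> R by rewrite mulr_gt0 ?pi_gt0.
have g0 := gsum_gt0 0 p2.
have E : gsum (2 * pi) 0 = theta_sum (2 * pi) 0 :> R.
  rewrite /gsum /theta_sum.
  have [_ ->] := lim_series_recl (is_cvg_gs (x := 0) p2).
  have -> : theta_term (2 * pi) 0 = (fun k => gs (2 * pi) (k.+1%:R + 0) : R).
    apply/funext => k; rewrite /theta_term mulr0 cos0 mulr1 /gs addr0.
    congr expR; move: (lt0r_neq0 (@pi_gt0 R)); by move: pi => p pn; field; exact: pn.
  have E1 u v : u = v -> limn (series u) = limn (series v) :> R by move=> ->.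
  rewrite (E1 (fun k => gs (2 * pi) (k.+1%:R - 0)) (fun k => gs (2 * pi) (k.+1%:R + 0))).
    move: (limn _) => l.
    by rewrite subrr /gs expr0n/= mulr0 mul0r oppr0 expR0; ring.
  by apply/funext => k; rewrite subr0 addr0.
have := poisson p2 (lexx 0); rewrite E => h.
have t0 : 0 < theta_sum (2 * pi) 0 :> R by rewrite -E.
have s0 : 0 < Num.sqrt (2 * pi) :> R by rewrite sqrtr_gt0.
have : stirling_cst / Num.sqrt (2 * pi) = 1 :> R.
  by apply: (mulIf (lt0r_neq0 t0)); rewrite -h mul1r.
by move=> /(congr1 ( *%R^~ (Num.sqrt (2 * pi)))); rewrite mulfVK ?gt_eqF// mul1r.
Qed.

Let c : R := ln 2.

Lemma ln2_bounds : 1 / 2 <= (ln 2 : R) <= 1.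
Proof.
have h := @ln_ge_ratio R 2; apply/andP; split.
  have E : 2 * (2 - 1) / (2 + 1) = 2 / 3 :> R by field.
  by move: h; rewrite E => h; have := h (ltW (ltr1n R 2)); lra.
rewrite -[leRHS](@expRK R) ler_ln ?posrE ?expR_gt0//.
by have := @expR_ge1Dx R 1; lra.
Qed.

Let c0 : 0 < c. Proof. by have /andP[+ _] := ln2_bounds; rewrite /c; lra. Qed.

(** The exponent is at least 8 (k+1), as pi >= 2 and ln 2 <= 1, and e^8 >= 1 + 8. *)
Lemma theta_coef_le (k : nat) : expR (- (2 * k.+1%:R ^+ 2 * pi ^+ 2 / c)) <= 9^-1 ^+ k.+1.
Proof.
have /andP[_ c1] := ln2_bounds.
apply: (@le_trans _ _ (expR (- 8) ^+ k.+1)).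
  rewrite -expRM_natr ler_expR mulNr lerN2 ler_pdivlMr//.
  have p4 : 4 <= pi ^+ 2 :> R by have := @pi_ge2 R; nra.
  have k1 : k.+1%:R <= k.+1%:R ^+ 2 :> R by rewrite -natrX ler_nat; nia.
  have k0 : 0 <= k.+1%:R :> R by [].
  apply: (@le_trans _ _ (2 * k.+1%:R * 4)).
    have : 0 <= k.+1%:R * (1 - c) by rewrite mulr_ge0// subr_ge0.
    by move: (k.+1%:R) k0 => z z0; nra.
  by rewrite ler_pM// ?mulr_ge0// ler_wpM2l.
rewrite lerXn2r ?nnegrE ?expR_ge0 ?invr_ge0// expRN lef_pV2 ?posrE ?expR_gt0//.
by have := @expR_ge1Dx R 8; lra.
Qed.

Lemma theta_term_le x k : `|theta_term c x k| <= 9^-1 ^+ k.+1.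
Proof.
rewrite normrM ger0_norm ?expR_ge0//; apply: le_trans (theta_coef_le k).
by rewrite ler_piMr ?expR_ge0// cos_max.
Qed.

Lemma lim_geometric_succ (z : R) : 0 <= z < 1 ->
  cvgn (series (fun k => z ^+ k.+1)) /\
  limn (series (fun k => z ^+ k.+1)) = z / (1 - z).
Proof.
move=> /andP[z0 z1].
have -> : (fun k => z ^+ k.+1) = geometric z z.
  by apply/funext => k; rewrite /geometric/= exprS.
have zn : `|z| < 1 by rewrite ger0_norm.
split; first exact: is_cvg_geometric_series.
by apply/cvg_lim => //; exact: cvg_geometric_series.
Qed.

Lemma is_cvg_theta_term x : cvgn (series (theta_term c x)).
Proof.
apply: is_cvg_series_le (theta_term_le x) _.
by have [] := @lim_geometric_succ 9^-1 _ => //; apply/andP; split; lra.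
Qed.

Lemma theta_sum_ge x : 3 / 4 <= theta_sum c x.
Proof.
have [|cg lg] := @lim_geometric_succ 9^-1; first by apply/andP; split; lra.
have := lim_series_le_norm (theta_term_le x) cg.
rewrite lg ler_norml /theta_sum => /andP[+ _].
have -> : 9^-1 / (1 - 9^-1) = 1 / 8 :> R by field.
lra.
Qed.

Lemma cos_lipschitz (x y : R) : `|cos x - cos y| <= `|x - y|.
Proof.
wlog xy : x y / x <= y.
  move=> W; have [/W//|/ltW/W] := leP x y.
  by rewrite distrC (distrC y).
have h1 : x - cos x <= y - cos y.
  apply: (@is_derive_ge0 R (@id R - @cos R) (fun z => 1 + sin z) x y xy) => z _.
    by apply: is_derive_eq; rewrite opprK.
  by have := sin_geN1 z; lra.
have h2 : x + cos x <= y + cos y.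
  apply: (@is_derive_ge0 R (@id R + @cos R) (fun z => 1 - sin z) x y xy) => z _.
  by have := sin_le1 z; lra.
by rewrite (distrC x) (@ger0_norm _ (y - x)) ?subr_ge0// ler_norml; apply/andP; split; lra.
Qed.

(** Of 9^-(k+1) = 3^-(k+1) 3^-(k+1), one factor absorbs the k+1 produced by the cosine and the other
    sums to 1/2; 8 bounds 2 pi. *)
Lemma theta_sum_lipschitz x y : `|theta_sum c x - theta_sum c y| <= 8 * `|x - y|.
Proof.
have [|cg lg] := @lim_geometric_succ 3^-1; first by apply/andP; split; lra.
have cx := is_cvg_theta_term (x := x); have cy := is_cvg_theta_term (x := y).
have -> : theta_sum c x - theta_sum c y =
    2 * limn (series (theta_term c x - theta_term c y)).
  by rewrite lim_seriesB// /theta_sum; ring.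
have le k : `|(theta_term c x - theta_term c y) k| <= (8 * `|x - y|) * 3^-1 ^+ k.+1.
  rewrite !fctE /theta_term -mulrBr normrM ger0_norm ?expR_ge0//.
  apply: le_trans (ler_pM (expR_ge0 _) (normr_ge0 _) (theta_coef_le k) (cos_lipschitz _ _)) _.
  rewrite -mulrBr normrM ger0_norm ?mulr_ge0 ?pi_ge0//.
  have -> : 9^-1 = 3^-1 * 3^-1 :> R by field.
  rewrite exprMn; set u := 3^-1 ^+ k.+1.
  have u0 : 0 <= u by rewrite exprn_ge0.
  have ku : u * k.+1%:R <= 1.
    rewrite /u exprVn mulrC ler_pdivrMr ?exprn_gt0// mul1r -natrX ler_nat.
    exact: ltnW (ltn_expl _ _).
  have p4 : pi <= 4 :> R by have := @pihalf_lt2 R; lra.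
  have -> : u * u * (2 * k.+1%:R * pi * `|x - y|) =
     2 * (u * k.+1%:R) * pi * `|x - y| * u by ring.
  rewrite ler_wpM2r// ler_wpM2r//.
  have p0 := @pi_ge0 R; have k0 : 0 <= u * k.+1%:R by rewrite mulr_ge0.
  by move: (u * k.+1%:R) k0 ku => z z0 z1; nra.
pose g : R^nat := fun k => 3^-1 ^+ k.+1.
have cg' : cvgn (series ((8 * `|x - y|) *: g)) by exact: is_cvg_seriesZ.
have := @lim_series_le_norm _ _ ((8 * `|x - y|) *: g) le cg'.
rewrite lim_seriesZ// lg.
have -> : (8 * `|x - y|) *: (3^-1 / (1 - 3^-1)) = 4 * `|x - y| :> R.
  by rewrite /GRing.scale/=; field.
by move=> h; rewrite normrM ger0_norm//; lra.
Qed.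

Lemma theta3_theta_sum (y : R) : 1 / 2 <= y ->
  theta3 (frac_part y) = theta_sum c (y - 1 / 2).
Proof.
move=> y2; have y0 : 0 <= y by lra.
rewrite /theta3 /theta_sum /frac_part; congr (_ + _ * _).
have [N fN] : exists N : nat, Num.floor y = N%:Z.
  have : 0 <= Num.floor y by rewrite floor_ge0.
  by case: (Num.floor y) => // N _; exists N.
rewrite fN -pmulrn.
have E n : \sum_(1 <= k < n.+1) expR (- (2 * k%:R ^+ 2 * pi ^+ 2 / ln 2))
      * cos (2 * k%:R * pi * (1 / 2 - (y - N%:R))) = series (theta_term c (y - 1 / 2)) n.
  rewrite big_add1/=; apply: eq_bigr => k _; rewrite /theta_term; congr (_ * _).
  have -> : 2 * k.+1%:R * pi * (1 / 2 - (y - N%:R)) =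
     - (2 * k.+1%:R * pi * (y - 1 / 2)) + 2 * pi * (k.+1 * N)%:R :> R.
    by rewrite natrM; ring.
  by rewrite cosDnat2pi cosN.
apply: cvg_lim => //; rewrite -cvg_shiftS.
under eq_fun do rewrite E.
exact: is_cvg_theta_term.
Qed.

End theta_series.

(** * Two-sided bounds for J with explicit relative errors *)

Section limit_sandwich.
Context {R : realType}.
Let c : R := ln 2.

Let c0 : 0 < c. Proof. by rewrite ln_gt0// ltr1n. Qed.

Definition J_weight (j : nat) : R := (2 ^+ j.+1 - 1)^-1.

Lemma expr2_ge1 n : 1 <= 2 ^+ n :> R.
Proof. by rewrite exprn_ege1// ler1n. Qed.

Lemma J_weight_gt0 j : 0 < J_weight j.
Proof. by rewrite invr_gt0 exprS; have := expr2_ge1 j; lra. Qed.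

Lemma J_weight_half j : J_weight j.+1 <= J_weight j / 2.
Proof.
rewrite /J_weight -invfM lef_pV2 ?posrE ?(exprS _ j.+1) ?(exprS _ j); have := expr2_ge1 j; lra.
Qed.

Lemma J_weight_le n : J_weight n <= 2 ^- n.
Proof.
by rewrite /J_weight lef_pV2 ?posrE ?exprn_gt0// exprS; have := expr2_ge1 n; lra.
Qed.

Lemma J_weight_onem j : J_weight j * (1 - 2 ^- j.+1) = 2 ^- j.+1.
Proof.
have h : 2 ^+ j.+1 - 1 != 0 :> R.
  by rewrite gt_eqF// exprS; have := expr2_ge1 j; lra.
rewrite /J_weight; have : 2 ^+ j.+1 != 0 :> R by rewrite expf_neq0.
by move: (2 ^+ j.+1) h => z z0 z1; field; rewrite z0 z1.
Qed.

Lemma rate_sum_J_weight_le n : rate_sum J_weight n <= 2 ^+ n.+1.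
Proof.
rewrite /rate_sum; elim: n => [|n IH]; first by rewrite big_geq// exprn_ge0.
rewrite big_nat_recr//= {1}/J_weight invrK (exprS _ n.+1).
by move: IH; move: (\sum_(0 <= j < n) _) (2 ^+ n.+1) => u v; lra.
Qed.

Lemma rate_prod_J_weightE n :
  rate_prod J_weight n = expR (c * (n%:R * n.+1%:R / 2)) * qpoch n.
Proof.
rewrite /rate_prod; elim: n => [|n IH].
  by rewrite /qpoch !big_geq// mul0r mul0r mulr0 expR0 mulr1.
rewrite big_nat_recr//= IH qpochS {1}/J_weight invrK.
have -> : c * (n.+1%:R * n.+2%:R / 2) = c * (n%:R * n.+1%:R / 2) + c * n.+1%:R.
  by rewrite -[n.+2%:R]natr1 -[n.+1%:R]natr1; field.
rewrite expRD expRM_natr lnK ?posrE//.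
have h : 2 ^+ n.+1 != 0 :> R by rewrite expf_neq0.
by move: (2 ^+ n.+1) h (expR _) => z z0 y; field.
Qed.

(** Each weight is 2^-i / (1 - 2^-i), so passing to the pure powers of Euler's product costs at most
    the product of the 1 - 2^-i over i > n, which is at least 1 - 2^-n. *)
Lemma tail_prod_bounds n m (s rho : R) : 0 <= s ->
  expR (c * rho) = s / 2 ^+ n ->
  let D := \prod_(0 <= j < m) (1 + s * J_weight (n + j)%N) in
  let E := \prod_(0 <= j < m) (1 + expR (c * (rho - j.+1%:R))) in
  0 < E /\ E <= D /\ D * (1 - 2 ^- n) <= E.
Proof.
move=> s0 rhoE D E.
have g j : expR (c * (rho - j.+1%:R)) = s * 2 ^- (n + j).+1.
  rewrite mulrBr expRD rhoE expRN_ln2 -addnS exprD invfM.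
  by rewrite mulrA.
have gw j : s * 2 ^- (n + j).+1 <= s * J_weight (n + j)%N.
  by rewrite ler_wpM2l// -J_weight_onem ler_piMr ?(ltW (J_weight_gt0 _))//.
have E0 : 0 < E.
  by apply: prodr_gt0 => j _; have := expR_gt0 (c * (rho - j.+1%:R)); lra.
have ED : E <= D.
  apply: ler_prod => j _; rewrite addr_ge0 ?expR_ge0//= lerD2l g; exact: gw.
split=> //; split=> //.
have D0 : 0 <= D by apply: le_trans ED; exact: ltW.
have step : D * (qpoch (n + m) / qpoch n) <= E.
  have -> : qpoch (n + m) / qpoch n = \prod_(0 <= j < m) (1 - 2 ^- (n + j).+1) :> R.
    have qn := @qpoch_gt0 R n.
    rewrite /qpoch (@big_cat_nat _ _ _ n 0 (n + m)) ?leq_addr//= -/(qpoch n).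
    rewrite mulrC mulKf ?gt_eqF// -{1}[n]add0n big_addn addKn.
    by apply: eq_bigr => j _; rewrite addnC.
  rewrite -big_split/=; apply: ler_prod => j _.
  have w0 := J_weight_gt0 (n + j); have e1 := expr2_ge1 (n + j).+1.
  have v1 : 2 ^- (n + j).+1 <= 1 :> R by rewrite invf_le1 ?exprn_gt0.
  have v0 : 0 <= 2 ^- (n + j).+1 :> R by rewrite invr_ge0 exprn_ge0.
  have h1 : 0 <= s * J_weight (n + j) by rewrite mulr_ge0// ltW.
  apply/andP; split; first by apply: mulr_ge0; [exact: addr_ge0|lra].
  by rewrite g mulrDl mul1r -mulrA J_weight_onem lerD2r gerBl.
apply: le_trans step; rewrite ler_wpM2l// ler_pdivlMr ?qpoch_gt0//.
apply: le_trans (qpoch_addn n m); rewrite mulrC ler_wpM2l ?(ltW (qpoch_gt0 _))//.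
by rewrite lerDl invr_ge0 exprn_ge0.
Qed.

Context (d : measure_display) (T : measurableType d).
Variables (P : probability T R) (X : nat -> {RV P >-> R}).
Hypothesis X_indep : independent_RVs X.
Hypothesis X_exp : forall j, exponential_RV 1 (X j).

(** The errors in [cdf_sandwich] and [tail_prod_bounds] do not depend on the number m of tail terms,
    so m may tend to infinity. *)
Lemma J_sandwich n (t rho : R) (r := rate_sum J_weight n * t / n.+1%:R)
    (q := 16 / n%:R * (1 + n%:R / t * J_weight n))
    (W := rate_prod J_weight n * fpow n t / euler rho) :
  (0 < n)%N -> 0 < t -> expR (c * rho) = n%:R / t / 2 ^+ n ->
  r <= 1 -> q <= 1 ->
  (1 - r) * (1 - q) * (1 - 2 ^- n) * W
    <= fine (P [set w | (J X w <= t%:E)%E]) <= W.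
Proof.
move=> n0 t0 rhoE r1 q1.
pose F m := fine (P [set w | psum X J_weight (n + m) w <= t]).
have cF : F @ \oo --> fine (P [set w | (J X w <= t%:E)%E]).
  have := @cvg_psum_cdf _ _ _ P X J_weight X_exp (fun j => ltW (J_weight_gt0 j)) t.
  rewrite -(cvg_shiftn n).
  by apply: cvg_trans; apply: near_eq_cvg; near=> m; rewrite /= /F addnC.
pose E m := \prod_(0 <= j < m) (1 + expR (c * (rho - j.+1%:R))).
pose V := rate_prod J_weight n * fpow n t.
have V0 : 0 <= V.
  rewrite mulr_ge0//; first by apply: prodr_ge0 => j _; rewrite invr_ge0 ltW ?J_weight_gt0.
  by rewrite divr_ge0 ?exprn_ge0// ltW.
have cE : (fun m => V / E m) @ \oo --> W.
  apply: cvgM; first exact: cvg_cst.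
  apply: cvgV; last exact: cvg_euler_prod.
  by rewrite gt_eqF// (lt_le_trans _ (euler_ge1 _)).
have s0 : 0 <= n%:R / t by rewrite divr_ge0// ltW.
have Dt : rate_sum J_weight n * t <= n.+1%:R by move: r1; rewrite ler_pdivrMr// mul1r.
have bd m : (1 - r) * (1 - q) * (1 - 2 ^- n) * (V / E m) <= F m <= V / E m.
  have [Em0 [ED DE]] := tail_prod_bounds m s0 rhoE.
  have D0 := lt_le_trans Em0 ED.
  have /andP[lo hi] := cdf_sandwich X_indep X_exp J_weight_gt0 J_weight_half m n0 t0 Dt.
  apply/andP; split; last first.
    by apply: le_trans hi _; rewrite ler_wpM2l// lef_pV2.
  apply: le_trans lo; rewrite -/r -/q -(mulrA ((1 - r) * (1 - q))).
  rewrite ler_wpM2l//; first by rewrite mulr_ge0 ?subr_ge0.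
  rewrite mulrCA ler_wpM2l// ler_pdivrMr// mulrC ler_pdivlMr//.
  by rewrite mulrC.
have cA : (fun m => (1 - r) * (1 - q) * (1 - 2 ^- n) * (V / E m)) @ \oo -->
    (1 - r) * (1 - q) * (1 - 2 ^- n) * W.
  by apply: cvgM cE; exact: cvg_cst.
apply/andP; split.
  by apply: (ler_cvg_to cA cF); near=> m; have /andP[] := bd m.
by apply: (ler_cvg_to cF cE); near=> m; have /andP[] := bd m.
Unshelve. all: by end_near. Qed.

End limit_sandwich.

(** * Exact factorization of the ratio between the bound and the claimed asymptotics *)

Section asymptotic_ratio.
Context {R : realType}.
Let c : R := ln 2.

Let c0 : 0 < c. Proof. by rewrite ln_gt0// ltr1n. Qed.

Lemma euler_prod_sqE : euler_prod_sq R = qpoch_oo ^+ 2.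
Proof.
rewrite /euler_prod_sq; apply/cvg_lim => //; rewrite -cvg_shiftS.
have -> : (fun n => \prod_(1 <= j < n.+1) ((1 - 2 ^- j) ^+ 2 : R)) = (fun n => qpoch n ^+ 2).
  by apply/funext => n; rewrite big_add1/= /qpoch prodrXl.
by apply: cvgM; exact: cvg_qpoch.
Qed.

Lemma psi_expRN (L : R) : 0 < L -> psi (expR (- (c * L))) = L + ln L / c.
Proof.
move=> L0; rewrite /psi div1r expRN invrK expRK lnM ?posrE// -/c.
by field; exact: lt0r_neq0.
Qed.

Lemma J_asymp_expRN (L : R) (ps := L + ln L / c) : 0 < L -> 1 / 2 <= ps ->
  J_asymp (expR (- (c * L))) =
  Num.sqrt c * qpoch_oo ^+ 2 / (2 * pi * theta_sum c (ps - 1 / 2)) *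
  expR (c * L / 2 + L - c / 8 - c * ps ^+ 2 / 2).
Proof.
move=> L0 ps2; rewrite /J_asymp euler_prod_sqE psi_expRN// -/ps theta3_theta_sum//.
rewrite -/c /powR !gt_eqF ?expR_gt0// expRK -/c.
have -> : c * L / 2 + L - c / 8 - c * ps ^+ 2 / 2 =
    - (1 / 8 * c) + - (c / 2 * ps ^+ 2) + - (1 / 2 + 1 / c) * - (c * L).
  by field; exact: lt0r_neq0.
rewrite !expRD (expRN (1 / 8 * c)).
have e0 := expR_gt0 (1 / 8 * c).
have t0 : theta_sum c (ps - 1 / 2) != 0.
  by rewrite gt_eqF// (lt_le_trans _ (theta_sum_ge _)).
move: (lt0r_neq0 (@pi_gt0 R)) (lt0r_neq0 e0) t0.
move: pi (expR (1 / 8 * c)) (theta_sum _ _) (expR (- _)) (expR (_ * _)) (Num.sqrt c) qpoch_oo.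
by move=> p e th u v w z p0 {}e0 th0; field; rewrite p0 e0 th0.
Qed.

Lemma fact_stirlingE (n : nat) : (0 < n)%N ->
  n`!%:R = stirling n * expR (n%:R * ln n%:R + ln n%:R / 2 - n%:R) :> R.
Proof.
move=> n0; have N0 : 0 < n%:R :> R by rewrite ltr0n.
rewrite !expRD expRN (mulrC n%:R (ln _)) expRM_natr lnK ?posrE//.
have -> : expR (ln n%:R / 2) = Num.sqrt n%:R :> R.
  rewrite -[RHS]ger0_norm ?sqrtr_ge0// -(@sqrtr_sqr _ (Num.sqrt _)).
  rewrite sqr_sqrtr// -[in RHS](@lnK _ n%:R) ?posrE//.
  by rewrite -[LHS]ger0_norm ?expR_ge0// -sqrtr_sqr -expRM_natr mulfVK.
have s0 : Num.sqrt n%:R != 0 :> R by rewrite gt_eqF ?sqrtr_gt0.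
have X0 : n%:R ^+ n != 0 :> R by rewrite expf_neq0// gt_eqF.
have e0 := lt0r_neq0 (expR_gt0 (n%:R : R)).
have G (u v e f : R) : u != 0 -> v != 0 -> e != 0 -> f = f * e / (v * u) * (v * u / e).
  by move=> u0 v0 {}e0; field; rewrite u0 v0 e0.
exact: G.
Qed.

(** An identity without error terms: each of the five factors on the right will be shown to tend to
    1. Here L = log_2 (1/t), and [del] is log_2 (n/L). *)
Lemma asymptotic_ratio (n : nat) (L rho : R) (t := expR (- (c * L)))
    (ps := L + ln L / c) (del := ln (n%:R / L) / c) (x := rho - 1 / 2) :
  (0 < n)%N -> 0 < L -> 1 / 2 <= ps -> 0 <= x ->
  c * rho = ln n%:R + c * L - c * n%:R ->
  rate_prod J_weight n * fpow n t / euler rho / J_asymp t =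
  (qpoch n / qpoch_oo) * (Num.sqrt (2 * pi) / stirling n) *
  (expR (c * x ^+ 2 / 2) * gsum c x / (qpoch_oo * euler rho)) *
  (theta_sum c (ps - 1 / 2) / theta_sum c (ps + del - 1 / 2)) *
  expR (n%:R - L - c * ps * del - c * del ^+ 2 / 2).
Proof.
move=> n0 L0 ps2 x0 rhoE.
have N0 : 0 < n%:R :> R by rewrite ltr0n.
have cn := lt0r_neq0 c0.
(* [rho] differs from psi(t) by the small [del] and the integer n; the latter is invisible to the
   theta series. *)
have rE : rho = ps + del - n%:R.
  apply: (mulfI cn); rewrite rhoE /ps /del lnM ?posrE ?invr_gt0// lnV ?posrE//.
  by field.
have lnn : ln n%:R = c * (n%:R + rho - L) by move: rhoE; lra.
have xE : theta_sum c (ps + del - 1 / 2) = theta_sum c x.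
  by rewrite -(theta_sumDn c x n) /x rE; congr theta_sum; ring.
rewrite rate_prod_J_weightE J_asymp_expRN// -/ps xE poisson// stirling_cstE /fpow fact_stirlingE//.
rewrite /t -expRM_natr.
set e1 := expR _; set e2 := expR _; set e3 := expR _; set e4 := expR _.
set e5 := expR _; set e6 := expR _.
have p0 : 0 < 2 * pi :> R by rewrite mulr_gt0 ?pi_gt0.
have [s0 sE] : Num.sqrt (2 * pi) != 0 :> R /\ 2 * pi = Num.sqrt (2 * pi) ^+ 2 :> R.
  by rewrite gt_eqF ?sqrtr_gt0// sqr_sqrtr// ltW.
(* All exponentials are merged; after eliminating ln n, the exponents agree as polynomials. *)
have E : e1 = e3 * e4 * e5 * e6 / e2.
  apply: (mulIf (lt0r_neq0 (expR_gt0 _ : 0 < e2))); rewrite mulfVK ?gt_eqF ?expR_gt0//.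
  rewrite /e1 /e2 /e3 /e4 /e5 /e6 -!expRD; congr expR.
  have dE : del = n%:R + rho - ps by rewrite rE; ring.
  by rewrite -/c lnn dE /x -[n.+1%:R]natr1; move: (n%:R : R) => N; field.
move: s0 sE; move: (Num.sqrt (2 * pi)) => s s0 sE; rewrite sE E; clear E sE.
have q0 : qpoch_oo != 0 :> R := lt0r_neq0 qpoch_oo_gt0.
have st0 := lt0r_neq0 (@stirling_gt0 R n n0).
have eu0 : euler rho != 0 by rewrite gt_eqF// (lt_le_trans _ (euler_ge1 _)).
have sc0 : Num.sqrt c != 0 by rewrite gt_eqF ?sqrtr_gt0.
have th y : theta_sum c y != 0 by rewrite gt_eqF// (lt_le_trans _ (theta_sum_ge _)).
have [e20 e30 e40] : [/\ e2 != 0, e3 != 0 & e4 != 0] by split; rewrite gt_eqF ?expR_gt0.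
move: (th x) (th (ps - 1 / 2)) s0 q0 st0 eu0 sc0 e20 e30 e40.
move: (theta_sum c x) (theta_sum c (ps - 1 / 2)) s qpoch_oo (stirling n).
move: (euler rho) (Num.sqrt c) (qpoch n) e2 e3 e4 e5 e6.
clear; move=> eu sc qn e2 e3 e4 e5 e6 tx tp s q st.
move=> h1 h2 h3 h4 h5 h6 h7 h8 h9 h10.
by field; rewrite h1 h2 h3 h4 h5 h6 h7 h8 h9 h10.
Qed.

End asymptotic_ratio.

(** * Error estimates at the chosen level n *)

Section estimates.
Context {R : realType}.
Let c : R := ln 2.

Let c0 : 0 < c. Proof. by rewrite ln_gt0// ltr1n. Qed.
Let expRc : expR c = 2. Proof. by rewrite lnK// posrE. Qed.

(** The lower bound on the logarithm is ln z <= z - 1 at z = 1 / (1 + u), and z <= 2. *)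
Lemma ln1D_bounds (u : R) : `|u| <= 1 / 2 ->
  `|ln (1 + u)| <= 2 * `|u| /\ `|u - ln (1 + u)| <= 2 * u ^+ 2.
Proof.
move=> u2; have /andP[u1 u1'] : - (1 / 2) <= u <= 1 / 2 by rewrite -ler_norml.
have v0 : 0 < 1 + u by lra.
have up : ln (1 + u) <= u by rewrite le_ln1Dx//; lra.
have vi : (1 + u) * (1 + u)^-1 = 1 by rewrite divff// gt_eqF.
have vi0 : 0 < (1 + u)^-1 by rewrite invr_gt0.
have vi2 : (1 + u)^-1 <= 2 by move: vi vi0; move: (1 + u)^-1 => z; nra.
have lo : u - u ^+ 2 * (1 + u)^-1 <= ln (1 + u).
  rewrite -[1 + u in leRHS]invrK lnV ?posrE//.
  have := @le_ln1Dx R ((1 + u)^-1 - 1); rewrite addrCA subrr addr0.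
  move=> /(_ ltac:(lra)); move: vi; move: (1 + u)^-1 => z vi; move: (ln z) => y h.
  have -> : u - u ^+ 2 * z = u - u * ((1 + u) * z - z) by ring.
  rewrite vi; have : (1 + u) * z = 1 by []; lra.
have usq : 0 <= u ^+ 2 by rewrite sqr_ge0.
have lo' : u - 2 * u ^+ 2 <= ln (1 + u).
  by apply: le_trans lo; move: vi2; move: (1 + u)^-1 => z h; nra.
split; last by rewrite ger0_norm ?subr_ge0//; lra.
have nu := ler_norm u; have nu' := ler_norm (- u); rewrite normrN in nu'.
have un : u ^+ 2 <= `|u| / 2 by rewrite -real_normK ?num_real// expr2; nra.
by rewrite ler_norml; apply/andP; split; lra.
Qed.

Lemma prod3_ge (x y z : R) : 0 <= x <= 1 -> 0 <= y <= 1 -> 0 <= z <= 1 ->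
  1 - (x + y + z) <= (1 - x) * (1 - y) * (1 - z).
Proof.
move=> /andP[x0 x1] /andP[y0 y1] /andP[z0 z1].
have h : 1 - (x + y) <= (1 - x) * (1 - y) by nra.
have h0 : (1 - x) * (1 - y) <= 1 by nra.
by move: h h0; move: ((1 - x) * (1 - y)) => w h h0; nra.
Qed.

(* [level_time l] is the t with log log_2 (1/t) = l, [level] the number of
   terms in the head, and 2^(level_rho l) = n/(2^n t) for n = [level l]. *)
Definition level (l : R) : nat := Num.truncn (expR l + l / (2 * c)).
Definition level_time (l : R) : R := expR (- (c * expR l)).
Definition level_rho (l : R) : R := (ln (level l)%:R + c * expR l - c * (level l)%:R) / c.
(** This is L^(-1/2) for L = e^l = log_2 (1/t), the common order of the balanced errors. *)
Definition level_err (l : R) : R := expR (- (l / 2)).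

Section at_level.
Variable l : R.
Hypothesis l100 : 100 <= l.
Let L := expR l.
Let e := level_err l.
Let n := level l.

Let e0 : 0 < e. Proof. exact: expR_gt0. Qed.

Let e_small : e <= 1 / 51.
Proof.
have h := @expR_ge1Dx R (l / 2).
rewrite /e /level_err expRN div1r lef_pV2 ?posrE ?expR_gt0//; have l1 := l100; lra.
Qed.

Let Le2 : L * e ^+ 2 = 1.
Proof.
rewrite /L /e /level_err -expRM_natr -expRD; have -> : l + - (l / 2) * 2 = 0 by field.
exact: expR0.
Qed.

(** Square l + 1 <= 4 e^(l/4). It lets errors of order l^2 / L be absorbed into order L^(-1/2). *)
Let lsq : (l + 1) ^+ 2 * e <= 16.
Proof.
have h := @expR_ge1Dx R (l / 4).
have E : expR (l / 4) ^+ 2 * e = 1.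
  rewrite /e /level_err -expRM_natr -expRD; have -> : l / 4 * 2 + - (l / 2) = 0 by field.
  exact: expR0.
have h2 : (l + 1) ^+ 2 <= 16 * expR (l / 4) ^+ 2.
  by have l1 := l100; move: h; move: (expR _) => z h; nra.
have -> : 16 = 16 * expR (l / 4) ^+ 2 * e by rewrite -mulrA E mulr1.
by rewrite ler_wpM2r// ltW.
Qed.

Let l_c : 0 <= l / (2 * c) <= l.
Proof.
have /andP[h1 h2] := @ln2_bounds R; rewrite -/c in h1 h2.
have l1 := l100; have d0 : 0 < 2 * c by lra.
apply/andP; split; first by apply: divr_ge0; lra.
by rewrite ler_pdivrMr// ler_peMr//; lra.
Qed.

Let level_bounds : n%:R <= L + l / (2 * c) < n%:R + 1.
Proof.
have /andP[h1 h2] := l_c.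
by rewrite natr1 truncn_itv// addr_ge0// expR_ge0.
Qed.

Lemma level_dist : `|n%:R - L| <= l + 1.
Proof.
have /andP[h1 h2] := l_c; have /andP[h3 h4] := level_bounds.
by rewrite ler_norml; apply/andP; split; have l1 := l100; lra.
Qed.

Lemma level_ge_half : L / 2 <= n%:R.
Proof.
have /andP[h1 h2] := l_c; have /andP[h3 h4] := level_bounds.
have : 2 <= L by have := @expR_ge1Dx R l; have l1 := l100; rewrite -/L; lra.
lra.
Qed.

Lemma level_gt0 : (0 < n)%N.
Proof. by rewrite -(ltr0n R) (lt_le_trans _ level_ge_half)// divr_gt0// expR_gt0. Qed.

Let N0 : 0 < n%:R :> R. Proof. by rewrite ltr0n level_gt0. Qed.

Let L0 : 0 < L. Proof. exact: expR_gt0. Qed.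

Let tau := 2 ^+ n * level_time l.

(** The summand l / (2c) in [level] contributes the factor e^(l/2) = 1/e, and truncation loses at
    most a factor 2. *)
Let tau_bounds : 1 / 2 <= tau * e <= 1.
Proof.
have -> : tau = expR (c * (n%:R - L)).
  by rewrite mulrBr expRD expRM_natr expRc.
have /andP[h3 h4] := level_bounds.
have E : l / (2 * c) * c = l / 2 by field; exact: lt0r_neq0.
have -> : 1 / 2 = expR (- c) by rewrite expRN expRc div1r.
rewrite /e /level_err -expRD; apply/andP; split.
  have : 0 <= (n%:R + 1 - (L + l / (2 * c))) * c by rewrite mulr_ge0 ?(ltW c0)//; lra.
  by rewrite ler_expR; lra.
have : 0 <= (L + l / (2 * c) - n%:R) * c by rewrite mulr_ge0 ?(ltW c0)//; lra.
by move=> h; rewrite -[leRHS]expR0 ler_expR; lra.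
Qed.

Let invn_le : n%:R^-1 <= 2 * e ^+ 2.
Proof.
have h := level_ge_half; have i : n%:R * n%:R^-1 = 1 :> R by rewrite divff// gt_eqF.
have i0 : 0 < n%:R^-1 :> R by rewrite invr_gt0.
have : e ^+ 2 * (L / 2) * n%:R^-1 <= e ^+ 2 * n%:R * n%:R^-1.
  by rewrite ler_wpM2r ?(ltW i0)// ler_wpM2l ?sqr_ge0.
rewrite -(mulrA (e ^+ 2) n%:R) i; move: Le2; rewrite mulrC => Le.
have -> : e ^+ 2 * (L / 2) * n%:R^-1 = e ^+ 2 * L * n%:R^-1 / 2 by ring.
by rewrite Le; lra.
Qed.

Lemma expR_level_rho : expR (c * level_rho l) = n%:R / level_time l / 2 ^+ n.
Proof.
rewrite /level_rho mulrC divfK ?gt_eqF// !expRD lnK ?posrE// /level_time (expRN (c * expR l)) invrK.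
by rewrite -/n expRN expRM_natr expRc.
Qed.

Lemma expRN_level_rho : expR (- (c * level_rho l)) <= 2 * e.
Proof.
rewrite expRN expR_level_rho !invfM !invrK.
have -> : n%:R^-1 * level_time l * 2 ^+ n = n%:R^-1 * tau by rewrite -mulrA (mulrC (level_time l)).
have /andP[h1 h2] := tau_bounds.
have t0 : 0 <= tau by rewrite mulr_ge0 ?exprn_ge0// ltW// expR_gt0.
apply: (@le_trans _ _ (2 * e ^+ 2 * tau)); first by rewrite ler_wpM2r.
have -> : 2 * e ^+ 2 * tau = 2 * e * (tau * e) by ring.
by rewrite ler_piMr// mulr_ge0// ltW.
Qed.

Lemma level_rho_ge1 : 1 <= level_rho l.
Proof.
have := expRN_level_rho; rewrite leNgt => h; rewrite leNgt; apply/negP => r1.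
move: h; rewrite -leNgt => h.
have : 2^-1 <= expR (- (c * level_rho l)).
  rewrite -expRc -expRN ler_expR lerN2 ger_pMr//; exact: ltW.
have e1 := e_small; lra.
Qed.

Lemma rate_sum_err : 0 <= rate_sum J_weight n * level_time l / n.+1%:R <= 2 * e.
Proof.
have t0 : 0 < level_time l := expR_gt0 _.
apply/andP; split.
  rewrite divr_ge0// mulr_ge0 ?(ltW t0)//.
  by apply: sumr_ge0 => j _; rewrite invr_ge0 ltW// J_weight_gt0.
have /andP[h1 h2] := tau_bounds.
have T0 : 0 <= tau by rewrite mulr_ge0 ?exprn_ge0// ltW.
have nL : L <= n.+1%:R.
  by have /andP[h3 h4] := level_bounds; have /andP[h5 _] := l_c; rewrite -natr1; lra.
rewrite ler_pdivrMr//.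
apply: (@le_trans _ _ (2 * tau)).
  by rewrite /tau mulrA -exprS ler_wpM2r ?(ltW t0)// rate_sum_J_weight_le.
apply: (@le_trans _ _ (2 * e * L)); last by rewrite ler_wpM2l// mulr_ge0// ltW.
have -> : tau = tau * e * (e * L) by move: Le2 => Le; rewrite -[LHS]mulr1 -Le; ring.
by rewrite -[2 * e * L]mulrA ler_wpM2l// ler_piMl// mulr_ge0// ltW.
Qed.

(** The product is 16 (1/n + a_n/t), with a_n/t <= 1/tau <= 2e and 1/n <= 2e^2; as e <= 1/51, the
    second part costs less than e. *)
Lemma tail_err : 0 <= 16 / n%:R * (1 + n%:R / level_time l * J_weight n) <= 33 * e.
Proof.
have t0 : 0 < level_time l := expR_gt0 _.
have w0 := @J_weight_gt0 R n.
have -> : 16 / n%:R * (1 + n%:R / level_time l * J_weight n) = 16 * (n%:R^-1 + J_weight n / level_time l).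
  by move: (lt0r_neq0 N0) (lt0r_neq0 t0) => z1 z2; field; rewrite z1 z2.
have i0 : 0 <= n%:R^-1 :> R by rewrite invr_ge0 ltW.
apply/andP; split; first by rewrite mulr_ge0// addr_ge0// divr_ge0// ltW.
have /andP[h1 h2] := tau_bounds.
have : J_weight n / level_time l <= 2 * e.
  rewrite ler_pdivrMr//; apply: le_trans (J_weight_le n) _.
  rewrite -[leLHS]mul1r ler_pdivrMr ?exprn_gt0//.
  have -> : 2 * e * level_time l * 2 ^+ n = 2 * (tau * e) by rewrite /tau; move: (2 ^+ n) (level_time l) => x y; ring.
  lra.
move: invn_le e_small; rewrite expr2; move: (J_weight n / level_time l) n%:R^-1 e0 => a b z0.
nra.
Qed.

Lemma exp2_err : 0 <= (2 ^- n : R) <= e.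
Proof.
rewrite invr_ge0 exprn_ge0//=; apply: (@le_trans _ _ n%:R^-1).
  by rewrite lef_pV2 ?posrE ?exprn_gt0// -natrX ler_nat ltnW// ltn_expl.
by apply: le_trans invn_le _; move: e_small e0; rewrite expr2; move: e => z; nra.
Qed.

Lemma level_ratio : `|n%:R / L - 1| <= 1 / 2 /\
  [/\ L * (n%:R / L - 1) ^+ 2 <= 16 * e, `|n%:R / L - 1| <= 16 * e &
      l * `|n%:R / L - 1| <= 16 * e].
Proof.
set u := n%:R / L - 1.
have uL : L * `|u| = `|n%:R - L|.
  rewrite -{1}(gtr0_norm L0) -normrM; congr `|_|.
  by rewrite /u mulrBr mulr1 mulrCA divff ?gt_eqF// mulr1.
have ue : `|u| <= (l + 1) * e ^+ 2.
  have -> : `|u| = (L * `|u|) * e ^+ 2 by rewrite mulrAC Le2 mul1r.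
  by rewrite uL ler_wpM2r ?sqr_ge0// level_dist.
have b1 : (l + 1) * ((l + 1) * e ^+ 2) <= 16 * e.
  have -> : (l + 1) * ((l + 1) * e ^+ 2) = (l + 1) ^+ 2 * e * e by ring.
  by rewrite ler_wpM2r// ltW.
have u0 := normr_ge0 u; have l1 := l100; have e1 := e0; have e2 := e_small.
have b2 : (l + 1) * `|u| <= 16 * e by apply: le_trans b1; rewrite ler_wpM2l//; lra.
split; last split.
- move: b2 u0; move: (`|u|) => v; nra.
- rewrite -real_normK ?num_real// expr2 mulrA uL.
  by apply: le_trans b2; rewrite ler_wpM2r// level_dist.
- move: b2 u0; move: (`|u|) => v; nra.
- move: b2 u0; move: (`|u|) => v; nra.
Qed.

Lemma shift_err : `|ln (n%:R / L) / c| <= 64 * e.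
Proof.
have [u2 [_ h _]] := level_ratio.
have [h1 _] := ln1D_bounds u2; move: h1; rewrite addrC subrK => h1.
have /andP[c1 _] := @ln2_bounds R; rewrite -/c in c1.
have l1 := l100; have e1 := e0; have c1' := c0.
rewrite normrM normfV (gtr0_norm c0) ler_pdivrMr//.
apply: le_trans h1 _; have := e0; move: h; move: (`|_|) => v; nra.
Qed.

(** With u = n/L - 1 and y = ln (1 + u), the exponent is L (u - y) - l y / c - y^2 / (2c). The terms
    of order L u cancel; the three parts cost 32 e, 64 e and 64 e. *)
Lemma exponent_err (ps := L + l / c) (del := ln (n%:R / L) / c) :
  `|n%:R - L - c * ps * del - c * del ^+ 2 / 2| <= 160 * e.
Proof.
have [u2 [h1 h2 h3]] := level_ratio.
have [g1 g2] := ln1D_bounds u2; move: g1 g2; rewrite addrC subrK.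
have E : n%:R - L = L * (n%:R / L - 1).
  by rewrite mulrBr mulr1 mulrCA divff ?gt_eqF// mulr1.
rewrite E /ps /del; move: u2 h1 h2 h3.
move: (n%:R / L - 1) (ln (n%:R / L)) => u y u2 h1 h2 h3 g1 g2.
have /andP[c1 _] := @ln2_bounds R; rewrite -/c in c1.
have l1 := l100; have e1 := e0; have c1' := c0.
have -> : L * u - c * (L + l / c) * (y / c) - c * (y / c) ^+ 2 / 2 =
   L * (u - y) - (l * y) * c^-1 - (y ^+ 2) * c^-1 / 2.
  by field; exact: lt0r_neq0.
have ci2 : c^-1 <= 2 by rewrite -[leRHS]invrK lef_pV2 ?posrE//; lra.
have ci0 : 0 <= c^-1 by rewrite invr_ge0 ltW.
have k1 : `|L * (u - y)| <= 32 * e.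
  rewrite normrM (gtr0_norm L0); apply: le_trans (ler_wpM2l (ltW L0) g2) _.
  by rewrite mulrCA; lra.
have k2 : `|l * y * c^-1| <= 64 * e.
  rewrite !normrM (ger0_norm ci0) (@ger0_norm _ l); last lra.
  apply: (@le_trans _ _ (l * `|y| * 2)).
    by rewrite ler_wpM2l// mulr_ge0//; lra.
  have : l * `|y| <= l * (2 * `|u|) by rewrite ler_wpM2l//; lra.
  by rewrite mulrCA; lra.
have k3 : `|y ^+ 2 * c^-1 / 2| <= 64 * e.
  rewrite normrM (normrM (y ^+ 2)) normrX (ger0_norm ci0).
  have -> : `|2^-1| = 2^-1 :> R by rewrite ger0_norm.
  have : `|y| ^+ 2 <= 2 * `|u| by rewrite expr2; have := normr_ge0 y; move: u2 g1; move: (`|y|) (`|u|) => a b; nra.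
  move: ci0 ci2; have := sqr_ge0 `|y|; move: (`|y| ^+ 2) c^-1 => a b; nra.
by rewrite (le_trans (ler_normB _ _))// (le_trans (lerD (ler_normB _ _) (lexx _)))//; lra.
Qed.

End at_level.
End estimates.

(** * Passage to the limit in l = log log_2 (1/t), then in t *)

Section limits.
Context {R : realType}.
Let c : R := ln 2.

Let c0 : 0 < c. Proof. by rewrite ln_gt0// ltr1n. Qed.

Lemma cvg_level_err : @level_err R @ +oo --> 0.
Proof.
have h : (fun l : R => l / 2) @ +oo --> +oo.
  by apply/cvgryPge => A; near=> l; rewrite ler_pdivlMr//; near: l; apply: nbhs_pinfty_ge; exact: num_real.
exact: (cvg_comp _ _ h (@cvgr_expR R)).
Unshelve. all: by end_near. Qed.

Lemma cvg_level_err_bound (f : R -> R) (b C : R) :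
  (forall l, 100 <= l -> `|f l - b| <= C * level_err l) -> f @ +oo --> b.
Proof.
move=> h; apply: (@squeeze_cvgr _ _ _ _ (fun l => b - C * level_err l) (fun l => b + C * level_err l)).
- near=> l; have l100 : 100 <= l by near: l; apply: nbhs_pinfty_ge; exact: num_real.
  by rewrite -ler_distl h.
- rewrite -[X in _ --> X]subr0; apply: cvgB; first exact: cvg_cst.
  by rewrite -[X in _ --> X](mulr0 C); apply: cvgM; [exact: cvg_cst|exact: cvg_level_err].
- rewrite -[X in _ --> X]addr0; apply: cvgD; first exact: cvg_cst.
  by rewrite -[X in _ --> X](mulr0 C); apply: cvgM; [exact: cvg_cst|exact: cvg_level_err].
Unshelve. all: by end_near. Qed.

Lemma cvg_level : (level : R -> nat) @ +oo --> \oo.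
Proof.
apply/cvgnyPge => A; near=> l.
have l100 : 100 <= l by near: l; apply: nbhs_pinfty_ge; exact: num_real.
have lA : 2 * A%:R <= l by near: l; apply: nbhs_pinfty_ge; exact: num_real.
rewrite -(ler_nat R); apply: le_trans (level_ge_half l100).
by have := @expR_ge1Dx R l; lra.
Unshelve. all: by end_near. Qed.

Lemma cvg_log_log : (fun t : R => ln (ln (1 / t) / c)) @ 0^'+ --> +oo.
Proof.
apply/cvgryPge => A; near=> t.
have t0 : 0 < t by near: t; exact: nbhs_right_gt.
have tA : t <= expR (- (c * expR A)).
  by near: t; apply: nbhs_right_ltW; exact: expR_gt0.
have h : expR A <= ln (1 / t) / c.
  rewrite ler_pdivlMr// mulrC -[leLHS]expRK ler_ln ?posrE ?expR_gt0 ?divr_gt0//.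
  by rewrite div1r -[leLHS]invrK lef_pV2 ?posrE ?invr_gt0 ?expR_gt0// -expRN.
by rewrite -[leLHS]expRK ler_ln ?posrE ?expR_gt0//; apply: lt_le_trans h; exact: expR_gt0.
Unshelve. all: by end_near. Qed.

Lemma level_timeK (t : R) : 0 < t < 1 -> level_time (ln (ln (1 / t) / c)) = t.
Proof.
move=> /andP[t0 t1]; rewrite /level_time -/c lnK; last first.
  by rewrite posrE divr_gt0// ln_gt0// div1r invf_gt1.
by rewrite mulrCA divff ?gt_eqF// mulr1 div1r lnV ?posrE// opprK lnK.
Qed.

Context (d : measure_display) (T : measurableType d).
Variables (P : probability T R) (X : nat -> {RV P >-> R}).
Hypothesis X_indep : independent_RVs X.
Hypothesis X_exp : forall j, exponential_RV 1 (X j).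

Let p t := fine (P [set w | (J X w <= t%:E)%E]).
Let W (l : R) := rate_prod J_weight (level l) * fpow (level l) (level_time l) / euler (level_rho l).

Let W_gt0 l : 100 <= l -> 0 < W l.
Proof.
move=> l100; rewrite divr_gt0 ?(lt_le_trans _ (euler_ge1 _))//.
rewrite mulr_gt0//; first by apply: prodr_gt0 => j _; rewrite invr_gt0 J_weight_gt0.
by rewrite divr_gt0 ?exprn_gt0 ?expR_gt0// ltr0n fact_gt0.
Qed.

Lemma cvg_cdf_ratio : (fun l => p (level_time l) / W l) @ +oo --> (1 : R).
Proof.
(* 36 = 2 + 33 + 1 adds up the head, tail and Euler product errors. *)
apply: (@cvg_level_err_bound _ 1 36) => l l100.
have e51 : level_err l <= 1 / 51.
  have h := @expR_ge1Dx R (l / 2).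
  by rewrite /level_err expRN div1r lef_pV2 ?posrE ?expR_gt0//; lra.
have e0 : 0 <= level_err l := expR_ge0 _.
have e1 : level_err l <= 1 by lra.
have e2 : 2 * level_err l <= 1 by lra.
have e33 : 33 * level_err l <= 1 by lra.
have near1 z : z <= 1 -> 1 - 36 * level_err l <= z -> `|z - 1| <= 36 * level_err l.
  by move=> z1 z2; rewrite ler_norml; apply/andP; split; lra.
have e36 : 1 - 36 * level_err l <= 1 - (2 * level_err l + 33 * level_err l + level_err l) by lra.
have /andP[r0 r1] := rate_sum_err l100; have /andP[q0 q1] := tail_err l100.
have /andP[v0 v1] := exp2_err l100.
have rl := le_trans r1 e2; have ql := le_trans q1 e33.
have vl := le_trans v1 e1.
have /andP[lo hi] := J_sandwich X_indep X_exp (level_gt0 l100) (expR_gt0 _ : 0 < level_time l)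
  (expR_level_rho l100) rl ql.
have W0 := W_gt0 l100.
have h1 : p (level_time l) / W l <= 1 by rewrite ler_pdivrMr// mul1r.
have h2 : 1 - 36 * level_err l <= p (level_time l) / W l.
  rewrite ler_pdivlMr//; apply: le_trans lo; rewrite ler_wpM2r ?(ltW W0)//.
  apply: le_trans (prod3_ge _ _ _); rewrite ?r0 ?q0 ?v0//.
  by apply: le_trans e36 _; rewrite lerD2l lerN2 !lerD.
exact: near1.
Qed.

Lemma cvg_J_ratio : (fun l => p (level_time l) / J_asymp (level_time l)) @ +oo --> (1 : R).
Proof.
pose ps (l : R) : R := expR l + l / c.
pose del (l : R) : R := ln ((level l)%:R / expR l) / c.
pose x (l : R) : R := level_rho l - 1 / 2.
pose f1 (l : R) : R := p (level_time l) / W l.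
pose f2 (l : R) : R := qpoch (level l) / qpoch_oo.
pose f3 (l : R) : R := Num.sqrt (2 * pi) / stirling (level l).
pose f4 (l : R) : R := expR (c * x l ^+ 2 / 2) * gsum c (x l) / (qpoch_oo * euler (level_rho l)).
pose f5 (l : R) : R := theta_sum c (ps l - 1 / 2) / theta_sum c (ps l + del l - 1 / 2).
pose f6 (l : R) : R := expR ((level l)%:R - expR l - c * ps l * del l - c * del l ^+ 2 / 2).
have E : \forall l \near +oo,
    f1 l * (f2 l * f3 l * f4 l * f5 l * f6 l) = p (level_time l) / J_asymp (level_time l).
  near=> l; have l100 : 100 <= l by near: l; apply: nbhs_pinfty_ge; exact: num_real.
  have psE : expR l + ln (expR l) / c = ps l by rewrite expRK.
  have r1 := level_rho_ge1 l100.
  have ps2 : 1 / 2 <= expR l + ln (expR l) / c.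
    rewrite psE; have h1 := @expR_ge1Dx R l.
    have h2 : 0 <= l / c by apply: divr_ge0; [lra|exact: ltW].
    by rewrite /ps; lra.
  have x0 : 0 <= level_rho l - 1 / 2 by lra.
  have rE : c * level_rho l = ln (level l)%:R + c * expR l - c * (level l)%:R.
    by rewrite /level_rho mulrC divfK// gt_eqF.
  have := asymptotic_ratio (level_gt0 l100) (expR_gt0 l) ps2 x0 rE.
  rewrite -/c psE -/(level_time l) -/(W l) -/(del l) -/(x l).
  rewrite -/(f2 l) -/(f3 l) -/(f4 l) -/(f5 l) -/(f6 l) => <-.
  by rewrite /f1 mulrA mulfVK// gt_eqF// W_gt0.
apply: cvg_trans (near_eq_cvg E) _.
have q0 := @qpoch_oo_gt0 R.
have c1 : f1 @ +oo --> (1 : R) by exact: cvg_cdf_ratio.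
have c2 : f2 @ +oo --> (1 : R).
  rewrite -[X in _ --> X](divff (lt0r_neq0 q0)); apply: cvgM; last exact: cvg_cst.
  exact: (cvg_comp _ _ cvg_level (@cvg_qpoch R)).
have c3 : f3 @ +oo --> (1 : R).
  have s0 : stirling_cst != 0 :> R by rewrite gt_eqF// stirling_cst_gt0.
  rewrite -[X in _ --> X](divff s0) {1}stirling_cstE; apply: cvgM; first exact: cvg_cst.
  by apply: cvgV => //; exact: (cvg_comp _ _ cvg_level (@cvg_stirling R)).
have c4 : f4 @ +oo --> (1 : R).
  have [K K0 HK] := @euler_gsum R.
  apply: (@cvg_level_err_bound _ 1 (K * 2)) => l l100.
  have D0 : 0 < qpoch_oo * euler (level_rho l) by rewrite mulr_gt0// (lt_le_trans _ (euler_ge1 _)).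
  have /andP[h1 h2] := HK _ (level_rho_ge1 l100).
  have g1 : 1 <= f4 l by rewrite ler_pdivlMr// mul1r.
  have g2 : f4 l <= 1 + K * expR (- (c * level_rho l)).
    rewrite ler_pdivrMr//; apply: le_trans h2 _.
    by rewrite mulrC.
  have g3 : K * expR (- (c * level_rho l)) <= K * (2 * level_err l) by rewrite ler_wpM2l// expRN_level_rho.
  by rewrite ger0_norm ?subr_ge0//; lra.
have c5 : f5 @ +oo --> (1 : R).
  (* Lipschitz constant 8, shift at most 64 e, and a denominator of at least 3/4 >= 1/2. *)
  apply: (@cvg_level_err_bound _ 1 (16 * 64)) => l l100.
  have h := theta_sum_lipschitz (ps l - 1 / 2) (ps l + del l - 1 / 2).
  have t1 := theta_sum_ge (ps l + del l - 1 / 2).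
  have := shift_err l100; rewrite -/(del l) => hd.
  have E1 : (ps l - 1 / 2) - (ps l + del l - 1 / 2) = - del l by ring.
  rewrite E1 normrN in h.
  have t0 : 0 < theta_sum c (ps l + del l - 1 / 2) by rewrite (lt_le_trans _ t1).
  have -> : f5 l - 1 = (theta_sum c (ps l - 1 / 2) - theta_sum c (ps l + del l - 1 / 2)) /
      theta_sum c (ps l + del l - 1 / 2).
    by rewrite mulrBl divff// gt_eqF.
  rewrite normrM normfV (gtr0_norm t0) ler_pdivrMr//.
  apply: le_trans h _; have e0 := expR_ge0 (- (l / 2)); rewrite -/(level_err l) in e0.
  move: hd t1; rewrite -/c; move: (`|_|) (theta_sum _ _) (level_err l) e0 => a b e e0 ae tb.
  nra.
have c6 : f6 @ +oo --> (1 : R).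
  rewrite -[X in _ --> X](@expR0 R).
  apply: (cvg_comp _ expR _ (@continuous_expR R 0)).
  by apply: (@cvg_level_err_bound _ 0 160) => l l100; rewrite subr0; exact: exponent_err.
have := cvgM c1 (cvgM (cvgM (cvgM (cvgM c2 c3) c4) c5) c6).
by rewrite !mulr1; apply.
Unshelve. all: by end_near. Qed.

End limits.

Theorem theorem5p2 (d : measure_display) (T : measurableType d)
    (R : realType) (P : probability T R) (X : nat -> {RV P >-> R})
    (X_indep : independent_RVs X)
    (X_exp : forall j : nat, exponential_RV 1 (X j)) :
  (fun t : R => fine (P [set w | (J X w <= t%:E)%E]) / J_asymp t)
    @ 0^'+ --> (1 : R).
Proof.
have h := cvg_comp _ _ (@cvg_log_log R) (cvg_J_ratio X_indep X_exp).
apply: cvg_trans h; apply: near_eq_cvg; near=> t.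
by rewrite /= level_timeK//; apply/andP; split; near: t; [exact: nbhs_right_gt|exact: nbhs_right_lt].
Unshelve. all: by end_near. Qed.
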